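(* Let $n\ge 3$ and suppose that $L \in \mathcal{K}^n$ is origin-symmetric and $\mathrm{SO}(n - 1)$ invariant. Then $$|a_k^n[L]| < \frac{a_0^n[L]}{(k-1)(n+k-1)}$$ for every $k > 2$ and $$|a_2^n[L]| \leq \frac{a_0^n[L]}{n+1},$$ where this last inequality is also strict if $L$ is of class $C^2_+$.
   Context: $\mathcal{K}^n$ is the space of convex bodies (compact convex sets) in $\mathbb{R}^n$; $h(L,u)=\max\{u\cdot x: x\in L\}$ is the support function. $\mathrm{SO}(n-1)$ denotes the stabilizer in $\mathrm{SO}(n)$ of a fixed pole $\bar e\in\mathbb{S}^{n-1}$. Define $a_k^n[L]=\int_{\mathbb{S}^{n-1}}h(L,u)P_k^n(\bar e\cdot u)\,du$ (integration with respect to spherical Lebesgue measure), where $P_k^n$ is the Legendre polynomial of dimension $n$ and degree $k$, $P_k^n(t)= (-1)^k \frac{\Gamma(\frac{n - 1}{2})}{2^k \Gamma( \frac{n - 1}{2} + k)} (1 - t^2)^{-\frac{n-3}{2}}\left(\frac{d}{dt}\right)^k(1 - t^2)^{\frac{n-3}{2}+k}$ (so $P_k^n(1)=1$). $L$ is of class $C^2_+$ if its boundary is a $C^2$ submanifold of $\mathbb{R}^n$ with everywhere positive Gaussian curvature; equivalently, $h(L,\cdot)$ (as a 1-homogeneous function) is $C^2$ on $\mathbb{R}^n\setminus\{o\}$ and its Hessian restricted to $u^\perp$ is positive definite at each $u\in\mathbb{S}^{n-1}$.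
   Formalization: The strict inequality for k > 2 is stated for L different from {o}, since for L = {o} all coefficients vanish and it would read 0 < 0; convex bodies are taken nonempty. *)

(* Defs.v *)
From HB Require Import structures.
From mathcomp Require Import all_boot all_order all_algebra.
From mathcomp Require Import all_classical all_reals all_analysis.

Set Implicit Arguments.
Unset Strict Implicit.
Unset Printing Implicit Defensive.
Import Order.TTheory GRing.Theory Num.Theory.
Import numFieldNormedType.Exports.
Local Open Scope classical_set_scope.
Local Open Scope ring_scope.

(* Points of R^n are row vectors 'rV[R]_n, which carry the topology and the
   vector space structure; the measures live on n.-tuple R, which carries the
   Borel (= product) sigma-algebra.  [rowt] and [trow] identify the two. *)

Section euclidean.
Context {R : realType} {n : nat}.
Implicit Types x y : 'rV[R]_n.

Definition dot x y : R := \sum_(i < n) x 0 i * y 0 i.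

(* The norm `|x| of the library on 'rV[R]_n is the sup norm. *)
Definition enorm x : R := Num.sqrt (dot x x).

Definition rowt (t : n.-tuple R) : 'rV[R]_n := \row_i tnth t i.

Definition trow x : n.-tuple R := [tuple x 0 i | i < n].

End euclidean.

Section lebesgue_tuple.
Context {R : realType}.
Local Open Scope ereal_scope.

Definition tcons n (p : measurableTypeR R * n.-tuple R) : n.+1.-tuple R :=
  [tuple of p.1 :: p.2].

(* n-dimensional Lebesgue measure, as an iterated product *)
Fixpoint lebesgue_tuple n : set (n.-tuple R) -> \bar R :=
  match n with
  | 0 => \d_ [tuple]
  | m.+1 => pushforward (@lebesgue_measure R \x @lebesgue_tuple m) (@tcons m)
  end.

Lemma measurable_tcons n : measurable_fun [set: _] (@tcons n).
Proof. exact: measurable_cons. Qed.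

Lemma lebesgue_tuple_sigma_finite n :
  exists mu : {sigma_finite_measure set (n.-tuple R) -> \bar R},
    @lebesgue_tuple n = mu.
Proof.
elim: n => [|n [mu muE]]; first by exists \d_ ([tuple] : 0.-tuple R).
pose l : {sigma_finite_measure set (measurableTypeR R) -> \bar R} :=
  @lebesgue_measure R.
pose nu : {measure set (measurableTypeR R * n.-tuple R)%type -> \bar R} :=
  (l \x mu).
pose tau := measure_function_pushforward__canonical__measure_function_Measure
   nu (@measurable_tcons n).
have /sigma_finiteP[F [TF ndF Foo]] := sigma_finiteT l.
have /sigma_finiteP[G [TG ndG Goo]] := sigma_finiteT mu.
have sf : sigma_finite [set: n.+1.-tuple R] tau.
  exists (fun i => (fun t : n.+1.-tuple R => thead t) @^-1` F i `&`
                   (fun t : n.+1.-tuple R => [tuple of behead t] : n.-tuple R) @^-1` G i).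
    apply/esym; rewrite -subTset => t _.
    have [j _ Fj] : (\bigcup_i F i) (thead t) by rewrite -TF.
    have [k _ Gk] : (\bigcup_i G i) ([tuple of behead t] : n.-tuple R) by rewrite -TG.
    exists (maxn j k) => //; split => /=.
      by move: Fj; exact/subsetPset/ndF/leq_maxl.
    by move: Gk; exact/subsetPset/ndG/leq_maxr.
  move=> i; have [mF Fi] := Foo i; have [mG Gi] := Goo i; split.
    apply: measurableI.
      by rewrite -[X in measurable X]setTI; exact: measurable_tnth.
    by rewrite -[X in measurable X]setTI; exact: measurable_behead.
  rewrite /tau /= /pushforward.
  rewrite (_ : _ @^-1` _ = F i `*` G i).
    by rewrite /nu /= product_measure1E// lte_mul_pinfty// ge0_fin_numE.
  apply/seteqP; split => -[x t] [/= Fx Gt]; split => //=.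
    by move: Gt; congr (G i _); exact: val_inj.
  by move: Gt; congr (G i _); exact: val_inj.
pose H := Measure_isSigmaFinite.Build _ _ _ (tau : set _ -> \bar R) sf.
pose tau' : {sigma_finite_measure set _ -> \bar R} := HB.pack (tau : set _ -> \bar R) (Measure.class tau) H.
by exists tau'; rewrite /= muE.
Qed.

Let lebesgue_tuple0 n : @lebesgue_tuple n set0 = 0.
Proof. by have [mu ->] := lebesgue_tuple_sigma_finite n; exact: measure0. Qed.

Let lebesgue_tuple_ge0 n A : 0 <= @lebesgue_tuple n A.
Proof. by have [mu ->] := lebesgue_tuple_sigma_finite n; exact: measure_ge0. Qed.

Let lebesgue_tuple_additive n : semi_sigma_additive (@lebesgue_tuple n).
Proof.
have [mu ->] := lebesgue_tuple_sigma_finite n.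
exact: measure_semi_sigma_additive.
Qed.

HB.instance Definition _ n := isMeasure.Build _ _ _ (@lebesgue_tuple n)
  (@lebesgue_tuple0 n) (@lebesgue_tuple_ge0 n) (@lebesgue_tuple_additive n).

Let lebesgue_tupleT n : sigma_finite setT (@lebesgue_tuple n).
Proof.
by have [mu ->] := lebesgue_tuple_sigma_finite n; exact: sigma_finiteT.
Qed.

HB.instance Definition _ n := Measure_isSigmaFinite.Build _ _ _
  (@lebesgue_tuple n) (@lebesgue_tupleT n).

End lebesgue_tuple.

Section sphere.
Context {R : realType} (n : nat).

Definition sphere : set (n.-tuple R) := [set u | enorm (rowt u) = 1].

Definition normalize (t : n.-tuple R) : n.-tuple R :=
  trow ((enorm (rowt t))^-1 *: rowt t).

(* { r u | 0 < r <= 1, u \in A } for A contained in the sphere *)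
Definition cone (A : set (n.-tuple R)) : set (n.-tuple R) :=
  [set t | 0 < enorm (rowt t) <= 1] `&` normalize @^-1` A.

(* Spherical Lebesgue measure, through polar coordinates:
   sigma(A) = n * vol { r u | 0 < r <= 1, u \in A } *)
Definition sphere_measure (A : set (n.-tuple R)) : \bar R :=
  (n%:R%:E * lebesgue_tuple (cone A))%E.

Lemma measurable_enorm : measurable_fun [set: n.-tuple R] (enorm \o rowt).
Proof.
apply: measurableT_comp.
  by apply: measurable_realfun.continuous_measurable_fun; exact: sqrt_continuous.
apply: measurable_sum => i; rewrite /rowt/=.
by under eq_fun do rewrite !mxE; apply: measurable_realfun.measurable_funM; exact: measurable_tnth.
Qed.

Lemma measurable_normalize : measurable_fun [set: n.-tuple R] normalize.
Proof.
apply/measurable_fun_tnthP => i; rewrite /normalize.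
rewrite (_ : _ \o _ = fun t => (enorm (rowt t)) `^ (-1) * tnth t i); last first.
  by apply/funext => t /=; rewrite tnth_mktuple !mxE powR_inv1// sqrtr_ge0.
apply: measurable_realfun.measurable_funM; last exact: measurable_tnth.
by apply: (measurableT_comp (measurable_realfun.measurable_powR _)); exact: measurable_enorm.
Qed.

Lemma measurable_cone A : measurable A -> measurable (cone A).
Proof.
move=> mA; apply: measurableI; last first.
  by rewrite -[X in measurable X]setTI; exact: measurable_normalize.
have -> : [set t : n.-tuple R | 0 < enorm (rowt t) <= 1] =
    (enorm \o rowt) @^-1` `]0, 1].
  by apply/funext => t /=; rewrite in_itv.
by rewrite -[X in measurable X]setTI; exact: measurable_enorm.
Qed.

Let sphere_measure0 : sphere_measure set0 = 0%E.
Proof.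
by rewrite /sphere_measure /cone preimage_set0 setI0 measure0 mule0.
Qed.

Let sphere_measure_ge0 A : (0 <= sphere_measure A)%E.
Proof. by rewrite mule_ge0// lee_fin. Qed.

Let sphere_measure_additive : semi_sigma_additive sphere_measure.
Proof.
move=> F mF tF mUF; rewrite /sphere_measure.
have -> : cone (\bigcup_i F i) = \bigcup_i cone (F i).
  by rewrite /cone preimage_bigcup setI_bigcupr.
under eq_fun do rewrite -ge0_sume_distrr//.
apply: cvgeZl => //; apply: measure_semi_sigma_additive.
- by move=> i; exact: measurable_cone.
- apply/trivIsetP => i j _ _ ij; rewrite /cone setIACA setIid -preimage_setI.
  by move/trivIsetP : tF => /(_ _ _ I I ij) ->; rewrite preimage_set0 setI0.
- by apply: bigcup_measurable => i _; exact: measurable_cone.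
Qed.

HB.instance Definition _ := isMeasure.Build _ _ _ sphere_measure
  sphere_measure0 sphere_measure_ge0 sphere_measure_additive.

End sphere.

Section convex_bodies.
Context {R : realType} {n : nat}.
Implicit Types (L : set 'rV[R]_n) (e u : 'rV[R]_n).

Definition convex_body L :=
  [/\ L !=set0, compact L & convex_set (L : set (convex_lmodType 'rV[R]_n))].

Definition support_function L u : R := sup [set dot u x | x in L].

Definition origin_symmetric L := forall x, L x -> L (- x).

Definition special_orthogonal : set 'M[R]_n :=
  [set A | A *m A^T = 1%:M /\ \det A = 1].

(* SO(n - 1), seen as the stabilizer of the pole e in SO(n) *)
Definition pole_stabilizer e : set 'M[R]_n :=
  [set A | special_orthogonal A /\ e *m A = e].

Definition SO_invariant e L :=
  forall A, pole_stabilizer e A -> [set x *m A | x in L] = L.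

Definition partial (i : 'I_n) (f : 'rV[R]_n -> R) : 'rV[R]_n -> R :=
  fun x => 'D_(delta_mx 0 i) f x.

Definition C1_on (U : set 'rV[R]_n) (f : 'rV[R]_n -> R) :=
  forall i x, U x ->
    derivable f x (delta_mx 0 i) /\ {for x, continuous (partial i f)}.

Definition C2_on (U : set 'rV[R]_n) (f : 'rV[R]_n -> R) :=
  C1_on U f /\ forall i, C1_on U (partial i f).

Definition hessian (f : 'rV[R]_n -> R) x : 'M[R]_n :=
  \matrix_(i, j) partial j (partial i f) x.

(* Class C^2_+, in terms of the support function: it is C^2 away from the
   origin and its Hessian at each unit vector u is positive definite on the
   orthogonal complement of u. *)
Definition C2_plus L :=
  C2_on [set x | x != 0] (support_function L) /\
  forall u, enorm u = 1 -> forall v, v != 0 -> dot u v = 0 ->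
    0 < dot (v *m hessian (support_function L) u) v.

End convex_bodies.

Section legendre.
Context {R : realType}.

(* Euler's Gamma function (for x > 0) *)
Definition Gamma (x : R) : R :=
  \int[lebesgue_measure]_(t in `]0, +oo[) (t `^ (x - 1) * expR (- t)).

(* Meaningful for -1 < t < 1 only: outside, `^ is not a genuine real power. *)
Definition rodrigues (n k : nat) (t : R) : R :=
  (-1) ^+ k * (Gamma ((n%:R - 1) / 2) /
               (2 ^+ k * Gamma ((n%:R - 1) / 2 + k%:R))) *
  (1 - t ^+ 2) `^ (- ((n%:R - 3) / 2)) *
  derive1n k (fun s : R => (1 - s ^+ 2) `^ ((n%:R - 3) / 2 + k%:R)) t.

(* The Legendre polynomial P_k^n on [-1, 1]: the continuous extension of the
   Rodrigues formula to the end points. *)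
Definition legendre (n k : nat) (t : R) : R :=
  lim (rodrigues n k s @[s --> within `]-1, 1[ (nbhs t)]).

End legendre.

(* a_k^n[L] with pole e *)
Definition legendre_coef {R : realType} {n : nat} (e : 'rV[R]_n) (k : nat)
    (L : set 'rV[R]_n) : R :=
  \int[@sphere_measure R n]_(u in @sphere R n)
    (support_function L (rowt u) * legendre n k (dot e (rowt u))).

(* Main.v *)
Require Import Defs.
From HB Require Import structures.
From mathcomp Require Import all_boot all_order all_algebra.
From mathcomp Require Import all_classical all_reals all_analysis.
From mathcomp Require Import measurable_realfun.
From mathcomp Require Import complex ring lra.

Set Implicit Arguments.
Unset Strict Implicit.
Unset Printing Implicit Defensive.
Import Order.TTheory GRing.Theory Num.Theory.
Import numFieldNormedType.Exports.
Local Open Scope classical_set_scope.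
Local Open Scope ring_scope.

(** Why the theorem holds.  Write n = m + 3 and let v be a unit vector orthogonal
    to e.  For a body of revolution, h(L, u) depends on e . u only, so everything is
    carried by the function f(s) = h(sin s e + cos s v) on the circle ([prof]), and
    the projection of the spherical measure to the axis ([sphere_zonal]) gives,
    with one constant C > 0,
      a_k = C * int_{-pi/2}^{pi/2} f(s) P_k(sin s) cos^{n-2} s ds
    ([legendre_coef_prof]).  The bounds on a_k come from the properties of f shared
    by all support functions of origin-symmetric planar bodies: it is pi-periodic,
    Lipschitz, and f(a+d) + f(a-d) >= 2 cos d f(a).

    Such an f is a limit of positive combinations of the functions |sin(s - a)|
    (a planar symmetric body is a zonoid).  Hence int f rho >= 0 as soon as
    int |sin(s - a)| rho(s) ds >= 0 for every a
    ([sine_transform_pairing_ge0]).  Take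
    rho(s) = (D p)(sin s) cos^{n-2} s, where
      D p = (n-1) p + (1-t^2) p'' - (n-1) t p'
    ([lap]) is the operator h -> (Laplacian + n - 1) h on zonal functions.  Its
    |sin| transform is 2 Lam_a(p), where
      Lam_a(p) = p(sin a) cos^{n-2} a + (n-2) sin a int_0^a p(sin s) cos^{n-3} s ds
    ([sine_transform_lap]), and D P_k = - N_k P_k with N_k = (k-1)(n+k-1)
    ([lap_leg]).  Applied to p = c/(n-1) -+ P_k, this turns the bound
      (n-1) |Lam_a(P_k)| <= c Lam_a(1)   for all a                            (1)
    into N_k |a_k| <= c a_0 ([pairing_leg_ge0]).  For even k >= 4 the bound (1) holds
    with some c < 1 ([Lam_leg_bound]): Lam_a is a positive functional whose values
    on even powers satisfy a two-term recursion ([Lx_rec]), and the Laplace formula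
    P_k(t) = E (t + i Y sqrt(1-t^2))^k majorises |P_k| on [0, 1] by a polynomial of
    fixed low degree ([leg_le]).  For odd k, a_k = 0 since f is even.

    For k = 2 the two signs are different: one holds with c = 1/2 and the other only
    with c = 1.  Equality in the latter would need f to be proportional to |sin|.
    Under the smoothness assumption f(0) > 0 ([C2_plus_equator]): otherwise
    h(x) = h(e) |e . x|, whose Hessian vanishes at e.  Strictness then follows by
    comparing f with the multiple of |sin| which agrees with it at the zero of the
    weight ([pairing_leg1_lt]). *)

(** * Integrals of continuous functions over segments *)

Section segment_integral.
Context {R : realType}.
Implicit Types (f g F : R -> R) (a b c x : R).

Definition RI a b f : R := \int[@lebesgue_measure R]_(x in `[a, b]) f x.

Lemma integrable_segment a b f : continuous f ->
  (@lebesgue_measure R).-integrable `[a, b] (EFin \o f).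
Proof.
move=> cf; apply: continuous_compact_integrable; first exact: segment_compact.
exact: continuous_subspaceT.
Qed.

Lemma RI_FTC a b f F : a <= b -> continuous f ->
  (forall x, a <= x <= b -> is_derive x 1 F (f x)) -> RI a b f = F b - F a.
Proof.
rewrite le_eqVlt => /predU1P[<- _ _|ab cf dF].
  by rewrite subrr /RI set_itv1 Rintegral_set1.
have cF x : a <= x <= b -> {for x, continuous F}.
  by move=> /dF [dFx _]; apply/differentiable_continuous/derivable1_diffP.
rewrite /RI /Rintegral (continuous_FTC2 (F := F))//.
- exact: continuous_subspaceT.
- split.
  + by move=> x /[!in_itv]/= /andP[/ltW ax /ltW xb]; apply: ex_derive; apply: dF; rewrite ax xb.
  + by apply: cvg_at_right_filter; apply: cF; rewrite lexx ltW.
  + by apply: cvg_at_left_filter; apply: cF; rewrite lexx ltW.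
- move=> x /[!in_itv]/= /andP[/ltW ax /ltW xb].
  by rewrite derive1E; apply: derive_val; apply: dF; rewrite ax xb.
Qed.

Lemma primitive_ex c f : continuous f ->
  exists F, forall x, c < x -> is_derive x 1 F (f x).
Proof.
move=> cf; exists (fun x => RI c x f) => x cx.
have [dF dFE] := @continuous_FTC1_closed R f c x (x + 1) (ltr_pwDr ltr01 (lexx x)) (integrable_segment _ _ cf) cx (cf x).
by split; [exact: dF|rewrite -derive1E].
Qed.

Lemma RI_D a b f g : continuous f -> continuous g ->
  RI a b (fun x => f x + g x) = RI a b f + RI a b g.
Proof. by move=> cf cg; rewrite /RI RintegralD//; exact: integrable_segment. Qed.

Lemma RI_B a b f g : continuous f -> continuous g ->
  RI a b (fun x => f x - g x) = RI a b f - RI a b g.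
Proof. by move=> cf cg; rewrite /RI RintegralB//; exact: integrable_segment. Qed.

Lemma RI_Z a b r f : continuous f -> RI a b (fun x => r * f x) = r * RI a b f.
Proof. by move=> cf; rewrite /RI RintegralZl//; exact: integrable_segment. Qed.

Lemma eq_RI a b f g : (forall x, a <= x <= b -> f x = g x) -> RI a b f = RI a b g.
Proof. by move=> fg; apply: eq_Rintegral => x /[!inE]/=; rewrite in_itv/=; exact: fg. Qed.

Lemma RI_ge0 a b f : (forall x, a <= x <= b -> 0 <= f x) -> 0 <= RI a b f.
Proof. by move=> f0; apply: Rintegral_ge0 => x /=; rewrite in_itv/=; exact: f0. Qed.

Lemma le_RI a b f g : continuous f -> continuous g ->
  (forall x, a <= x <= b -> f x <= g x) -> RI a b f <= RI a b g.
Proof.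
move=> cf cg fg; apply: le_Rintegral; [by []|exact: integrable_segment..|].
by move=> x /=; rewrite in_itv/=; exact: fg.
Qed.

Lemma le_norm_RI a b f : continuous f -> `|RI a b f| <= RI a b (fun x => `|f x|).
Proof. by move=> cf; apply: le_normr_Rintegral => //; exact: integrable_segment. Qed.

Lemma RI_split a c b f : a <= c -> c <= b -> continuous f ->
  RI a b f = RI a c f + RI c b f.
Proof.
move=> ac cb cf; have [F dF] := primitive_ex (a - 1) cf.
have h u v : a <= u -> u <= v -> RI u v f = F v - F u.
  move=> au uv; apply: RI_FTC => // x /andP[ux _]; apply: dF.
  by rewrite (lt_le_trans _ (le_trans au ux))// ltrBlDr ltrDl.
by rewrite !h//; [lra|exact: le_trans cb].
Qed.

Lemma RI_gt0 a b f x : a < b -> continuous f ->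
  (forall y, a <= y <= b -> 0 <= f y) -> a <= x <= b -> 0 < f x -> 0 < RI a b f.
Proof.
move=> ab cf f0 xab fx0.
have fx2 : 0 < f x / 2 by rewrite divr_gt0.
have /cvgrPdist_lt/(_ _ fx2) := cf x.
rewrite near_simpl => /nbhs_ballP[e /= e0 he].
pose c := Num.max a (x - e / 2); pose d := Num.min b (x + e / 2).
have cd : c < d.
  rewrite /c /d; move: xab => /andP[xa xb]; rewrite gt_max !lt_min ab/=.
  by apply/and3P; split; lra.
have ac : a <= c by rewrite /c le_max lexx.
have db : d <= b by rewrite /d ge_min lexx.
have h1 : 0 <= RI a c f.
  by apply: RI_ge0 => y /andP[ay yc]; apply: f0; rewrite ay/=; lra.
have h2 : 0 <= RI d b f.
  by apply: RI_ge0 => y /andP[dy yb]; apply: f0; rewrite yb andbT; lra.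
rewrite (@RI_split a c b)//; last by rewrite (le_trans (ltW cd)).
rewrite (@RI_split c d b)//; last exact: ltW.
suff : 0 < RI c d f by lra.
have cc : continuous (fun _ : R => f x / 2) by move=> ?; apply: cst_continuous.
apply: (lt_le_trans (y := RI c d (fun=> f x / 2))); last first.
  apply: le_RI => // y /andP[cy yd].
  suff : `|f x - f y| < f x / 2 by rewrite ltr_norml; lra.
  apply: he; rewrite /ball/= ltr_norml.
  have : x - e / 2 <= y by apply: le_trans cy; rewrite /c le_max lexx orbT.
  have : y <= x + e / 2 by apply: (le_trans yd); rewrite /d ge_min lexx orbT.
  by lra.
have -> : RI c d (fun=> f x / 2) = f x / 2 * d - f x / 2 * c.
  apply: (@RI_FTC c d _ (fun y => f x / 2 * y)) => //; first exact: ltW.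
  by move=> y _; apply: is_derive_eq; rewrite /GRing.scale/= mulr1.
by rewrite -mulrBr mulr_gt0// subr_gt0.
Qed.

(** The two sides agree because x |-> F(x + b - a) - F(x) is constant when F is a
    primitive of f. *)
Lemma RI_periodic_shift a b f d : a <= b -> continuous f ->
  (forall x, f (x + (b - a)) = f x) -> RI a b (fun x => f (x + d)) = RI a b f.
Proof.
move=> ab cf pf.
have [F dF] := primitive_ex (a - `|d| - 1) cf.
have dF' x : a - `|d| <= x -> is_derive x 1 F (f x) by move=> h; apply: dF; lra.
have nd : - `|d| <= d by rewrite lerNl -normrN ler_norm.
have nd0 := normr_ge0 d.
have cfd : continuous (fun x => f (x + d)).
  move=> x; apply: (@continuous_comp _ _ _ (fun x => x + d) f); last exact: cf.
  exact: (@cvgD _ _ _ _ _ _ _ _ _ cvg_id (cvg_cst _)).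
have -> : RI a b (fun x => f (x + d)) = F (b + d) - F (a + d).
  apply: (@RI_FTC a b _ (fun x => F (x + d))) => // x /andP[ax xb].
  have dFx : is_derive (x + d) 1 F (f (x + d)) by apply: dF'; lra.
  have -> : (fun x => F (x + d)) = F \o (fun x => x + d) by [].
  by apply: is_derive_eq; rewrite /GRing.scale/= ?addr0 ?mul1r ?mulr1.
have -> : RI a b f = F b - F a.
  by apply: RI_FTC => // x /andP[ax xb]; apply: dF'; lra.
pose H x := F (x + (b - a)) - F x.
have dH x : a - `|d| <= x -> is_derive x 1 H 0.
  move=> h; have ? : is_derive x 1 F (f x) by exact: dF'.
  have dFx : is_derive (x + (b - a)) 1 F (f x) by rewrite -(pf x); apply: dF'; lra.
  have ? : is_derive x 1 (F \o (fun x => x + (b - a))) (f x).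
    by apply: is_derive_eq; rewrite /GRing.scale/= ?addr0 ?mul1r ?mulr1.
  rewrite (_ : H = (F \o (fun x => x + (b - a))) - F)//.
  by apply: is_derive_eq; rewrite subrr.
have c0 : continuous (fun _ : R => 0 : R) by move=> ?; apply: cst_continuous.
have RI0 u v : RI u v (fun=> 0 : R) = 0 by rewrite /RI Rintegral_cst// mul0r.
have HE u v : a - `|d| <= u -> u <= v -> H u = H v.
  move=> au uv; apply/esym/eqP; rewrite -subr_eq0.
  have <- : RI u v (fun=> 0) = H v - H u.
    apply: RI_FTC => // x /andP[ux _]; apply: dH; exact: le_trans ux.
  by rewrite RI0.
have {}HE : H a = H (a + d).
  by have [h|h] := leP a (a + d); [apply: HE => //; lra|apply/esym/HE => //; lra].
move: HE; rewrite /H.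
have -> : a + (b - a) = b by rewrite addrC subrK.
have -> : a + d + (b - a) = b + d by lra.
by lra.
Qed.

Lemma RI_reflect a f : 0 <= a -> continuous f ->
  RI (- a) a (fun x => f (- x)) = RI (- a) a f.
Proof.
move=> a0 cf; have [F dF] := primitive_ex (- a - 1) cf.
have dF' x : - a <= x -> is_derive x 1 F (f x) by move=> h; apply: dF; lra.
have cfN : continuous (fun x => f (- x)).
  move=> x; apply: (@continuous_comp _ _ _ (fun x => - x) f); last exact: cf.
  exact: opp_continuous.
have aa : - a <= a by rewrite (le_trans _ a0)// oppr_le0.
have -> : RI (- a) a f = F a - F (- a).
  by apply: RI_FTC => // x /andP[? ?]; exact: dF'.
have -> : RI (- a) a (fun x => f (- x)) = (- F (- a)) - (- F (- - a)).
  apply: (@RI_FTC _ _ _ (fun x => - F (- x))) => // x /andP[? ?].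
  have dFx : is_derive (- x) 1 F (f (- x)) by apply: dF'; lra.
  have -> : (fun x => - F (- x)) = - (F \o (fun x => - x)) by [].
  by apply: is_derive_eq; rewrite /GRing.scale/=; lra.
by rewrite !opprK addrC.
Qed.

End segment_integral.

(** * The transform with kernel |sin| on the circle *)
Section planar.
Context {R : realType}.
Implicit Types (f g u F : R -> R) (a b c d x : R).
Local Notation mu := (@lebesgue_measure R).

(** Tonelli, cut down to a rectangle: nonnegativity of the integrand avoids any
    integrability hypothesis on the product. *)
Lemma RI_fubini_ge0 a b c d (K : R -> R -> R) :
  measurable_fun [set: measurableTypeR R * measurableTypeR R] (fun z => K z.1 z.2) ->
  (forall x, continuous (K x)) -> (forall y, continuous (K ^~ y)) ->
  (forall x y, a <= x <= b -> c <= y <= d -> 0 <= K x y) ->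
  RI a b (fun x => RI c d (K x)) = RI c d (fun y => RI a b (K ^~ y)).
Proof.
move=> mK cK1 cK2 K0.
pose A : set (measurableTypeR R) := `[a, b]%classic.
pose B : set (measurableTypeR R) := `[c, d]%classic.
pose k := EFin \o (fun z : measurableTypeR R * measurableTypeR R =>
  \1_A z.1 * \1_B z.2 * K z.1 z.2).
have mI (X : set (measurableTypeR R)) : measurable X ->
    measurable_fun [set: measurableTypeR R] (\1_X : measurableTypeR R -> R).
  by move=> mX; apply: measurable_indic.
have mk : measurable_fun [set: measurableTypeR R * measurableTypeR R] k.
  apply/measurable_EFinP; apply: measurable_funM => //.
  apply: measurable_funM.
    by apply: measurableT_comp measurable_fst; apply: mI; exact: measurable_itv.
  by apply: measurableT_comp measurable_snd; apply: mI; exact: measurable_itv.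
have k0 z : (0 <= k z)%E.
  rewrite lee_fin /k !indicE.
  have [|] := boolP (z.1 \in A); rewrite ?mul0r//.
  have [|] := boolP (z.2 \in B); rewrite ?mul0r// ?mulr0 ?mul0r//.
  rewrite /A /B !inE/= !in_itv/= !mul1r => h1 h2; exact: K0.
have E1 : (\int[mu]_x \int[mu]_y k (x, y) = \int[mu]_(x in A) (RI c d (K x))%:E)%E.
  rewrite [RHS]integral_mkcond; apply: eq_integral => x _.
  rewrite patchE; case: ifPn => [xA|xA]; last first.
    by apply: integral0_eq => y _; rewrite /k /= indicE (negbTE xA) !mul0r.
  rewrite /RI /Rintegral fineK; last first.
    by apply: integrable_fin_num => //; exact: integrable_segment.
  rewrite [RHS]integral_mkcond; apply: eq_integral => y _.
  by rewrite patchE /k /= !indicE xA mul1r; case: ifPn; rewrite ?mul1r ?mul0r.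
have E2 : (\int[mu]_y \int[mu]_x k (x, y) = \int[mu]_(y in B) (RI a b (K ^~ y))%:E)%E.
  rewrite [RHS]integral_mkcond; apply: eq_integral => y _.
  rewrite patchE; case: ifPn => [yB|yB]; last first.
    by apply: integral0_eq => x _; rewrite /k /= [\1_B _]indicE (negbTE yB) mulr0 !mul0r.
  rewrite /RI /Rintegral fineK; last first.
    by apply: integrable_fin_num => //; exact: integrable_segment.
  rewrite [RHS]integral_mkcond; apply: eq_integral => x _.
  by rewrite patchE /k /= !indicE yB mulr1; case: ifPn; rewrite ?mul1r ?mul0r.
by rewrite [LHS]/RI [RHS]/RI /Rintegral -E1 -E2 (@fubini_tonelli _ _ _ _ _ mu mu k).
Qed.

Lemma lipschitz_continuous f (C : R) :
  (forall x y, `|f x - f y| <= C * `|x - y|) -> continuous f.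
Proof.
move=> fC x; apply/cvgrPdist_lt => e e0.
have C1 : 0 < `|C| + 1 by rewrite ltr_pwDr.
apply/nbhs_ballP; exists (e / (`|C| + 1)); first by rewrite /= divr_gt0.
move=> y /= ; rewrite /ball/= ltr_pdivlMr// => h.
apply: le_lt_trans (fC x y) _; apply: le_lt_trans h.
by rewrite mulrC ler_wpM2l// (le_trans (ler_norm _))// lerDl.
Qed.

Lemma RI_lipschitz_continuous a b (K : R -> R -> R) (C : R) : a <= b ->
  (forall x, continuous (K x)) ->
  (forall x x' y, a <= y <= b -> `|K x y - K x' y| <= C * `|x - x'|) ->
  continuous (fun x => RI a b (K x)).
Proof.
move=> ab cK KC; apply: (@lipschitz_continuous _ (C * (b - a))) => x x'.
rewrite -RI_B//.
have cB : continuous (fun y => K x y - K x' y).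
  by move=> y; apply: cvgB; exact: cK.
apply: le_trans (le_norm_RI _ _ cB) _.
have cN : continuous (fun y => `|K x y - K x' y|).
  by move=> y; apply: cvg_norm; exact: cB.
have cC : continuous (fun _ : R => C * `|x - x'|) by move=> ?; apply: cst_continuous.
apply: le_trans (le_RI cN cC (KC x x')) _.
have -> : RI a b (fun _ : R => C * `|x - x'|) = C * `|x - x'| * b - C * `|x - x'| * a.
  apply: (@RI_FTC _ _ _ _ (fun y => C * `|x - x'| * y)) => // y _.
  by apply: is_derive_eq; rewrite /GRing.scale/= mulr1.
by rewrite -mulrBr mulrAC.
Qed.

Lemma cont_at_comp f u x : continuous f -> continuous_at x u ->
  continuous_at x (fun y => f (u y)).
Proof. by move=> cf cu; apply: continuous_comp => //; exact: cf. Qed.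

Lemma cont_at_sin u x : continuous_at x u -> continuous_at x (fun y => sin (u y)).
Proof. by apply: cont_at_comp; exact: continuous_sin. Qed.

Lemma cont_at_cos u x : continuous_at x u -> continuous_at x (fun y => cos (u y)).
Proof. by apply: cont_at_comp; exact: continuous_cos. Qed.

Lemma cont_at_D f g x : continuous_at x f -> continuous_at x g ->
  continuous_at x (fun y => f y + g y).
Proof. exact: continuousD. Qed.

Lemma cont_at_N f x : continuous_at x f -> continuous_at x (fun y => - f y).
Proof. exact: continuousN. Qed.

Lemma cont_at_M f g x : continuous_at x f -> continuous_at x g ->
  continuous_at x (fun y => f y * g y).
Proof. exact: continuousM. Qed.

Lemma cont_at_X f n x : continuous_at x f -> continuous_at x (fun y => f y ^+ n).
Proof. by apply: (cont_at_comp (f := fun z => z ^+ n)); exact: exprn_continuous. Qed.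

Lemma cont_at_norm f x : continuous_at x f -> continuous_at x (fun y => `|f y|).
Proof. by apply: cont_at_comp; exact: norm_continuous. Qed.

Lemma cont_at_horner (p : {poly R}) f x :
  continuous_at x f -> continuous_at x (fun y => p.[f y]).
Proof. by apply: (cont_at_comp (f := fun z => p.[z])); exact: continuous_horner. Qed.

Lemma cont_norm f : continuous f -> continuous (fun y => `|f y|).
Proof. by move=> cf x; exact/cont_at_norm/cf. Qed.

Lemma cont_at_cst c x : continuous_at x (fun=> c : R).
Proof. exact: cst_continuous. Qed.

Lemma cont_at_id x : continuous_at x (fun y : R => y).
Proof. exact: cvg_id. Qed.

End planar.

Ltac cont1 :=
 lazymatch goal with
 | |- continuous_at _ (fun x => x) => exact: cont_at_id
 | |- continuous_at _ (fun x => Algebra.add (@?a x) (@?b x)) =>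
    apply: (@cont_at_D _ a b); cont1
 | |- continuous_at _ (fun x => Algebra.opp (@?a x)) =>
    apply: (@cont_at_N _ a); cont1
 | |- continuous_at _ (fun x => GRing.mul (@?a x) (@?b x)) =>
    apply: (@cont_at_M _ a b); cont1
 | |- continuous_at _ (fun x => GRing.exp (@?a x) _) =>
    apply: (@cont_at_X _ a); cont1
 | |- continuous_at _ (fun x => Num.norm (@?a x)) =>
    apply: (@cont_at_norm _ a); cont1
 | |- continuous_at _ (fun x => horner _ (@?a x)) =>
    apply: (@cont_at_horner _ _ a); cont1
 | |- continuous_at _ (fun x => sin (@?a x)) => apply: (@cont_at_sin _ a); cont1
 | |- continuous_at _ (fun x => cos (@?a x)) => apply: (@cont_at_cos _ a); cont1
 | |- continuous_at _ (fun _ => ?c) => exact: cont_at_cst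
 | |- _ => match goal with
   | H : continuous ?f |- continuous_at _ ?f => exact: H
   | H : continuous ?f |- continuous_at _ (fun x => ?f x) => exact: H
   | H : forall _, continuous _ |- continuous_at _ (fun x => ?f x) => exact: H
   | H : continuous ?f |- continuous_at _ (fun x => ?f (@?u x)) =>
      apply: (@cont_at_comp _ f u _ H); cont1
   | H : forall _, continuous _ |- continuous_at _ (fun x => ?f (@?u x)) =>
      apply: (@cont_at_comp _ f u _ (H _)); cont1 end
 end.
Ltac cont := let x := fresh in intro x; cbv beta; cont1.

Section sine_transform.
Context {R : realType}.
Implicit Types (f g rho : R -> R) (a b c d x s : R).
Local Notation hpi := (pi / 2 : R).

Lemma hpi_gt0 : 0 < hpi. Proof. by rewrite divr_gt0// pi_gt0. Qed.

Lemma sin_lipschitz x y : `|sin x - sin y| <= `|x - y|.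
Proof.
wlog xy : x y / x <= y => [h|].
  have [/h//|/ltW/h] := leP x y.
  by rewrite distrC [`|y - x|]distrC.
have [|c _] := @MVT_segment R sin cos x y xy (fun z _ => is_derive_sin z).
  by apply: continuous_subspaceT; exact: continuous_sin.
move=> e; rewrite distrC e normrM [`|x - y|]distrC ler_piMl//; exact: cos_max.
Qed.

Lemma abs_sin_lipschitz x y : `|(`|sin x| - `|sin y|)| <= `|x - y|.
Proof. by rewrite (le_trans (ler_dist_dist _ _))// sin_lipschitz. Qed.

(** The second difference of |sin| adapted to the solutions of y'' + y = 0: it
    vanishes wherever |sin| has no kink in [x - d, x + d], so it is an
    approximate identity as d tends to 0. *)
Definition bump d x := `|sin (x + d)| + `|sin (x - d)| - 2 * cos d * `|sin x|.

Lemma bumpN d x : bump d (- x) = bump d x.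
Proof.
rewrite /bump (_ : - x + d = - (x - d)); last by ring.
by rewrite (_ : - x - d = - (x + d)) ?sinN ?normrN; ring.
Qed.

Lemma bump_in d x : 0 < d < hpi -> 0 <= x <= d -> bump d x = 2 * sin (d - x).
Proof.
move=> /andP[d0 dh] /andP[x0 xd]; rewrite /bump.
have p2 : pi = hpi + hpi by rewrite -splitr.
have h1 : 0 <= sin (x + d) by apply: sin_ge0_pi; apply/andP; split; lra.
have h2 : 0 <= sin (d - x) by apply: sin_ge0_pi; apply/andP; split; lra.
have h3 : 0 <= sin x by apply: sin_ge0_pi; apply/andP; split; lra.
rewrite (ger0_norm h1) (ger0_norm h3) -[x - d]opprB sinN normrN (ger0_norm h2).
by rewrite sinD sinB; ring.
Qed.

Lemma bump_out d x : 0 < d < hpi -> d <= x <= hpi -> bump d x = 0.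
Proof.
move=> /andP[d0 dh] /andP[dx xh]; rewrite /bump.
have p2 : pi = hpi + hpi by rewrite -splitr.
have h1 : 0 <= sin (x + d) by apply: sin_ge0_pi; apply/andP; split; lra.
have h2 : 0 <= sin (x - d) by apply: sin_ge0_pi; apply/andP; split; lra.
have h3 : 0 <= sin x by apply: sin_ge0_pi; apply/andP; split; lra.
rewrite (ger0_norm h1) (ger0_norm h3) (ger0_norm h2).
by rewrite sinD sinB; ring.
Qed.

Lemma bump_ge0 d x : 0 < d < hpi -> - hpi <= x <= hpi -> 0 <= bump d x.
Proof.
move=> dh; wlog x0 : x / 0 <= x => [h /andP[h1 h2]|/andP[_ xh]].
  have [x0|x0] := leP 0 x; first by apply: h => //; rewrite h1.
  by rewrite -bumpN; apply: h; [lra|apply/andP; split; lra].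
have p2 : pi = hpi + hpi by rewrite -splitr.
have [xd|dx] := leP x d; last by rewrite bump_out// (ltW dx).
rewrite bump_in ?x0// mulr_ge0//; apply: sin_ge0_pi.
by move/andP: dh => [? ?]; apply/andP; split; lra.
Qed.

Lemma bump_far d x : 0 < d < hpi -> - hpi <= x <= hpi -> d <= `|x| -> bump d x = 0.
Proof.
move=> dh; wlog x0 : x / 0 <= x => [h /andP[h1 h2]|/andP[_ xh]].
  have [x0|x0] := leP 0 x; first by apply: h => //; rewrite h1.
  by rewrite -bumpN -normrN; apply: h; [lra|apply/andP; split; lra].
by rewrite ger0_norm// => dx; apply: bump_out => //; rewrite dx.
Qed.

Lemma abs_sinDpi x : `|sin (x + pi)| = `|sin x|.
Proof. by rewrite sinDpi normrN. Qed.

Lemma RI_mulr_const_le a b f g (C : R) : continuous f -> continuous g ->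
  (forall x, a <= x <= b -> 0 <= f x) ->
  (forall x, a <= x <= b -> `|f x * g x| <= f x * C) ->
  `|RI a b (fun x => f x * g x)| <= RI a b f * C.
Proof.
move=> cf cg f0 fg.
have cfg : continuous (fun x => f x * g x) by cont.
have cN : continuous (fun x => `|f x * g x|) by cont.
have cC : continuous (fun x => C * f x) by cont.
apply: le_trans (le_norm_RI _ _ cfg) _; rewrite mulrC -RI_Z//.
by apply: le_RI => // x /fg; rewrite [C * _]mulrC.
Qed.

(** Set D(a) = f(a+d) + f(a-d) - 2 cos d f(a) >= 0.  Integrating |sin(s-a)| D(a)
    against da moves the second difference onto |sin|, which yields f * [bump d],
    close to a positive multiple of f(s); integrating against rho(s) ds first gives
    the integral of D times the transform of rho, which is nonnegative. *)
Lemma sine_transform_pairing_ge0 f rho (K : R) :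
  (forall x y, `|f x - f y| <= K * `|x - y|) -> (forall x, f (x + pi) = f x) ->
  (forall a d, 0 < d < hpi -> 2 * cos d * f a <= f (a + d) + f (a - d)) ->
  continuous rho ->
  (forall a, - hpi <= a <= hpi -> 0 <= RI (- hpi) hpi (fun s => `|sin (s - a)| * rho s)) ->
  0 <= RI (- hpi) hpi (fun s => f s * rho s).
Proof.
move=> fK fpi fconv crho tr_ge0.
have hp := hpi_gt0; have p2 : pi = hpi + hpi by rewrite -splitr.
have hh : - hpi <= hpi by lra.
have cf := lipschitz_continuous fK.
have K0 : 0 <= K.
  by have := fK 1 0; rewrite subr0 normr1 mulr1; exact: le_trans.
have cabs : continuous (fun s => `|rho s|) by cont.
have cfr : continuous (fun s => f s * rho s) by cont.
(* It suffices to have nonnegativity up to an error of order d. *)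
suff key d : 0 < d < hpi ->
    0 <= RI (- hpi) hpi (fun s => f s * rho s) + K * d * RI (- hpi) hpi (fun s => `|rho s|).
  set A := RI _ _ _ in key *; set B := RI _ _ _ in key.
  have B0 : 0 <= B by apply: RI_ge0.
  rewrite leNgt; apply/negP => A0.
  have KB : 0 < K * B + 1 by rewrite ltr_pwDr// mulr_ge0.
  pose d := Num.min (hpi / 2) (- A / (2 * (K * B + 1))).
  have d1 : d <= hpi / 2 by rewrite /d ge_min lexx.
  have d2 : d <= - A / (2 * (K * B + 1)) by rewrite /d ge_min lexx orbT.
  have d0 : 0 < d.
    rewrite /d lt_min; apply/andP; split; first lra.
    by apply: divr_gt0; [rewrite oppr_gt0|apply: mulr_gt0].
  have /key : 0 < d < hpi by apply/andP; split; lra.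
  move: d2; rewrite ler_pdivlMr ?mulr_gt0// => d2.
  have : K * d * B = d * (K * B) by ring.
  by move: d2; nra.
move=> dh; have /andP[d0 dhpi] := dh.
pose D a := f (a + d) + f (a - d) - 2 * cos d * f a.
have cD : continuous D by rewrite /D; cont.
have D0 a : 0 <= D a by rewrite subr_ge0 fconv.
have cbump : continuous (bump d) by rewrite /bump; cont.
pose M := RI (- hpi) hpi (bump d).
have M0 : 0 < M.
  apply: (@RI_gt0 _ _ _ _ 0) => //.
  - by lra.
  - by move=> y; exact: bump_ge0.
  - by lra.
  - rewrite bump_in ?lexx ?(ltW d0)// subr0 mulr_gt0// sin_gt0_pihalf//.
pose J s := RI (- hpi) hpi (fun b => bump d b * f (s - b)).
(* Periodicity moves the second difference from f to |sin|. *)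
have S1 s : RI (- hpi) hpi (fun a => `|sin (s - a)| * D a) = J s.
  pose g1 a := `|sin (s - a + d)| * f a.
  pose g2 a := `|sin (s - a - d)| * f a.
  have cg1 : continuous g1 by rewrite /g1; cont.
  have cg2 : continuous g2 by rewrite /g2; cont.
  have g1p x : g1 (x + (hpi - - hpi)) = g1 x.
    rewrite /g1 opprK -p2 fpi -(abs_sinDpi (s - (x + pi) + d)).
    by congr (`|sin _| * _); ring.
  have g2p x : g2 (x + (hpi - - hpi)) = g2 x.
    rewrite /g2 opprK -p2 fpi -(abs_sinDpi (s - (x + pi) - d)).
    by congr (`|sin _| * _); ring.
  have E1 := RI_periodic_shift d hh cg1 g1p.
  have E2 := RI_periodic_shift (- d) hh cg2 g2p.
  have cg1d : continuous (fun x => g1 (x + d)) by rewrite /g1; cont.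
  have cg2d : continuous (fun x => g2 (x - d)) by rewrite /g2; cont.
  have c3 : continuous (fun a => 2 * cos d * (`|sin (s - a)| * f a)) by cont.
  have c12 : continuous (fun x => g1 (x + d) + g2 (x - d)) by rewrite /g1 /g2; cont.
  have c12' : continuous (fun x => g1 x + g2 x) by rewrite /g1 /g2; cont.
  transitivity (RI (- hpi) hpi (fun a => g1 (a + d) + g2 (a - d) - 2 * cos d * (`|sin (s - a)| * f a))).
    apply: eq_RI => a _; rewrite /g1 /g2 /D.
    rewrite (_ : s - (a + d) + d = s - a); last by ring.
    rewrite (_ : s - (a - d) - d = s - a); last by ring.
    by ring.
  rewrite RI_B// RI_D// E1 E2 -RI_D// -RI_B//.
  pose G x := bump d x * f (s - x).
  have cG : continuous G by rewrite /G; cont.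
  transitivity (RI (- hpi) hpi (fun a => G (s - a))).
    apply: eq_RI => a _; rewrite /g1 /g2 /G /bump.
    rewrite (_ : s - (s - a) = a); last by ring.
    by ring.
  have bp x : bump d (x + pi) = bump d x.
    rewrite /bump (_ : x + pi + d = x + d + pi); last by ring.
    by rewrite (_ : x + pi - d = x - d + pi) ?abs_sinDpi//; ring.
  have Gp x : G (x + (hpi - - hpi)) = G x.
    rewrite /G opprK -p2 bp -(fpi (s - (x + pi))).
    by congr (_ * f _); ring.
  have cGs : continuous (fun x => G (x + s)) by rewrite /G; cont.
  transitivity (RI (- hpi) hpi (fun a => G (- a + s))).
    by apply: eq_RI => a _; rewrite addrC.
  rewrite (@RI_reflect _ hpi (fun x => G (x + s)))//; last exact: ltW.
  exact: RI_periodic_shift.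
have cbf s : continuous (fun b => bump d b * f (s - b)) by cont.
have cJ : continuous J.
  apply: (@RI_lipschitz_continuous _ _ _ _ (K * 4)) => // x x' y yh.
  rewrite -mulrBr normrM (ger0_norm (bump_ge0 _ yh))//.
  have b4 : bump d y <= 4.
    have := sin_max (y + d); have := sin_max (y - d).
    rewrite /bump; have := sin_max y; have := cos_geN1 d.
    have := normr_ge0 (sin y); nra.
  apply: le_trans (ler_pM (bump_ge0 dh yh) (normr_ge0 _) b4 (fK _ _)) _.
  rewrite mulrA [4 * K]mulrC (_ : x - y - (x' - y) = x - x')//; ring.
(* bump d has mass M and is supported in [- d, d]. *)
have S2 s : `|J s - M * f s| <= M * (K * d).
  have ccs : continuous (fun b => f s * bump d b) by cont.
  have cc2 : continuous (fun b => f (s - b) - f s) by cont.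
  have -> : J s - M * f s = RI (- hpi) hpi (fun b => bump d b * (f (s - b) - f s)).
    rewrite /J [M * f s]mulrC /M -RI_Z// -RI_B//; apply: eq_RI => b _; ring.
  apply: RI_mulr_const_le => // [x|x xh]; first exact: bump_ge0.
  rewrite normrM (ger0_norm (bump_ge0 _ _))//.
  have [xd|dx] := leP `|x| d; last by rewrite (bump_far dh xh (ltW dx)) !mul0r.
  rewrite ler_wpM2l ?bump_ge0//; apply: le_trans (fK _ _) _.
  by rewrite ler_wpM2l// (_ : s - x - s = - x) ?normrN//; ring.
have csr : continuous (fun s => rho s * J s) by cont.
pose tr a := RI (- hpi) hpi (fun s => `|sin (s - a)| * rho s).
(* Adding a constant makes rho nonnegative, as Tonelli requires. *)
have [m [m0 mrho]] : exists m, 0 <= m /\ forall s, - hpi <= s <= hpi -> 0 <= rho s + m.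
  have [c _ hc] := EVT_min hh (continuous_subspaceT crho).
  exists `|rho c|; split => // s sh.
  have : rho c <= rho s by apply: hc; rewrite in_itv.
  have := ler_norm (- rho c); rewrite normrN; lra.
have S3 : RI (- hpi) hpi (fun s => rho s * J s) = RI (- hpi) hpi (fun a => D a * tr a).
  have ms (h : R -> R) : continuous h -> measurable_fun [set: measurableTypeR R] (h : measurableTypeR R -> R).
    exact: continuous_measurable_fun.
  have cabss : continuous (fun s : R => `|sin s|) by cont.
  have mK (r : R -> R) : continuous r ->
      measurable_fun [set: measurableTypeR R * measurableTypeR R]
        (fun z => r z.1 * (`|sin (z.1 - z.2)| * D z.2)).
    move=> cr; apply: measurable_funM.
      exact: (measurableT_comp (ms _ cr) measurable_fst).
    apply: measurable_funM; last exact: (measurableT_comp (ms _ cD) measurable_snd).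
    apply: (measurableT_comp (ms _ cabss)).
    by apply: measurable_funB; [exact: measurable_fst|exact: measurable_snd].
  have FT (r : R -> R) : continuous r -> (forall s, - hpi <= s <= hpi -> 0 <= r s) ->
      RI (- hpi) hpi (fun s => r s * J s) =
      RI (- hpi) hpi (fun a => D a * RI (- hpi) hpi (fun s => `|sin (s - a)| * r s)).
    move=> cr r0.
    transitivity (RI (- hpi) hpi (fun s => RI (- hpi) hpi (fun a => r s * (`|sin (s - a)| * D a)))).
      by apply: eq_RI => s _; rewrite RI_Z ?S1//; cont.
    rewrite (@RI_fubini_ge0 _ _ _ _ _ (fun s a => r s * (`|sin (s - a)| * D a)))//.
    - apply: eq_RI => a _; rewrite -RI_Z; last by cont.
      by apply: eq_RI => s _; ring.
    - exact: mK.
    - by move=> s; cont.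
    - by move=> a; cont.
    - by move=> s a sh _; rewrite mulr_ge0 ?r0// mulr_ge0.
  have cm : continuous (fun _ : R => m) by move=> ?; exact: cont_at_cst.
  have crm : continuous (fun s => rho s + m) by cont.
  have e1 := FT _ crm mrho; have e2 := FT _ cm (fun _ _ => m0).
  have ctr (r : R -> R) : continuous r ->
      continuous (fun a => RI (- hpi) hpi (fun s => `|sin (s - a)| * r s)).
    move=> cr; have [c _ hc] := EVT_max hh (continuous_subspaceT (cont_norm cr)).
    apply: (@RI_lipschitz_continuous _ _ _ (fun a s => `|sin (s - a)| * r s) `|r c| hh).
      by move=> a; cont.
    move=> x x' s sh; rewrite -mulrBl normrM mulrC.
    apply: ler_pM; [exact: normr_ge0|exact: normr_ge0|by apply: hc; rewrite in_itv|].
    apply: le_trans (abs_sin_lipschitz _ _) _.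
    by rewrite (_ : s - x - (s - x') = x' - x); [rewrite distrC|ring].
  have cmJ : continuous (fun s => m * J s) by cont.
  have crmJ : continuous (fun s => (rho s + m) * J s) by cont.
  have ct1 := ctr _ crm; have ct2 := ctr _ cm; have ct3 := ctr _ crho.
  transitivity (RI (- hpi) hpi (fun s => (rho s + m) * J s) - RI (- hpi) hpi (fun s => m * J s)).
    by rewrite -RI_B; [apply: eq_RI => s _; ring|exact: crmJ|exact: cmJ].
  rewrite e1 e2 -RI_B; [|by cont|by cont].
  apply: eq_RI => a _; rewrite -mulrBr -RI_B; [|by cont|by cont].
  by congr (_ * _); apply: eq_RI => s _; ring.
have S4 : 0 <= RI (- hpi) hpi (fun s => rho s * J s).
  by rewrite S3; apply: RI_ge0 => a ah; apply: mulr_ge0; [exact: D0|exact: tr_ge0].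
have cM : continuous (fun s => M * (f s * rho s)) by cont.
have cdf : continuous (fun s => J s - M * f s) by cont.
have S5 : RI (- hpi) hpi (fun s => rho s * J s) =
    M * RI (- hpi) hpi (fun s => f s * rho s) + RI (- hpi) hpi (fun s => rho s * (J s - M * f s)).
  rewrite -RI_Z; last exact: cfr.
  rewrite -RI_D; [|exact: cM|by cont].
  by apply: eq_RI => s _; ring.
have S6 : RI (- hpi) hpi (fun s => rho s * (J s - M * f s)) <=
    M * (K * d) * RI (- hpi) hpi (fun s => `|rho s|).
  rewrite -RI_Z; last exact: cabs.
  apply: le_RI; [by cont|by cont|move=> s _].
  apply: le_trans (ler_norm _) _; rewrite normrM mulrC.
  by apply: ler_wpM2r; [exact: normr_ge0|exact: S2].
rewrite -(pmulr_rge0 _ M0) mulrDr.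
apply: le_trans S4 _; rewrite S5 lerD2l; apply: le_trans S6 _.
by rewrite !mulrA.
Qed.

End sine_transform.

(** * The zonal operator and its |sin| transform *)
Section derive_combinators.
Context {R : realType}.
Implicit Types (f g u : R -> R) (a b c x : R).

Lemma der_D f g x a b : is_derive x 1 f a -> is_derive x 1 g b ->
  is_derive x 1 (fun y => f y + g y) (a + b).
Proof. by move=> df dg; exact: is_deriveD. Qed.

Lemma der_N f x a : is_derive x 1 f a -> is_derive x 1 (fun y => - f y) (- a).
Proof. by move=> df; exact: is_deriveN. Qed.

Lemma der_M f g x a b : is_derive x 1 f a -> is_derive x 1 g b ->
  is_derive x 1 (fun y => f y * g y) (f x * b + g x * a).
Proof. by move=> df dg; exact: is_deriveM. Qed.

Lemma der_comp f u x a b : is_derive (u x) 1 f b -> is_derive x 1 u a ->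
  is_derive x 1 (fun y => f (u y)) (a * b).
Proof.
move=> df du; rewrite (_ : (fun y => f (u y)) = f \o u)//.
by apply: is_derive_eq; rewrite mulrC.
Qed.

Lemma der_X f x a n : is_derive x 1 f a ->
  is_derive x 1 (fun y => f y ^+ n) (a * (n%:R * f x ^+ n.-1)).
Proof.
move=> df; rewrite (_ : (fun y => f y ^+ n) = f ^+ n).
  by apply: is_derive_eq; rewrite [RHS]mulrC.
by apply/funext => y; rewrite exprfctE.
Qed.

Lemma der_sin u x a : is_derive x 1 u a -> is_derive x 1 (fun y => sin (u y)) (a * cos (u x)).
Proof. by move=> du; apply: der_comp. Qed.

Lemma der_cos u x a : is_derive x 1 u a -> is_derive x 1 (fun y => cos (u y)) (a * - sin (u x)).
Proof. by move=> du; apply: der_comp. Qed.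

Lemma der_horner (p : {poly R}) u x a : is_derive x 1 u a ->
  is_derive x 1 (fun y => p.[u y]) (a * p^`().[u x]).
Proof. by move=> du; apply: (der_comp (f := horner p)). Qed.

Lemma der_cst c x : is_derive x 1 (fun _ : R => c) 0.
Proof. exact: is_derive_cst. Qed.

Lemma der_id x : is_derive x 1 (fun y : R => y) 1.
Proof. exact: is_derive_id. Qed.

End derive_combinators.

Ltac der :=
 lazymatch goal with
 | |- is_derive _ _ (fun x => x) _ => apply: der_id
 | |- is_derive _ _ (fun x => Algebra.add (@?a x) (@?b x)) _ =>
    apply: (@der_D _ a b); der
 | |- is_derive _ _ (fun x => Algebra.opp (@?a x)) _ => apply: (@der_N _ a); der
 | |- is_derive _ _ (fun x => GRing.mul (@?a x) (@?b x)) _ =>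
    apply: (@der_M _ a b); der
 | |- is_derive _ _ (fun x => GRing.exp (@?a x) _) _ => apply: (@der_X _ a); der
 | |- is_derive _ _ (fun x => horner _ (@?a x)) _ => apply: (@der_horner _ _ a); der
 | |- is_derive _ _ (fun x => sin (@?a x)) _ => apply: (@der_sin _ a); der
 | |- is_derive _ _ (fun x => cos (@?a x)) _ => apply: (@der_cos _ a); der
 | |- is_derive _ _ (fun _ => ?c) _ => apply: der_cst
 | |- _ => match goal with H : is_derive _ _ ?f _ |- is_derive _ _ ?f _ => exact: H end
 end.

Section zonal_operator.
Context {R : realType} (m : nat).
Implicit Types (p q : {poly R}) (a s t x : R).
Local Notation hpi := (pi / 2 : R).

(** The operator Laplacian + (n - 1) of the sphere of dimension n - 1, acting on
    functions p(e . u), with n = m + 3. *)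
Definition lap p : {poly R} :=
  m.+2%:R *: p + (1 - 'X^2) * p^`()^`() - m.+2%:R *: ('X * p^`()).

Lemma horner_lap p t : (lap p).[t] =
  m.+2%:R * p.[t] + (1 - t ^+ 2) * p^`()^`().[t] - m.+2%:R * (t * p^`().[t]).
Proof. by rewrite /lap !hornerE. Qed.

(** The lower bound - pi only has to lie to the left of [- pi / 2, pi / 2], where
    the function is used: it makes [wint p] differentiable there. *)
Definition wint p a := RI (- pi) a (fun s => p.[sin s] * cos s ^+ m).

Lemma cont_w p : continuous (fun s => p.[sin s] * cos s ^+ m).
Proof. by cont. Qed.

Lemma is_derive_wint p a : - pi < a -> is_derive a 1 (wint p) (p.[sin a] * cos a ^+ m).
Proof.
move=> pa; have cf := @cont_w p.
have [dF dFE] := @continuous_FTC1_closed R _ (- pi) a (a + 1) (ltr_pwDr ltr01 (lexx a))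
  (integrable_segment _ _ cf) pa (cf a).
by split; [exact: dF|rewrite -derive1E].
Qed.

(** [Aprim] and [Bprim] are primitives of cos s rho(s) and sin s rho(s), where
    rho(s) = (lap p)(sin s) cos^{m+1} s.  As sin(s - a) is a combination of sin s and
    cos s, they give the |sin| transform of rho in closed form. *)
Definition Aprim p s := cos s ^+ m.+3 * p^`().[sin s] +
  sin s * cos s ^+ m.+1 * p.[sin s] + m.+1%:R * wint p s.

Definition Bprim p s := cos s ^+ m.+2 * (sin s * p^`().[sin s] - p.[sin s]).

Lemma is_derive_Bprim p s :
  is_derive s 1 (Bprim p) (sin s * ((lap p).[sin s] * cos s ^+ m.+1)).
Proof.
rewrite /Bprim; apply: is_derive_eq; [der|].
rewrite horner_lap -cos2sin2 /GRing.scale/= !exprS; ring.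
Qed.

Lemma is_derive_Aprim p s : - pi < s ->
  is_derive s 1 (Aprim p) (cos s * ((lap p).[sin s] * cos s ^+ m.+1)).
Proof.
move=> ps; have dw := is_derive_wint p ps.
rewrite /Aprim; apply: is_derive_eq; [der|].
rewrite horner_lap -cos2sin2 /GRing.scale/= !exprS.
have -> : p.[sin s] * cos s ^+ m = (cos s ^+ 2 + sin s ^+ 2) * (p.[sin s] * cos s ^+ m).
  by rewrite cos2Dsin2 mul1r.
by ring.
Qed.

(** Half the |sin| transform of (lap p)(sin s) cos^{m+1} s, at an even p. *)
Definition Lam p a := p.[sin a] * cos a ^+ m.+1 +
  m.+1%:R * sin a * (wint p a - wint p 0).

Lemma hpi_lt_pi : hpi < pi.
Proof. by have := pi_gt0 R; rewrite ltr_pdivrMr//; lra. Qed.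

Lemma RI0 (u v : R) : RI u v (fun=> 0 : R) = 0.
Proof. by rewrite /RI Rintegral_cst// mul0r. Qed.

Lemma derive0_eq (F : R -> R) (u v : R) : u <= v ->
  (forall x, u <= x <= v -> is_derive x 1 F 0) -> F u = F v.
Proof.
move=> uv dF; apply/esym/eqP; rewrite -subr_eq0.
have <- : RI u v (fun=> 0) = F v - F u.
  by apply: RI_FTC => // x; exact: cont_at_cst.
by rewrite RI0.
Qed.

Lemma wint_even p a : (forall t, p.[- t] = p.[t]) -> - hpi <= a <= hpi ->
  wint p a + wint p (- a) = 2 * wint p 0.
Proof.
move=> pe; have hp := hpi_lt_pi.
wlog a0 : a / 0 <= a => [h /andP[h1 h2]|/andP[_ ah]].
  have [a0|a0] := leP 0 a; first by apply: h => //; rewrite h1.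
  by have := h (- a); rewrite opprK => <-; [rewrite addrC| |apply/andP; split]; lra.
pose H x := wint p x + wint p (- x).
have -> : 2 * wint p 0 = H 0 by rewrite /H oppr0; ring.
rewrite -[LHS]/(H a); apply/esym; apply: derive0_eq => // x /andP[x0 xa].
have d1 : is_derive x 1 (wint p) (p.[sin x] * cos x ^+ m).
  by apply: is_derive_wint; lra.
have d2 : is_derive (- x) 1 (wint p) (p.[sin (- x)] * cos (- x) ^+ m).
  by apply: is_derive_wint; lra.
have d3 := der_comp d2 (der_N (der_id x)).
move: (der_D d1 d3); rewrite sinN cosN pe.
by rewrite (_ : _ + _ = 0)//; ring.
Qed.

Lemma LamN p a : (forall t, p.[- t] = p.[t]) -> - hpi <= a <= hpi ->
  Lam p (- a) = Lam p a.
Proof.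
move=> pe ah; have := wint_even pe ah.
by rewrite /Lam sinN cosN pe => h; nra.
Qed.

(** Split at the kink s = a, evaluate with the primitives of cos s rho and sin s rho,
    and use cos (+- pi / 2) = 0 to kill the boundary terms. *)
Lemma sine_transform_lap p a : (forall t, p.[- t] = p.[t]) -> - hpi <= a <= hpi ->
  RI (- hpi) hpi (fun s => `|sin (s - a)| * ((lap p).[sin s] * cos s ^+ m.+1)) =
  2 * Lam p a.
Proof.
move=> pe /andP[ah1 ah2]; have hp := hpi_lt_pi; have hp0 := @hpi_gt0 R.
have p2 : pi = hpi + hpi by rewrite -splitr.
pose rho s := (lap p).[sin s] * cos s ^+ m.+1.
have crho : continuous rho by rewrite /rho; cont.
have cs : continuous (fun s => sin s * rho s) by cont.
have cc : continuous (fun s => cos s * rho s) by cont.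
have ccs : continuous (fun s => cos a * (sin s * rho s)) by cont.
have csc : continuous (fun s => sin a * (cos s * rho s)) by cont.
have IB u v : u <= v -> RI u v (fun s => sin s * rho s) = Bprim p v - Bprim p u.
  by move=> uv; apply: RI_FTC => // x _; exact: is_derive_Bprim.
have IA u v : - hpi <= u -> u <= v ->
    RI u v (fun s => cos s * rho s) = Aprim p v - Aprim p u.
  by move=> hu uv; apply: RI_FTC => // x /andP[ux xv]; apply: is_derive_Aprim; lra.
rewrite (@RI_split _ _ a)//; last by cont.
have -> : RI (- hpi) a (fun s => `|sin (s - a)| * rho s) =
    sin a * (Aprim p a - Aprim p (- hpi)) - cos a * (Bprim p a - Bprim p (- hpi)).
  rewrite -IA// -IB// -!RI_Z// -RI_B//; apply: eq_RI => s /andP[hs sa].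
  have h : 0 <= sin (a - s) by apply: sin_ge0_pi; apply/andP; split; lra.
  by rewrite -opprB sinN normrN (ger0_norm h) sinB; ring.
have -> : RI a hpi (fun s => `|sin (s - a)| * rho s) =
    cos a * (Bprim p hpi - Bprim p a) - sin a * (Aprim p hpi - Aprim p a).
  rewrite -IA// -IB// -!RI_Z// -RI_B//; apply: eq_RI => s /andP[hs sa].
  have h : 0 <= sin (s - a) by apply: sin_ge0_pi; apply/andP; split; lra.
  by rewrite (ger0_norm h) sinB; ring.
have hpp : - hpi <= hpi <= hpi by apply/andP; split; lra.
have := wint_even pe hpp.
rewrite /Lam /Aprim /Bprim cosN sinN cos_pihalf sin_pihalf !exprS !mul0r => W.
have -> : wint p hpi = 2 * wint p 0 - wint p (- hpi) by rewrite -W; ring.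
have -> : p.[sin a] * (cos a * cos a ^+ m) =
    (cos a ^+ 2 + sin a ^+ 2) * (p.[sin a] * (cos a * cos a ^+ m)).
  by rewrite cos2Dsin2 mul1r.
by ring.
Qed.

End zonal_operator.

(** * The functional Lam on even powers *)
Section moments.
Context {R : realType} (m : nat).
Implicit Types (p q : {poly R}) (a s t x : R) (i j l d : nat).
Local Notation hpi := (pi / 2 : R).

Lemma wintB p a : 0 <= a ->
  wint m p a - wint m p 0 = RI 0 a (fun s => p.[sin s] * cos s ^+ m).
Proof.
move=> a0; rewrite /wint (@RI_split _ _ 0 a)//; last by cont.
  by rewrite addrC addKr.
by rewrite oppr_le0 pi_ge0.
Qed.

Lemma Lam_comb c p q a : 0 <= a -> Lam m (c *: p + q) a = c * Lam m p a + Lam m q a.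
Proof.
move=> a0; rewrite /Lam !wintB// hornerD hornerZ.
have cp : continuous (fun s => c * (p.[sin s] * cos s ^+ m)) by cont.
have -> : RI 0 a (fun s => (c *: p + q).[sin s] * cos s ^+ m) =
    c * RI 0 a (fun s => p.[sin s] * cos s ^+ m) + RI 0 a (fun s => q.[sin s] * cos s ^+ m).
  rewrite -RI_Z; last by cont.
  rewrite -RI_D; [|by cont|by cont].
  by apply: eq_RI => s _; rewrite hornerD hornerZ; ring.
by ring.
Qed.

Lemma Lam0 a : 0 <= a -> Lam m 0 a = 0.
Proof.
move=> a0; have := Lam_comb 1 0 0 a0; rewrite scaler0 addr0 mul1r => /eqP.
by rewrite -subr_eq0 opprD addrA subrr sub0r oppr_eq0 => /eqP.
Qed.

Lemma LamZ c p a : 0 <= a -> Lam m (c *: p) a = c * Lam m p a.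
Proof. by move=> a0; rewrite -[c *: p]addr0 Lam_comb// Lam0// addr0. Qed.

Lemma LamD p q a : 0 <= a -> Lam m (p + q) a = Lam m p a + Lam m q a.
Proof. by move=> a0; rewrite -[p in LHS]scale1r Lam_comb// mul1r. Qed.

Lemma sin_cos_pos a : 0 <= a <= hpi -> [/\ 0 <= sin a, sin a <= 1 & 0 <= cos a].
Proof.
move=> /andP[a0 ah]; have hp := @hpi_lt_pi R; split.
- by apply: sin_ge0_pi; apply/andP; split; lra.
- exact: sin_le1.
- by apply: cos_ge0_pihalf; apply/andP; split; lra.
Qed.

Lemma Lam_ge0 p a : (forall t, 0 <= t <= 1 -> 0 <= p.[t]) -> 0 <= a <= hpi ->
  0 <= Lam m p a.
Proof.
move=> p0 ah; have [s0 s1 c0] := sin_cos_pos ah; have /andP[a0 ah'] := ah.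
rewrite /Lam wintB// addr_ge0 ?mulr_ge0 ?exprn_ge0 ?p0 ?s0//.
apply: RI_ge0 => s /andP[ss sa].
have [|? ? ?] := @sin_cos_pos s; first by rewrite ss (le_trans sa).
by rewrite mulr_ge0 ?exprn_ge0// p0//; apply/andP.
Qed.

Lemma Lam_le p q a : (forall t, 0 <= t <= 1 -> p.[t] <= q.[t]) -> 0 <= a <= hpi ->
  Lam m p a <= Lam m q a.
Proof.
move=> pq ah; have /andP[a0 _] := ah.
have : 0 <= Lam m (-1 *: p + q) a.
  by apply: Lam_ge0 => // t /pq h; rewrite hornerD hornerZ; lra.
by rewrite Lam_comb//; lra.
Qed.

Lemma Lam_norm_le p q a : (forall t, 0 <= t <= 1 -> `|p.[t]| <= q.[t]) -> 0 <= a <= hpi ->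
  `|Lam m p a| <= Lam m q a.
Proof.
move=> pq ah; have /andP[a0 _] := ah.
rewrite ler_norml; apply/andP; split; last first.
  by apply: Lam_le => // t /pq; rewrite ler_norml => /andP[].
rewrite -mulN1r -LamZ//; apply: Lam_le => // t /pq.
by rewrite ler_norml hornerZ mulN1r => /andP[].
Qed.

Definition wsin j a := RI 0 a (fun s => sin s ^+ j.*2 * cos s ^+ m).

(** Integration by parts. *)
Lemma wsin_rec j a : 0 <= a -> (m + j.*2.+2)%:R * wsin j.+1 a =
  j.*2.+1%:R * wsin j a - sin a ^+ j.*2.+1 * cos a ^+ m.+1.
Proof.
move=> a0; rewrite /wsin.
have c1 : continuous (fun s : R => j.*2.+1%:R * (sin s ^+ j.*2 * cos s ^+ m)) by cont.
have c2 : continuous (fun s : R => (m + j.*2.+2)%:R * (sin s ^+ j.+1.*2 * cos s ^+ m)) by cont.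
have c12 : continuous (fun s : R => j.*2.+1%:R * (sin s ^+ j.*2 * cos s ^+ m) -
  (m + j.*2.+2)%:R * (sin s ^+ j.+1.*2 * cos s ^+ m)) by cont.
rewrite -RI_Z; last by cont.
rewrite -RI_Z; last by cont.
pose F s : R := sin s ^+ j.*2.+1 * cos s ^+ m.+1.
have : RI 0 a (fun s => j.*2.+1%:R * (sin s ^+ j.*2 * cos s ^+ m) -
    (m + j.*2.+2)%:R * (sin s ^+ j.+1.*2 * cos s ^+ m)) = F a - F 0.
  apply: RI_FTC => // s _.
  rewrite /F; apply: is_derive_eq; [der|].
  rewrite /GRing.scale/= doubleS !exprS.
  have -> : (m + j.*2.+2)%:R = m.+1%:R + j.*2.+1%:R :> R by rewrite -natrD addSnnS.
  have -> : cos s * cos s ^+ m * (cos s * (j.*2.+1%:R * sin s ^+ j.*2)) =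
      (1 - sin s ^+ 2) * (cos s ^+ m * (j.*2.+1%:R * sin s ^+ j.*2)).
    by rewrite -cos2sin2; ring.
  by ring.
by rewrite RI_B// /F sin0 expr0n mul0r subr0 => <-; ring.
Qed.

(** The moments E(Y^{2j}) of the random variable Y = sin S, where S has density
    proportional to cos^m s on [- pi / 2, pi / 2]. *)
Fixpoint mu j : R := if j is i.+1 then i.*2.+1%:R / (m + i.*2.+2)%:R * mu i else 1.

Lemma mu_ge0 j : 0 <= mu j.
Proof. by elim: j => //= i ih; rewrite mulr_ge0// divr_ge0. Qed.

Lemma wsin_hpi j : wsin j hpi = mu j * wsin 0 hpi.
Proof.
elim: j => [|j ih]; first by rewrite mul1r.
have := wsin_rec j (ltW (@hpi_gt0 R)); rewrite cos_pihalf expr0n mulr0 subr0 ih /=.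
have n0 : (m + j.*2.+2)%:R != 0 :> R by rewrite pnatr_eq0 addnS.
by move/(canRL (mulKf n0)) => ->; field.
Qed.

Lemma wsin0_gt0 : 0 < wsin 0 hpi.
Proof.
have hp := @hpi_gt0 R.
apply: (@RI_gt0 _ _ _ _ 0) => //.
- by cont.
- move=> y /(sin_cos_pos (a := y))[_ _ c0]; by rewrite expr0 mul1r exprn_ge0.
- by rewrite lexx ltW.
- by rewrite expr0 mul1r cos0 expr1n.
Qed.

Definition Lx j a := Lam m 'X^(j.*2) a.

Lemma LxE j a : 0 <= a ->
  Lx j a = sin a ^+ j.*2 * cos a ^+ m.+1 + m.+1%:R * sin a * wsin j a.
Proof.
move=> a0; rewrite /Lx /Lam wintB// hornerXn; congr (_ + _ * _).
by apply: eq_RI => s _; rewrite hornerXn.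
Qed.

(** The recursion of the moments, with a correction term of a definite sign: this
    makes [Lam] at an even polynomial explicit in terms of [Lx m 0 a]. *)
Lemma Lx_rec j a : 0 <= a -> (m + j.*2.+2)%:R * Lx j.+1 a =
  j.*2.+1%:R * (Lx j a - cos a ^+ m.+1 * sin a ^+ j.*2 * cos a ^+ 2).
Proof.
move=> a0; rewrite !LxE//.
have := wsin_rec j a0.
set V := wsin j.+1 a; set W := wsin j a => e.
transitivity ((m + j.*2.+2)%:R * (sin a ^+ j.+1.*2 * cos a ^+ m.+1) +
   m.+1%:R * sin a * ((m + j.*2.+2)%:R * V)); first by ring.
rewrite e cos2sin2 doubleS !exprS.
have -> : (m + j.*2.+2)%:R = m.+1%:R + j.*2.+1%:R :> R by rewrite -natrD addSnnS.
by ring.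
Qed.

Lemma Lx_ge0 j a : 0 <= a <= hpi -> 0 <= Lx j a.
Proof.
by move=> ah; apply: Lam_ge0 => // t /andP[t0 _]; rewrite hornerXn exprn_ge0.
Qed.

Lemma Lx_le j a : 0 <= a <= hpi -> Lx j a <= mu j * Lx 0 a.
Proof.
move=> ah; have /andP[a0 _] := ah; have [s0 s1 c0] := sin_cos_pos ah.
elim: j => [|j ih]; first by rewrite mul1r.
have n0 : 0 < (m + j.*2.+2)%:R :> R by rewrite ltr0n addnS.
rewrite -(ler_pM2l n0) Lx_rec//=.
have -> : (m + j.*2.+2)%:R * (j.*2.+1%:R / (m + j.*2.+2)%:R * mu j * Lx 0 a) =
   j.*2.+1%:R * (mu j * Lx 0 a) by field; rewrite gt_eqF.
rewrite ler_wpM2l//; apply: le_trans ih.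
by rewrite lerBlDr lerDl !mulr_ge0 ?exprn_ge0.
Qed.

(** By the recursion of the incomplete moments, int_0^a cos^m >= sin a cos^{m+1} a. *)
Lemma Lx0_ge a : 0 <= a <= hpi -> cos a ^+ m.+1 * (1 + m.+1%:R * sin a ^+ 2) <= Lx 0 a.
Proof.
move=> ah; have /andP[a0 _] := ah; have [s0 s1 c0] := sin_cos_pos ah.
have w1 : 0 <= wsin 1 a.
  apply: RI_ge0 => s /andP[ss sa].
  have [|? ? ?] := @sin_cos_pos s; first by rewrite ss (le_trans sa)//; case/andP: ah.
  by rewrite mulr_ge0 ?exprn_ge0.
have := wsin_rec 0 a0; rewrite mul1r expr1 => e.
have : sin a * cos a ^+ m.+1 <= wsin 0 a.
  by rewrite -subr_ge0 -e mulr_ge0.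
rewrite LxE// expr0 mul1r mulrDr mulr1 lerD2l => h.
have -> : cos a ^+ m.+1 * (m.+1%:R * sin a ^+ 2) =
  m.+1%:R * sin a * (sin a * cos a ^+ m.+1) by ring.
by rewrite ler_wpM2l// mulr_ge0.
Qed.

End moments.

(** * The Laplace formula for Legendre polynomials *)
Lemma big_ord_even (V : nmodType) l (F : nat -> V) :
  (forall j, F j.*2.+1 = 0) ->
  \sum_(i < l.*2.+1) F i = \sum_(j < l.+1) F j.*2.
Proof.
move=> F0; elim: l => [|l ih]; first by rewrite !big_ord_recr !big_ord0.
by rewrite doubleS 2!big_ord_recr/= F0 addr0 ih [RHS]big_ord_recr/= doubleS.
Qed.

(** The sum is the real part of (t + i w)^{2l}. *)
Lemma real_part_pow_bound (R : rcfType) (t w : R) l :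
  `|\sum_(j < l.+1) (-1) ^+ j * 'C(l.*2, j.*2)%:R * (t ^+ (l - j).*2 * w ^+ j.*2)|
    <= (t ^+ 2 + w ^+ 2) ^+ l.
Proof.
pose z : R[i] := Complex t w.
have sqM (u v : R[i]) : complex.Re (u * v) ^+ 2 + complex.Im (u * v) ^+ 2 =
    (complex.Re u ^+ 2 + complex.Im u ^+ 2) * (complex.Re v ^+ 2 + complex.Im v ^+ 2).
  case: u v => [a b] [c d]; simpc => /=; ring.
have sqX k : complex.Re (z ^+ k) ^+ 2 + complex.Im (z ^+ k) ^+ 2 = (t ^+ 2 + w ^+ 2) ^+ k.
  elim: k => [|k ih]; first by rewrite !expr0 /= expr1n expr0n addr0.
  by rewrite (exprS z) sqM ih [RHS]exprS.
have ReD (u v : R[i]) : complex.Re (u + v) = complex.Re u + complex.Re v by case: u v => [? ?] [? ?].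
have ReMn (u : R[i]) n : complex.Re (u *+ n) = complex.Re u *+ n.
  by elim: n => [|n ih] //; rewrite !mulrS ReD ih.
have Resum (I : finType) (F : I -> R[i]) : complex.Re (\sum_i F i) = \sum_i complex.Re (F i).
  by apply: (big_morph (@complex.Re R)).
have -> : \sum_(j < l.+1) (-1) ^+ j * 'C(l.*2, j.*2)%:R * (t ^+ (l - j).*2 * w ^+ j.*2) =
    complex.Re (z ^+ l.*2).
  pose F i : R := complex.Re ((Complex t 0) ^+ (l.*2 - i) * (Complex 0 w) ^+ i *+ 'C(l.*2, i)).
  have realX k : (Complex t 0 : R[i]) ^+ k = Complex (t ^+ k) 0.
    by elim: k => // k ih; rewrite !exprS ih; simpc.
  have imX j : (Complex 0 w : R[i]) ^+ j.*2 = Complex ((-1) ^+ j * w ^+ j.*2) 0.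
    elim: j => [|j ih]; first by rewrite !expr0 mulr1.
    by rewrite doubleS !exprS ih; simpc; congr (Complex _ _); ring.
  have -> : z = Complex t 0 + Complex 0 w by rewrite /z; simpc.
  rewrite exprDn Resum (@big_ord_even _ l F).
    apply: eq_bigr => j _; rewrite /F realX imX ReMn -doubleB.
    by simpc; rewrite /= -[RHS]mulr_natr; ring.
  by move=> j; rewrite /F exprS imX realX ReMn; simpc; rewrite /= mul0rn.
rewrite -(@ler_pXn2r _ 2)// ?nnegrE ?exprn_ge0 ?addr_ge0 ?sqr_ge0//.
by rewrite real_normK ?num_real// -exprM mulnC mul2n -sqX lerDl sqr_ge0.
Qed.

Section leg.
Context {R : realType} (m : nat).
Implicit Types (p q : {poly R}) (a s t x : R) (i j l d : nat).
Local Notation hpi := (pi / 2 : R).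
Local Notation mu := (@mu R m).

(** P_{2l}, by the Laplace formula P_k(t) = E (t + i Y sqrt(1 - t^2))^k: the odd
    moments of Y vanish and the even ones are [mu]. *)
Definition leg l : {poly R} := \sum_(j < l.+1)
  ((-1) ^+ j * 'C(l.*2, j.*2)%:R * mu j) *: ('X^((l - j).*2) * (1 - 'X^2) ^+ j).

(** E (t^2 + Y^2 (1 - t^2))^l. *)
Definition maj l : {poly R} := \sum_(j < l.+1)
  ('C(l, j)%:R * mu j) *: ('X^((l - j).*2) * (1 - 'X^2) ^+ j).

Lemma cont_sum n (F : nat -> R -> R) : (forall j, continuous (F j)) ->
  continuous (fun s => \sum_(j < n) F j s).
Proof.
move=> cF; elim: n => [|n ih].
  rewrite (_ : (fun _ => _) = fun=> 0); first by move=> ?; exact: cont_at_cst.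
  by apply/funext => s; rewrite big_ord0.
rewrite (_ : (fun _ => _) = fun s => \sum_(j < n) F j s + F n s); first by cont.
by apply/funext => s; rewrite big_ord_recr.
Qed.

Lemma RI_sum n a b (F : nat -> R -> R) : (forall j, continuous (F j)) ->
  RI a b (fun s => \sum_(j < n) F j s) = \sum_(j < n) RI a b (F j).
Proof.
move=> cF; elim: n => [|n ih].
  rewrite big_ord0; rewrite [RHS](_ : 0 = RI a b (fun=> 0)); last by rewrite RI0.
  by apply: eq_RI => s _; rewrite big_ord0.
have cS := @cont_sum n F cF; rewrite big_ord_recr /= -ih -RI_D//.
by apply: eq_RI => s _; rewrite big_ord_recr.
Qed.

(** Expectation against the law of Y, up to the normalising factor. *)
Lemma wsin_expect n (c : nat -> R) (r : R) :
  RI 0 hpi (fun s => (\sum_(j < n) c j * (sin s * r) ^+ j.*2) * cos s ^+ m) =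
  wsin m 0 hpi * \sum_(j < n) c j * mu j * r ^+ j.*2.
Proof.
transitivity (RI 0 hpi (fun s => \sum_(j < n)
    (c j * r ^+ j.*2) * (sin s ^+ j.*2 * cos s ^+ m))).
  apply: eq_RI => s _; rewrite mulr_suml; apply: eq_bigr => j _.
  by rewrite exprMn; ring.
rewrite (@RI_sum _ _ _ (fun j s => (c j * r ^+ j.*2) * (sin s ^+ j.*2 * cos s ^+ m))); last first.
  by move=> j; cont.
rewrite mulr_sumr; apply: eq_bigr => j _.
rewrite RI_Z; last by cont.
by rewrite -/(wsin m j hpi) wsin_hpi; ring.
Qed.

(** |P_{2l}(t)| <= E |t + i Y r|^{2l} = E (t^2 + Y^2 r^2)^l with r^2 = 1 - t^2, and the
    base t^2 + Y^2 r^2 is at most 1, so the exponent l can be lowered to d. *)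
Lemma leg_le d l t : (d <= l)%N -> 0 <= t <= 1 -> `|(leg l).[t]| <= (maj d).[t].
Proof.
move=> dl /andP[t0 t1].
have u0 : 0 <= 1 - t ^+ 2 by nra.
pose r := Num.sqrt (1 - t ^+ 2).
have r2 : r ^+ 2 = 1 - t ^+ 2 by rewrite sqr_sqrtr.
have rX j : r ^+ j.*2 = (1 - t ^+ 2) ^+ j by rewrite -mul2n exprM r2.
have V0 := @wsin0_gt0 R m.
have hE (x : R) (n : nat) (j : nat) : ('X^n * (1 - 'X^2) ^+ j).[x] = x ^+ n * (1 - x ^+ 2) ^+ j :> R.
  by rewrite !hornerE.
pose c1 j := (-1) ^+ j * 'C(l.*2, j.*2)%:R * t ^+ (l - j).*2 : R.
pose c2 j := 'C(d, j)%:R * t ^+ (d - j).*2 : R.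
have e1 : wsin m 0 hpi * (leg l).[t] =
    RI 0 hpi (fun s => (\sum_(j < l.+1) c1 j * (sin s * r) ^+ j.*2) * cos s ^+ m).
  rewrite wsin_expect /leg horner_sum; congr (_ * _); apply: eq_bigr => j _.
  by rewrite hornerZ hE rX /c1; ring.
have e2 : wsin m 0 hpi * (maj d).[t] =
    RI 0 hpi (fun s => (\sum_(j < d.+1) c2 j * (sin s * r) ^+ j.*2) * cos s ^+ m).
  rewrite wsin_expect /maj horner_sum; congr (_ * _); apply: eq_bigr => j _.
  by rewrite hornerZ hE rX /c2; ring.
rewrite -(ler_pM2l V0) -[X in X * `|_|](gtr0_norm V0) -normrM e1 e2.
have cS n (c : nat -> R) : continuous (fun s => \sum_(j < n) c j * (sin s * r) ^+ j.*2).
  by apply: (@cont_sum n (fun j s => c j * (sin s * r) ^+ j.*2)) => j; cont.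
have cF n (c : nat -> R) : continuous (fun s => (\sum_(j < n) c j * (sin s * r) ^+ j.*2) * cos s ^+ m).
  by have cSn := @cS n c; cont.
apply: le_trans (le_norm_RI _ _ (cF _ _)) _.
apply: le_RI; [exact: cont_norm|exact: cF|move=> s sh].
have [s0 s1 cs0] := sin_cos_pos sh.
rewrite normrM (ger0_norm (exprn_ge0 _ cs0)) ler_wpM2r ?exprn_ge0//.
pose B := t ^+ 2 + (sin s * r) ^+ 2.
have B0 : 0 <= B by rewrite addr_ge0 ?sqr_ge0.
have B1 : B <= 1.
  rewrite /B exprMn r2; have : sin s ^+ 2 <= 1 by rewrite sin2cos2 gerBl sqr_ge0.
  nra.
apply: le_trans (_ : B ^+ l <= _).
  apply: le_trans (real_part_pow_bound t (sin s * r) l).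
  rewrite le_eqVlt; apply/orP; left; apply/eqP; congr `|_|; apply: eq_bigr => j _.
  by rewrite /c1; ring.
apply: le_trans (_ : B ^+ d <= _); first exact: ler_wiXn2l.
rewrite /B exprDn le_eqVlt; apply/orP; left; apply/eqP; apply: eq_bigr => j _.
by rewrite /c2 -mulr_natr -!exprM !mul2n; ring.
Qed.

End leg.

(** * Bounds on Lam for Legendre polynomials *)
Arguments mu : simpl never.

Section kernel.
Context {R : realType} (m : nat).
Implicit Types (p q : {poly R}) (a s t x : R) (i j l d : nat).
Local Notation hpi := (pi / 2 : R).
Local Notation mu := (@mu R m).

Lemma muS j : (m + j.*2.+2)%:R * mu j.+1 = j.*2.+1%:R * mu j.
Proof.
have n0 : (m + j.*2.+2)%:R != 0 :> R by rewrite pnatr_eq0 addnS.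
by rewrite /mu /= -/(mu j) mulrA mulrCA mulfV// mulr1.
Qed.

Lemma Lam_ext p q a : (forall t, p.[t] = q.[t]) -> 0 <= a -> Lam m p a = Lam m q a.
Proof.
move=> pq a0; rewrite /Lam !wintB// pq; congr (_ + _ * _).
by apply: eq_RI => s _; rewrite pq.
Qed.

Lemma Lam_seq (c : seq R) a : 0 <= a ->
  Lam m (\sum_(j < size c) c`_j *: 'X^(j.*2)) a = \sum_(j < size c) c`_j * Lx m j a.
Proof.
move=> a0; elim/last_ind: c => [|c x ih]; first by rewrite !big_ord0 Lam0.
rewrite size_rcons !big_ord_recr /= LamD// LamZ// nth_rcons ltnn eqxx; congr (_ + _).
rewrite (eq_bigr (fun j : 'I_(size c) => c`_j *: 'X^(j.*2))); last first.
  by move=> j _; rewrite nth_rcons ltn_ord.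
by rewrite ih; apply: eq_bigr => j _; rewrite nth_rcons ltn_ord.
Qed.

Lemma Lam_eq_seq (c : seq R) p a : 0 <= a ->
  (forall t, p.[t] = \sum_(j < size c) c`_j * t ^+ j.*2) ->
  Lam m p a = \sum_(j < size c) c`_j * Lx m j a.
Proof.
move=> a0 pc; rewrite -Lam_seq//; apply: Lam_ext => // t.
by rewrite pc horner_sum; apply: eq_bigr => j _; rewrite hornerZ hornerXn.
Qed.

Lemma horner_leg l t : (leg m l).[t] = \sum_(j < l.+1)
  ((-1) ^+ j * 'C(l.*2, j.*2)%:R * mu j) * (t ^+ (l - j).*2 * (1 - t ^+ 2) ^+ j).
Proof. by rewrite /leg horner_sum; apply: eq_bigr => j _; rewrite !hornerE. Qed.

Lemma horner_maj d t : (maj m d).[t] = \sum_(j < d.+1)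
  ('C(d, j)%:R * mu j) * (t ^+ (d - j).*2 * (1 - t ^+ 2) ^+ j).
Proof. by rewrite /maj horner_sum; apply: eq_bigr => j _; rewrite !hornerE. Qed.

Let numE :
  ((0.*2 = 0)%N * (1.*2 = 2)%N * (2.*2 = 4)%N * (3.*2 = 6)%N * (4.*2 = 8)%N * (5.*2 = 10)%N *
   (1 - 0 = 1)%N * (1 - 1 = 0)%N * (2 - 0 = 2)%N * (2 - 1 = 1)%N * (2 - 2 = 0)%N *
   (3 - 0 = 3)%N * (3 - 1 = 2)%N * (3 - 2 = 1)%N * (3 - 3 = 0)%N * (4 - 0 = 4)%N *
   (4 - 1 = 3)%N * (4 - 2 = 2)%N * (4 - 3 = 1)%N * (4 - 4 = 0)%N * (5 - 0 = 5)%N *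
   (5 - 1 = 4)%N * (5 - 2 = 3)%N * (5 - 3 = 2)%N * (5 - 4 = 1)%N * (5 - 5 = 0)%N *
   ('C(4, 0) = 1)%N * ('C(4, 2) = 6)%N * ('C(4, 4) = 1)%N * ('C(6, 0) = 1)%N *
   ('C(6, 2) = 15)%N * ('C(6, 4) = 15)%N * ('C(6, 6) = 1)%N * ('C(8, 0) = 1)%N *
   ('C(8, 2) = 28)%N * ('C(8, 4) = 70)%N * ('C(8, 6) = 28)%N * ('C(8, 8) = 1)%N *
   ('C(3, 0) = 1)%N * ('C(3, 1) = 3)%N * ('C(3, 2) = 3)%N * ('C(3, 3) = 1)%N *
   ('C(5, 0) = 1)%N * ('C(5, 1) = 5)%N * ('C(5, 2) = 10)%N * ('C(5, 3) = 10)%N *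
   ('C(5, 4) = 5)%N * ('C(5, 5) = 1)%N)%type.
Proof. by []. Qed.

Lemma Lam_leg2 a : 0 <= a -> Lam m (leg m 2) a =
   mu 2 * Lx m 0 a - (6 * mu 1 + 2 * mu 2) * Lx m 1 a + (1 + 6 * mu 1 + mu 2) * Lx m 2 a.
Proof.
move=> a0; have mu0 : mu 0 = 1 by [].
rewrite (@Lam_eq_seq [:: mu 2; - (6 * mu 1 + 2 * mu 2); 1 + 6 * mu 1 + mu 2] _ _ a0).
  by rewrite !big_ord_recr big_ord0 /=; ring.
move=> t; rewrite horner_leg !big_ord_recr !big_ord0 /= !numE mu0; ring.
Qed.

Lemma Lam_leg3 a : 0 <= a -> Lam m (leg m 3) a =
   - mu 3 * Lx m 0 a + (15 * mu 2 + 3 * mu 3) * Lx m 1 a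
   - (15 * mu 1 + 30 * mu 2 + 3 * mu 3) * Lx m 2 a
   + (1 + 15 * mu 1 + 15 * mu 2 + mu 3) * Lx m 3 a.
Proof.
move=> a0; have mu0 : mu 0 = 1 by [].
rewrite (@Lam_eq_seq [:: - mu 3; 15 * mu 2 + 3 * mu 3;
  - (15 * mu 1 + 30 * mu 2 + 3 * mu 3); 1 + 15 * mu 1 + 15 * mu 2 + mu 3] _ _ a0).
  by rewrite !big_ord_recr big_ord0 /=; ring.
move=> t; rewrite horner_leg !big_ord_recr !big_ord0 /= !numE mu0; ring.
Qed.

Lemma Lam_leg4 a : 0 <= a -> Lam m (leg m 4) a =
   mu 4 * Lx m 0 a - (28 * mu 3 + 4 * mu 4) * Lx m 1 a
   + (70 * mu 2 + 84 * mu 3 + 6 * mu 4) * Lx m 2 a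
   - (28 * mu 1 + 140 * mu 2 + 84 * mu 3 + 4 * mu 4) * Lx m 3 a
   + (1 + 28 * mu 1 + 70 * mu 2 + 28 * mu 3 + mu 4) * Lx m 4 a.
Proof.
move=> a0; have mu0 : mu 0 = 1 by [].
rewrite (@Lam_eq_seq [:: mu 4; - (28 * mu 3 + 4 * mu 4);
  70 * mu 2 + 84 * mu 3 + 6 * mu 4; - (28 * mu 1 + 140 * mu 2 + 84 * mu 3 + 4 * mu 4);
  1 + 28 * mu 1 + 70 * mu 2 + 28 * mu 3 + mu 4] _ _ a0).
  by rewrite !big_ord_recr big_ord0 /=; ring.
move=> t; rewrite horner_leg !big_ord_recr !big_ord0 /= !numE mu0; ring.
Qed.

Lemma Lam_maj3 a : 0 <= a -> Lam m (maj m 3) a =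
   mu 3 * Lx m 0 a + 3 * (mu 2 - mu 3) * Lx m 1 a
   + 3 * (mu 1 - 2 * mu 2 + mu 3) * Lx m 2 a
   + (1 - 3 * mu 1 + 3 * mu 2 - mu 3) * Lx m 3 a.
Proof.
move=> a0; have mu0 : mu 0 = 1 by [].
rewrite (@Lam_eq_seq [:: mu 3; 3 * (mu 2 - mu 3); 3 * (mu 1 - 2 * mu 2 + mu 3);
  1 - 3 * mu 1 + 3 * mu 2 - mu 3] _ _ a0).
  by rewrite !big_ord_recr big_ord0 /=; ring.
move=> t; rewrite horner_maj !big_ord_recr !big_ord0 /= !numE mu0; ring.
Qed.

Lemma Lam_maj5 a : 0 <= a -> Lam m (maj m 5) a =
   mu 5 * Lx m 0 a + 5 * (mu 4 - mu 5) * Lx m 1 a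
   + 10 * (mu 3 - 2 * mu 4 + mu 5) * Lx m 2 a
   + 10 * (mu 2 - 3 * mu 3 + 3 * mu 4 - mu 5) * Lx m 3 a
   + 5 * (mu 1 - 4 * mu 2 + 6 * mu 3 - 4 * mu 4 + mu 5) * Lx m 4 a
   + (1 - 5 * mu 1 + 10 * mu 2 - 10 * mu 3 + 5 * mu 4 - mu 5) * Lx m 5 a.
Proof.
move=> a0; have mu0 : mu 0 = 1 by [].
rewrite (@Lam_eq_seq [:: mu 5; 5 * (mu 4 - mu 5); 10 * (mu 3 - 2 * mu 4 + mu 5);
  10 * (mu 2 - 3 * mu 3 + 3 * mu 4 - mu 5);
  5 * (mu 1 - 4 * mu 2 + 6 * mu 3 - 4 * mu 4 + mu 5);
  1 - 5 * mu 1 + 10 * mu 2 - 10 * mu 3 + 5 * mu 4 - mu 5] _ _ a0).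
  by rewrite !big_ord_recr big_ord0 /=; ring.
move=> t; rewrite horner_maj !big_ord_recr !big_ord0 /= !numE mu0; ring.
Qed.

(** As opposed to the bound from below, this direction has room: the constant 1/2
    is what makes the quadratic case one-sided. *)
Lemma Lam_leg1_le a : 0 <= a <= hpi -> 2 * (m.+2%:R * Lam m (leg m 1) a) <= Lx m 0 a.
Proof.
move=> ah; have /andP[a0 _] := ah; have mu0 : mu 0 = 1 by [].
have mE := muS 0; rewrite mu0 in mE.
have -> : Lam m (leg m 1) a = - mu 1 * Lx m 0 a + (1 + mu 1) * Lx m 1 a.
  rewrite (@Lam_eq_seq [:: - mu 1; 1 + mu 1] _ _ a0).
    by rewrite !big_ord_recr big_ord0 /=; ring.
  move=> t; rewrite horner_leg !big_ord_recr !big_ord0 /=.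
  by rewrite !numE (_ : 'C(2, 0) = 1%N)// (_ : 'C(2, 2) = 1%N)// mu0; ring.
have L1 := Lx_le m 1 ah; have L0 := Lx_ge0 m 0 ah.
move: mE; rewrite !numE addn2 mulr1.
have M2 : 2 <= m.+2%:R :> R by rewrite ler_nat.
move: L1 L0 M2 (@mu_ge0 R m 1); set M := m.+2%:R; set u := mu 1.
set L := Lx m 0 a; set K := Lx m 1 a => L1 L0 M2 u0 Mu.
have h : M * (- u * L + (1 + u) * K) <= M * (u * u * L).
  by rewrite ler_wpM2l//; nra.
have : M * (u * u * L) = (M * u) * (u * L) by ring.
rewrite Mu => e.
have : u <= 1 / 2 by nra.
by move=> u2; nra.
Qed.

(** 1 + (n-1) P_2(t) = n t^2 is nonnegative, and it vanishes at 0: no constant below 1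
    would do. *)
Lemma Lam_leg1_ge a : 0 <= a <= hpi -> - Lx m 0 a <= m.+2%:R * Lam m (leg m 1) a.
Proof.
move=> ah; have /andP[a0 _] := ah; have mu0 : mu 0 = 1 by [].
have mE := muS 0; rewrite mu0 in mE.
have -> : Lam m (leg m 1) a = - mu 1 * Lx m 0 a + (1 + mu 1) * Lx m 1 a.
  rewrite (@Lam_eq_seq [:: - mu 1; 1 + mu 1] _ _ a0).
    by rewrite !big_ord_recr big_ord0 /=; ring.
  move=> t; rewrite horner_leg !big_ord_recr !big_ord0 /=.
  by rewrite !numE (_ : 'C(2, 0) = 1%N)// (_ : 'C(2, 2) = 1%N)// mu0; ring.
have L1 := Lx_ge0 m 1 ah; have L0 := Lx_ge0 m 0 ah.
move: mE; rewrite !numE addn2 mulr1.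
have M2 : 2 <= m.+2%:R :> R by rewrite ler_nat.
move: L1 L0 M2 (@mu_ge0 R m 1); set M := m.+2%:R; set u := mu 1.
set L := Lx m 0 a; set K := Lx m 1 a => L1 L0 M2 u0 Mu.
have -> : M * (- u * L + (1 + u) * K) = - (M * u) * L + M * (1 + u) * K by ring.
rewrite Mu mulN1r lerDl !mulr_ge0//; lra.
Qed.

(** The constant 99/100 here and below is only required to be less than 1.  By the
    recursion, Lam(P_4) is a multiple of Lam(1) plus an explicit multiple of
    cos^{m+1} a, to be compared with the lower bound [Lx0_ge]. *)
Lemma Lam_leg2_bound a : 0 <= a <= hpi ->
  m.+2%:R * `|Lam m (leg m 2) a| <= 99 / 100 * Lx m 0 a.
Proof.
move=> ah; have /andP[a0 _] := ah; have mu0 : mu 0 = 1 by [].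
have [s0 s1 c0] := sin_cos_pos ah.
have e1 := muS 0; have e2 := muS 1; rewrite mu0 in e1.
have r1 := Lx_rec m 0 a0; have r2 := Lx_rec m 1 a0.
have G := Lx0_ge m ah; rewrite Lam_leg2//.
have M0 : 0 <= m%:R :> R by [].
move: e1 e2 r1 r2 G; rewrite !numE expr0 cos2sin2.
have -> : (m + 2)%:R = m%:R + 2 :> R by rewrite natrD.
have -> : (m + 4)%:R = m%:R + 4 :> R by rewrite natrD.
have -> : m.+2%:R = m%:R + 2 :> R by rewrite -addn2 natrD.
have -> : m.+1%:R = m%:R + 1 :> R by rewrite -addn1 natrD.
have x0 : 0 <= sin a ^+ 2 by rewrite sqr_ge0.
have x1 : sin a ^+ 2 <= 1 by rewrite sin2cos2 gerBl sqr_ge0.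
have q0 : 0 <= cos a ^+ m.+1 by rewrite exprn_ge0.
move: M0 x0 x1 q0; set M := m%:R; set x := sin a ^+ 2; set q := cos a ^+ m.+1.
set u1 := mu 1; set u2 := mu 2; set L0 := Lx m 0 a; set L1 := Lx m 1 a; set L2 := Lx m 2 a.
move=> M0 x0 x1 q0 e1 e2 r1 r2 G.
pose D := (M + 2) * (M + 4).
have D0 : 0 < D by rewrite /D mulr_gt0//; lra.
set Z := (X in `|X|).
have key : D * (D * Z) = 9 * L0 +
    3 * q * (1 - x) * ((M + 5) * (M + 1) - (M + 5) * (M + 7) * (M + 2) * x).
  have M2 : M + 2 != 0 by rewrite gt_eqF//; lra.
  have M4 : M + 4 != 0 by rewrite gt_eqF//; lra.
  have E1 : u1 = 1 / (M + 2) by apply: (mulfI M2); rewrite e1; field.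
  have E2 : u2 = 3 * u1 / (M + 4) by apply: (mulfI M4); rewrite e2; field.
  have F1 : L1 = (L0 - q * (1 - x)) / (M + 2) by apply: (mulfI M2); rewrite r1; field.
  have F2 : L2 = 3 * (L1 - q * x * (1 - x)) / (M + 4) by apply: (mulfI M4); rewrite r2; field.
  by rewrite /Z /D F2 F1 E2 E1; field; rewrite M2 M4.
have qL : q <= L0.
  apply: le_trans G; rewrite -[X in X <= _]mulr1 ler_wpM2l// lerDl mulr_ge0//; lra.
have L00 : 0 <= L0 by exact: le_trans qL.
have upper : D * (D * Z) <= 99 / 100 * ((M + 4) * D * L0).
  rewrite key; apply: (@le_trans _ _ (9 * L0 + 3 * q * ((M + 5) * (M + 1)))).
    rewrite lerD2l -subr_ge0.
    have -> : 3 * q * ((M + 5) * (M + 1)) - 3 * q * (1 - x) *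
        ((M + 5) * (M + 1) - (M + 5) * (M + 7) * (M + 2) * x) =
      3 * q * x * ((M + 5) * (M + 1)) + 3 * q * x * (1 - x) * ((M + 5) * (M + 7) * (M + 2)) by ring.
    by rewrite addr_ge0// !mulr_ge0//; lra.
  apply: (@le_trans _ _ (9 * L0 + 3 * L0 * ((M + 5) * (M + 1)))).
    by rewrite lerD2l !ler_wpM2r ?ler_wpM2l// mulr_ge0//; lra.
  rewrite -subr_ge0 /D.
  have -> : 99 / 100 * ((M + 4) * ((M + 2) * (M + 4)) * L0) - (9 * L0 + 3 * L0 * ((M + 5) * (M + 1))) =
     L0 * ((M + 2) * (M + 4)) * (99 / 100 * M + 96 / 100) by field.
  by rewrite !mulr_ge0//; lra.
have lower : - (99 / 100 * ((M + 4) * D * L0)) <= D * (D * Z).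
  rewrite key -subr_ge0 opprK.
  set T := q * (1 + (M + 1) * x).
  set W := (M + 5) * (M + 1) - (M + 5) * (M + 7) * (M + 2) * x.
  have h : (M + 4) * D * T <= (M + 4) * D * L0.
    by apply: ler_wpM2l G; rewrite mulr_ge0//; [lra|exact: ltW].
  suff : 0 <= 900 * q + 300 * q * (1 - x) * W + 99 * ((M + 4) * D * T) by lra.
  (* A certificate of positivity: a square, and nonnegative coefficients in M on both ends of [0, 1]. *)
  have -> : 900 * q + 300 * q * (1 - x) * W + 99 * ((M + 4) * D * T) =
    q * (75 * ((M + 5) * (M + 7) * (M + 2)) * (2 * x - 1) ^+ 2 +
      (1 - x) * (24 * M ^+ 3 + 240 * M ^+ 2 + 543 * M + 318) +
      x * (99 * M ^+ 4 + 1113 * M ^+ 3 + 4098 * M ^+ 2 + 5079 * M + 1986)).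
    by rewrite /T /D /W; ring.
  have M3 : 0 <= M ^+ 3 by exact: exprn_ge0.
  have M22 : 0 <= M ^+ 2 by exact: exprn_ge0.
  have M44 : 0 <= M ^+ 4 by exact: exprn_ge0.
  apply: mulr_ge0; first exact: q0.
  apply: addr_ge0; first apply: addr_ge0.
  - apply: mulr_ge0; last exact: sqr_ge0.
    apply: mulr_ge0; first by lra.
    by apply: mulr_ge0; [apply: mulr_ge0; lra|lra].
  - by apply: mulr_ge0; lra.
  - by apply: mulr_ge0; lra.
have M4 : 0 < M + 4 by lra.
have DM : 0 < D * (M + 4) by rewrite mulr_gt0.
rewrite -(ler_pM2l DM).
have -> : D * (M + 4) * ((M + 2) * `|Z|) = `|D * (D * Z)|.
  by rewrite normrM (gtr0_norm D0) normrM (gtr0_norm D0) /D; ring.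
have -> : D * (M + 4) * (99 / 100 * L0) = 99 / 100 * ((M + 4) * D * L0) by ring.
by rewrite ler_norml lower upper.
Qed.

End kernel.

Section kernel3.
Context {R : realType}.
Implicit Types (a s t x : R) (i j l d : nat).
Local Notation hpi := (pi / 2 : R).

(** In dimension 3, where Y is the sine of a uniform angle, the moments are central
    binomial coefficients over powers of 4. *)
Lemma muL3 : [/\ @mu R 0 1 = 1 / 2, @mu R 0 2 = 3 / 8, @mu R 0 3 = 5 / 16,
  @mu R 0 4 = 35 / 128 & @mu R 0 5 = 63 / 256].
Proof.
have m0 : @mu R 0 0 = 1 by [].
have := @muS R 0 0; have := @muS R 0 1; have := @muS R 0 2; have := @muS R 0 3.
have := @muS R 0 4; rewrite m0.
rewrite (_ : 0.*2 = 0%N)// (_ : 1.*2 = 2%N)// (_ : 2.*2 = 4%N)// (_ : 3.*2 = 6%N)//.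
rewrite (_ : 4.*2 = 8%N)// !add0n => e5 e4 e3 e2 e1.
by split; lra.
Qed.

(** In dimension 3 the recursion writes Z = Lam(P_k) as b Lam(1) + cos a * rest, with rest
    a polynomial in sin^2 a.  Inserting Lam(1) >= cos a (1 + sin^2 a) leaves
    two polynomial inequalities on [0, 1]. *)
Lemma Lam3_reduction a (b : R) (Z rest : R) : 0 <= a <= hpi ->
  0 <= 99 / 200 - b -> 0 <= 99 / 200 + b ->
  Z = b * Lx 0 0 a + cos a * rest ->
  0 <= (99 / 200 - b) * (1 + sin a ^+ 2) - rest ->
  0 <= (99 / 200 + b) * (1 + sin a ^+ 2) + rest ->
  2 * `|Z| <= 99 / 100 * Lx 0 0 a.
Proof.
move=> ah b1 b2 -> h1 h2; have [s0 s1 c0] := sin_cos_pos ah.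
have := Lx0_ge 0 ah; rewrite expr1 mul1r => G.
have g1 := ler_wpM2l b1 G; have g2 := ler_wpM2l b2 G.
have f1 := mulr_ge0 c0 h1; have f2 := mulr_ge0 c0 h2.
suff : `|b * Lx 0 0 a + cos a * rest| <= 99 / 200 * Lx 0 0 a by lra.
rewrite ler_norml; apply/andP; split; nra.
Qed.

(** The majorant of degree 6 is not good enough in dimension 3, hence a direct
    computation for P_6 and P_8. *)
Lemma Lam3_leg3_bound a : 0 <= a <= hpi ->
  2 * `|Lam 0 (leg 0 3) a| <= 99 / 100 * Lx 0 0 a.
Proof.
move=> ah; have /andP[a0 _] := ah; have [s0 s1 c0] := sin_cos_pos ah.
have [e1 e2 e3 _ _] := muL3.
have r1 := Lx_rec 0 0 a0; have r2 := Lx_rec 0 1 a0; have r3 := Lx_rec 0 2 a0.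
move: r1 r2 r3; rewrite (_ : 0.*2 = 0%N)// (_ : 1.*2 = 2%N)// (_ : 2.*2 = 4%N)//.
rewrite !add0n !expr1 cos2sin2 (exprM (sin a) 2 2) expr0.
have x0 : 0 <= sin a ^+ 2 by rewrite sqr_ge0.
have x1 : sin a ^+ 2 <= 1 by rewrite sin2cos2 gerBl sqr_ge0.
have := Lam_leg3 0 a0; rewrite e1 e2 e3; set Z := Lam _ _ _.
move=> ZE r1 r2 r3.
apply: (@Lam3_reduction _ (25 / 256) _
  (- (1 - sin a ^+ 2) * (105 / 256 - 735 / 128 * sin a ^+ 2 + 385 / 32 * (sin a ^+ 2) ^+ 2)) ah).
- by lra.
- by lra.
- rewrite ZE.
  by lra.
- move: x0 x1; set x := sin a ^+ 2 => x0 x1.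
  have y0 : 0 <= 1 - x by lra.
  (* Here and below, squares centred at approximate minimisers of the polynomial certify its sign. *)
  have h1 := mulr_ge0 x0 (sqr_ge0 (x - 1 / 5)).
  have h2 := mulr_ge0 y0 (sqr_ge0 (x - 1 / 5)).
  by lra.
- move: x0 x1; set x := sin a ^+ 2 => x0 x1.
  have y0 : 0 <= 1 - x by lra.
  have h1 := mulr_ge0 x0 (sqr_ge0 (x - 3 / 4)).
  have h2 := mulr_ge0 y0 (sqr_ge0 (x - 3 / 4)).
  by lra.
Qed.

Lemma Lam3_leg4_bound a : 0 <= a <= hpi ->
  2 * `|Lam 0 (leg 0 4) a| <= 99 / 100 * Lx 0 0 a.
Proof.
move=> ah; have /andP[a0 _] := ah; have [s0 s1 c0] := sin_cos_pos ah.
have [e1 e2 e3 e4 _] := muL3.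
have r1 := Lx_rec 0 0 a0; have r2 := Lx_rec 0 1 a0; have r3 := Lx_rec 0 2 a0.
have r4 := Lx_rec 0 3 a0.
move: r1 r2 r3 r4; rewrite (_ : 0.*2 = 0%N)// (_ : 1.*2 = 2%N)// (_ : 2.*2 = 4%N)//.
rewrite (_ : 3.*2 = 6%N)//.
rewrite !add0n !expr1 cos2sin2 (exprM (sin a) 2 2) (exprM (sin a) 2 3) expr0.
have x0 : 0 <= sin a ^+ 2 by rewrite sqr_ge0.
have x1 : sin a ^+ 2 <= 1 by rewrite sin2cos2 gerBl sqr_ge0.
have := Lam_leg4 0 a0; rewrite e1 e2 e3 e4; set Z := Lam _ _ _.
move=> ZE r1 r2 r3 r4.
apply: (@Lam3_reduction _ (1225 / (128 * 128)) _
  (- (1 - sin a ^+ 2) * (- (3255 / (128 * 128)) + (77 * 1005) / (64 * 128) * sin a ^+ 2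
   - (85 * 1001) / (32 * 64) * (sin a ^+ 2) ^+ 2 + (45 * 1001) / 1024 * (sin a ^+ 2) ^+ 3)) ah).
- by lra.
- by lra.
- rewrite ZE.
  by lra.
- move: x0 x1; set x := sin a ^+ 2 => x0 x1.
  have h : 0 <= x * (1 - x) by rewrite mulr_ge0// subr_ge0.
  have h1 := mulr_ge0 h (sqr_ge0 (x - 89 / 200)).
  have h2 := mulr_ge0 x0 (sqr_ge0 (x - 13 / 20)).
  by lra.
- move: x0 x1; set x := sin a ^+ 2 => x0 x1.
  have h : 0 <= x * (1 - x) by rewrite mulr_ge0// subr_ge0.
  have h1 := sqr_ge0 ((x - 1 / 8) * (x - 169 / 200)).
  have h2 := sqr_ge0 x.
  have h3 := mulr_ge0 x0 h.
  by lra.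
Qed.

(** Covers every P_k with k >= 10 at once. *)
Lemma Lam3_maj5_le a : 0 <= a <= hpi -> 2 * Lam 0 (maj 0 5) a <= 99 / 100 * Lx 0 0 a.
Proof.
move=> ah; have /andP[a0 _] := ah.
have [e1 e2 e3 e4 e5] := muL3.
rewrite Lam_maj5// e1 e2 e3 e4 e5.
have := Lx_le 0 1 ah; have := Lx_le 0 2 ah; have := Lx_le 0 3 ah.
have := Lx_le 0 4 ah; have := Lx_le 0 5 ah; have := Lx_ge0 0 0 ah.
by rewrite e1 e2 e3 e4 e5; lra.
Qed.

End kernel3.

Section kernel_bound.
Context {R : realType} (m : nat).
Implicit Types (a s t x : R) (i j l d : nat).
Local Notation hpi := (pi / 2 : R).
Local Notation mu := (@mu R m).

(** For n >= 4 the majorant of degree 6 covers every P_k with k >= 6 at once. *)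
Lemma Lam_maj3_le a : (1 <= m)%N -> 0 <= a <= hpi ->
  m.+2%:R * Lam m (maj m 3) a <= 99 / 100 * Lx m 0 a.
Proof.
move=> m1 ah; have /andP[a0 _] := ah.
have mu0 : mu 0 = 1 by [].
have e1 := @muS R m 0; have e2 := @muS R m 1; have e3 := @muS R m 2; rewrite mu0 in e1.
have M1 : 1 <= m%:R :> R by rewrite (ler_nat _ 1).
rewrite Lam_maj3//.
have L1 := Lx_le m 1 ah; have L2 := Lx_le m 2 ah; have L3 := Lx_le m 3 ah.
have L0 := Lx_ge0 m 0 ah.
move: e1 e2 e3; rewrite (_ : 0.*2 = 0%N)// (_ : 1.*2 = 2%N)// (_ : 2.*2 = 4%N)//.
have -> : (m + 2)%:R = m%:R + 2 :> R by rewrite natrD.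
have -> : (m + 4)%:R = m%:R + 4 :> R by rewrite natrD.
have -> : (m + 6)%:R = m%:R + 6 :> R by rewrite natrD.
have -> : m.+2%:R = m%:R + 2 :> R by rewrite -addn2 natrD.
move: M1 L1 L2 L3 L0; set M := m%:R.
set u1 := mu 1; set u2 := mu 2; set u3 := mu 3.
set K0 := Lx m 0 a; set K1 := Lx m 1 a; set K2 := Lx m 2 a; set K3 := Lx m 3 a.
move=> M1 L1 L2 L3 L0 e1 e2 e3.
pose D := (M + 2) * (M + 4) * (M + 6).
have D0 : 0 < D by rewrite /D !mulr_gt0//; lra.
have M2 : M + 2 != 0 by rewrite gt_eqF//; lra.
have M4 : M + 4 != 0 by rewrite gt_eqF//; lra.
have M6 : M + 6 != 0 by rewrite gt_eqF//; lra.
have E1 : u1 = 1 / (M + 2) by apply: (mulfI M2); rewrite e1; field.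
have E2 : u2 = 3 * u1 / (M + 4) by apply: (mulfI M4); rewrite e2; field.
have E3 : u3 = 5 * u2 / (M + 6) by apply: (mulfI M6); rewrite e3; field.
have F3 : u3 = 15 / D by rewrite E3 E2 E1 /D; field; rewrite M2 M4 M6.
have F23 : u2 - u3 = 3 * (M + 1) / D by rewrite E3 E2 E1 /D; field; rewrite M2 M4 M6.
have F123 : u1 - 2 * u2 + u3 = (M + 1) * (M + 3) / D.
  by rewrite E3 E2 E1 /D; field; rewrite M2 M4 M6.
have F0123 : 1 - 3 * u1 + 3 * u2 - u3 = (M + 1) * (M + 3) * (M + 5) / D.
  by rewrite E3 E2 E1 /D; field; rewrite M2 M4 M6.
rewrite F23 F123 F0123 F3.
have DV : 0 <= D^-1 by rewrite invr_ge0 ltW.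
have g1 : 3 * (3 * (M + 1) / D) * K1 <= 3 * (3 * (M + 1) / D) * (u1 * K0).
  by rewrite ler_wpM2l// !mulr_ge0//; lra.
have g2 : 3 * ((M + 1) * (M + 3) / D) * K2 <= 3 * ((M + 1) * (M + 3) / D) * (u2 * K0).
  by rewrite ler_wpM2l// !mulr_ge0//; lra.
have g3 : (M + 1) * (M + 3) * (M + 5) / D * K3 <= (M + 1) * (M + 3) * (M + 5) / D * (u3 * K0).
  by rewrite ler_wpM2l// !mulr_ge0//; lra.
apply: (@le_trans _ _ ((M + 2) * ((15 / D + 3 * (3 * (M + 1) / D) * u1 +
   3 * ((M + 1) * (M + 3) / D) * u2 + (M + 1) * (M + 3) * (M + 5) / D * u3) * K0))).
  by apply: ler_wpM2l; [lra|rewrite !mulrDl; lra].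
rewrite [X in X <= _]mulrA; apply: ler_wpM2r; first exact: L0.
rewrite E3 E2 E1.
have M20 : 0 < M + 2 by lra.
have M40 : 0 < M + 4 by lra.
have M60 : 0 < M + 6 by lra.
rewrite -subr_ge0.
have -> : 99 / 100 - (M + 2) * (15 / D + 3 * (3 * (M + 1) / D) * (1 / (M + 2)) +
    3 * ((M + 1) * (M + 3) / D) * (3 * (1 / (M + 2)) / (M + 4)) +
    (M + 1) * (M + 3) * (M + 5) / D * (5 * (3 * (1 / (M + 2)) / (M + 4)) / (M + 6))) =
   (99 * ((M + 4) * (M + 6)) * D - 100 * (15 * D + 9 * (M + 1) * ((M + 4) * (M + 6)) +
     9 * (M + 1) * (M + 3) * (M + 6) + 15 * ((M + 1) * (M + 3) * (M + 5)))) / (100 * ((M + 4) * (M + 6)) * D).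
  by rewrite /D; field; rewrite M2 M4 M6.
apply: divr_ge0; last by rewrite !mulr_ge0// ?ltW.
rewrite /D.
(* Expanded at M = 1, the numerator has nonnegative coefficients only. *)
pose y := M - 1; have y0 : 0 <= y by rewrite /y; lra.
have -> : M = y + 1 by rewrite /y; ring.
have y2 : 0 <= y ^+ 2 by exact: exprn_ge0.
have y3 : 0 <= y ^+ 3 by exact: exprn_ge0.
have y4 : 0 <= y ^+ 4 by exact: exprn_ge0.
have y5 : 0 <= y ^+ 5 by exact: exprn_ge0.
lra.
Qed.

Lemma Lam_leg_bound l a : (2 <= l)%N -> 0 <= a <= hpi ->
  m.+2%:R * `|Lam m (leg m l) a| <= 99 / 100 * Lx m 0 a.
Proof.
move=> l2 ah; have [<-|l3] := eqVneq 2%N l; first exact: Lam_leg2_bound.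
have {}l3 : (3 <= l)%N by rewrite ltn_neqAle l3.
have via d : (d <= l)%N -> m.+2%:R * Lam m (maj m d) a <= 99 / 100 * Lx m 0 a ->
    m.+2%:R * `|Lam m (leg m l) a| <= 99 / 100 * Lx m 0 a.
  move=> dl; apply: le_trans; rewrite ler_wpM2l//.
  by apply: Lam_norm_le => // t; exact: leg_le.
have [m0|m1] := posnP m; last by apply: (via 3%N) => //; exact: Lam_maj3_le.
case: _ / (esym m0) in via *.
have [<-|l4] := eqVneq 3%N l; first exact: Lam3_leg3_bound.
have {}l4 : (4 <= l)%N by rewrite ltn_neqAle l4.
have [<-|l5] := eqVneq 4%N l; first exact: Lam3_leg4_bound.
have {}l5 : (5 <= l)%N by rewrite ltn_neqAle l5.
by apply: (via 5%N) => //; exact: Lam3_maj5_le.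
Qed.

End kernel_bound.

(** * Rodrigues polynomials *)
Section rodrigues_poly.
Context {R : realType} (M : R).
Implicit Types (i j k r : nat) (t : R).

(** (d/dt)^j (1 - t^2)^M = Q_j(t) (1 - t^2)^{M - j}.  The exponent M does not
    depend on j, so that each derivative lowers the exponent of 1 - t^2 by one. *)
Fixpoint Q j : {poly R} := if j is i.+1 then
  (1 - 'X^2) * (Q i)^`() - (2 * (M - i%:R)) *: ('X * Q i) else 1.

Local Notation derE := (derivB, derivD, derivN, derivM, derivZ, derivX, derivXn, derivC).

Lemma QS j : Q j.+1 = (1 - 'X^2) * (Q j)^`() - (2 * (M - j%:R)) *: ('X * Q j).
Proof. by []. Qed.

(** Together with the defining recursion this is the differential equation of the
    Rodrigues polynomials, in first order form. *)
Lemma derivQ j : (Q j.+1)^`() = - (j.+1%:R * (2 * M - j%:R)) *: Q j.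
Proof.
elim: j => [|j ih].
  by rewrite QS /= !derE -!mul_polyC; ring.
have E : (1 - 'X^2) * (Q j)^`() = Q j.+1 + (2 * (M - j%:R)) *: ('X * Q j).
  by rewrite QS subrK.
rewrite (QS j.+1); move: (Q j.+1) ih E => q ih E.
rewrite !derE ih !derE; rewrite -!mul_polyC in E *.
have -> : (1 - 'X^2) * ((- (j.+1%:R * (2 * M - j%:R)))%:P * (Q j)^`()) =
   (- (j.+1%:R * (2 * M - j%:R)))%:P * ((1 - 'X^2) * (Q j)^`()) by ring.
by rewrite E; ring.
Qed.

Fixpoint cQ j i : R := if j is j'.+1 then
    - (2 * (M - j'%:R + i%:R)) * cQ j' i +
    (if i is i'.+1 then (j'%:R - (i'.*2)%:R) * cQ j' i' else 0)
  else (i == 0%N)%:R.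

(** The monomials in which both the recursion of [Q] and the Laplace formula are
    transparent. *)
Definition TQ j i : {poly R} := 'X^(j - i.*2) * (1 - 'X^2) ^+ i.

Lemma cQ_eq0 j i : (j < i.*2)%N -> cQ j i = 0.
Proof.
elim: j i => [|j ih] [|i]//= ji.
rewrite ih; last by rewrite ltnW.
rewrite mulr0 add0r; move: ji; rewrite doubleS !ltnS leq_eqVlt => /orP[/eqP ->|ji].
  by rewrite subrr mul0r.
by rewrite ih ?mulr0.
Qed.

Lemma TQ_step j i : (i.*2 <= j)%N ->
  (1 - 'X^2) * (TQ j i)^`() - (2 * (M - j%:R)) *: ('X * TQ j i) =
  (j%:R - (i.*2)%:R) *: TQ j.+1 i.+1 - (2 * (M - j%:R + i%:R)) *: TQ j.+1 i.
Proof.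
move=> ij; rewrite /TQ -(natrB _ ij).
have -> : (j.+1 - i.*2 = (j - i.*2).+1)%N by rewrite subSn.
have -> : (j.+1 - i.+1.*2 = (j - i.*2).-1)%N by rewrite doubleS subSS subnS.
move: (j - i.*2)%N => r.
case: i ij => [|i] ij; case: r => [|r]; rewrite !derE ?deriv_exp ?derE /=;
  rewrite -!mul_polyC !exprS ?expr0; ring.
Qed.

Lemma Q_sum j : Q j = \sum_(i < j.+1) cQ j i *: TQ j i.
Proof.
elim: j => [|j ih]; first by rewrite big_ord_recr big_ord0 /= /TQ add0r scale1r !expr0 mulr1.
rewrite QS ih raddf_sum /= !mulr_sumr scaler_sumr -sumrB.
transitivity (\sum_(i < j.+1) cQ j i *: ((j%:R - (i.*2)%:R) *: TQ j.+1 i.+1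
    - (2 * (M - j%:R + i%:R)) *: TQ j.+1 i)).
  apply: eq_bigr => i _; have [ij|ij] := leqP i.*2 j; last first.
    by rewrite cQ_eq0// !scale0r deriv0 !mulr0 scaler0 subrr.
  by rewrite -TQ_step// derivZ -!scalerAr scalerBr; congr (_ - _); rewrite !scalerA mulrC.
transitivity (\sum_(i < j.+1) ((cQ j i * (j%:R - (i.*2)%:R)) *: TQ j.+1 i.+1
    - (cQ j i * (2 * (M - j%:R + i%:R))) *: TQ j.+1 i)).
  by apply: eq_bigr => i _; rewrite scalerBr !scalerA.
rewrite sumrB.
rewrite [RHS](eq_bigr (fun i : 'I_j.+2 => - (2 * (M - j%:R + i%:R) * cQ j i) *: TQ j.+1 i +
    (if val i is i'.+1 then (j%:R - (i'.*2)%:R) * cQ j i' else 0) *: TQ j.+1 i)); last first.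
  by move=> i _; rewrite -scalerDl /= mulNr.
rewrite big_split /= [RHS]addrC; congr (_ + _).
  rewrite [RHS]big_ord_recl /= scale0r add0r; apply: eq_bigr => i _.
  by rewrite /bump /= mulrC.
rewrite [RHS]big_ord_recr /= (@cQ_eq0 j j.+1) ?mulr0 ?oppr0 ?scale0r ?addr0.
  by rewrite -sumrN; apply: eq_bigr => i _; rewrite scaleNr mulrC.
by rewrite doubleS ltnS -addnn -addSn leq_addl.
Qed.

(** The falling factorial. *)
Definition ff s : R := \prod_(u < s) (M - u%:R).

Lemma ffS s : ff s.+1 = ff s * (M - s%:R).
Proof. by rewrite /ff big_ord_recr. Qed.

(** The coefficients of [Q] on [TQ].  Multiplied by i! r! they become a falling
    factorial, so that the induction is a ring identity. *)
Lemma cQE j i r : j = (i.*2 + r)%N ->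
  cQ j i * (i`!%:R * r`!%:R) = j`!%:R * 2 ^+ r * (-1) ^+ (i + r) * ff (i + r).
Proof.
elim: j i r => [|j ih] i r.
  case: i => [|i]//; case: r => [|r]// _.
  by rewrite /= /ff big_ord0 !expr0 fact0; ring.
case: i => [|i] e.
  rewrite double0 !add0n in e *; case: r e => // r [e]; subst r.
  have := ih 0%N j erefl; rewrite !add0n /= => h.
  rewrite factS natrM ffS !exprS addr0.
  transitivity (- (2 * (M - j%:R)) * j.+1%:R * (cQ j 0 * (0`!%:R * j`!%:R))).
    by rewrite /=; ring.
  by rewrite h; ring.
have e2 : j = (i.*2 + r.+1)%N by apply: succn_inj; rewrite e doubleS !addSn addnS.
have h2 := ih i r.+1 e2.
have hj : (j%:R - (i.*2)%:R) = r.+1%:R :> R by rewrite e2 natrD; ring.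
rewrite [cQ _ _]/= hj.
case: r e e2 h2 hj => [|r] e e2 h2 hj.
  rewrite cQ_eq0 ?mulr0 ?add0r; last by rewrite e2 doubleS addn1.
  move: h2; rewrite addn0 addn1 => h2.
  transitivity (i.+1%:R * (cQ j i * (i`!%:R * 1`!%:R))).
    by rewrite (factS i) natrM (_ : 0`! = 1%N)// (_ : 1`! = 1%N)//; ring.
  rewrite h2 (factS j) natrM.
  have -> : j.+1%:R = 2 * i.+1%:R :> R by rewrite -natrM e addn0 mul2n.
  by rewrite expr1 expr0; ring.
have e1 : j = (i.+1.*2 + r)%N by rewrite e2 doubleS !addSn !addnS.
have h1 := ih i.+1 r e1.
transitivity (- (2 * (M - j%:R + i.+1%:R)) * r.+1%:R * (cQ j i.+1 * (i.+1`!%:R * r`!%:R)) +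
  i.+1%:R * (cQ j i * (i`!%:R * r.+2`!%:R))).
  by rewrite (factS r.+1) (factS r) (factS i) !natrM; ring.
rewrite h1 h2 (factS j) natrM.
have -> : M - j%:R + i.+1%:R = M - (i.+1 + r)%:R.
  by rewrite e1 -addnn -addnA natrD; ring.
have -> : j.+1%:R = 2 * i.+1%:R + r.+1%:R :> R by rewrite e natrD -mul2n natrM.
by rewrite !addSn !addnS !(ffS (i + r).+1) !(ffS (i + r)) !exprS; ring.
Qed.

End rodrigues_poly.

Section legendre_poly.
Context {R : realType} (m k : nat).
Implicit Types (i j r l : nat) (t : R).
Local Notation M := (m%:R / 2 + k%:R : R).

(** The Legendre polynomial of degree k is an eigenfunction, since zonal harmonics of
    degree k are eigenfunctions of the spherical Laplacian. *)
Lemma lap_Q : lap m (Q M k) = - ((k%:R - 1) * (m%:R + 2 + k%:R)) *: Q M k.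
Proof.
case: k => [|j].
  rewrite /lap /= derivC deriv0 !mulr0 addr0 scaler0 subr0; congr (_ *: _).
  by rewrite -addn2 natrD; ring.
set N : R := m%:R / 2 + j.+1%:R.
have hN : 2 * (N - j%:R) = m%:R + 2 by rewrite /N; field.
have hN2 : 2 * N - j%:R = m%:R + j%:R + 2 by rewrite /N; field.
have := QS N j; have := derivQ N j; move: (Q N j.+1) (Q N j) => q p D E.
rewrite /lap D derivZ.
have -> : (1 - 'X^2) * (- (j.+1%:R * (2 * N - j%:R)) *: p^`()) =
   - (j.+1%:R * (2 * N - j%:R)) *: (q + (2 * (N - j%:R)) *: ('X * p)).
  by rewrite E subrK scalerAr.
rewrite hN hN2 -[m.+2]addn2 natrD -!mul_polyC; ring.
Qed.

Lemma Q_parity t : (Q M k).[- t] = (-1) ^+ k * (Q M k).[t].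
Proof.
rewrite Q_sum !horner_sum mulr_sumr; apply: eq_bigr => i _; rewrite !hornerZ.
have [ik|ik] := leqP i.*2 k; last by rewrite cQ_eq0// !mul0r mulr0.
have h (x : R) : (TQ k i : {poly R}).[x] = x ^+ (k - i.*2) * (1 - x ^+ 2) ^+ i.
  by rewrite /TQ !hornerE.
rewrite !h sqrrN [(- t) ^+ _]exprNn.
have -> : (-1) ^+ (k - i.*2) = (-1) ^+ k :> R.
  by rewrite -[in RHS](subnK ik) exprD -mul2n exprM sqrrN expr1n expr1n mulr1.
by ring.
Qed.

Lemma ff_gt0 s : (s <= k)%N -> 0 < ff M s.
Proof.
move=> sk; apply: prodr_gt0 => u _.
have : (u < k)%N by exact: leq_trans (ltn_ord u) sk.
rewrite -(ltr_nat R) => uk; have : 0 <= m%:R :> R by [].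
lra.
Qed.

End legendre_poly.

Section leg_rodrigues.
Context {R : realType} (m l : nat).
Implicit Types (i j r : nat) (t : R).
Local Notation M := (m%:R / 2 + l.*2%:R : R).

Lemma ff_split i : (i <= l.*2)%N ->
  ff M (l.*2) = ff M (l.*2 - i) * \prod_(v < i) (m%:R / 2 + v.+1%:R).
Proof.
elim: i => [|i ih] il; first by rewrite subn0 big_ord0 mulr1.
rewrite ih 1?ltnW// big_ord_recr /= -(subnSK il) ffS.
have -> : M - (l.*2 - i.+1)%:R = m%:R / 2 + i.+1%:R by rewrite natrB//; ring.
by ring.
Qed.

Lemma mu_prod i : (2 * i)`!%:R =
  mu m i * i`!%:R * 4 ^+ i * \prod_(v < i) (m%:R / 2 + v.+1%:R) :> R.
Proof.
elim: i => [|i ih]; first by rewrite big_ord0 /= /mu muln0 fact0; ring.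
rewrite mulnS add2n (factS (2 * i).+1) (factS (2 * i)) (factS i) !natrM ih exprS big_ord_recr /=.
have := @muS R m i.
have -> : (m + i.*2.+2)%:R = 2 * (m%:R / 2 + i.+1%:R) :> R.
  by rewrite natrD -doubleS -mul2n natrM; field.
have -> : (2 * i).+2%:R = 2 * i.+1%:R :> R by rewrite -natrM mulnS.
rewrite -mul2n; set P := \prod_(_ < _) _; set a := mu m i.+1; set b := mu m i.
set c := m%:R / 2 + i.+1%:R => e.
transitivity (2 * i.+1%:R * ((2 * i).+1%:R * b) * (i`!%:R * 4 ^+ i * P)); first by ring.
by rewrite -e; ring.
Qed.

(** The Laplace and Rodrigues formulas define the same polynomial: the coefficients on
    [TQ] agree. *)
Lemma leg_Q : leg m l = (2 ^+ l.*2 * ff M l.*2)^-1 *: Q M l.*2.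
Proof.
have F0 : 0 < ff M l.*2 by exact: ff_gt0.
have P0 : 0 < 2 ^+ l.*2 * ff M l.*2 by rewrite mulr_gt0// exprn_gt0.
apply: (scalerI (lt0r_neq0 P0)); rewrite scalerA mulfV ?lt0r_neq0// scale1r.
rewrite Q_sum /leg scaler_sumr.
rewrite -[RHS](big_mkord xpredT (fun i => cQ M l.*2 i *: TQ l.*2 i)).
rewrite [RHS](big_cat_nat (n := l.+1))//=; last by rewrite ltnS -addnn leq_addr.
rewrite [X in _ = _ + X]big_nat_cond [X in _ = _ + X]big1 ?addr0; last first.
  move=> i /andP[/andP[li _] _]; rewrite cQ_eq0 ?scale0r//.
  by rewrite ltn_double.
rewrite big_mkord; apply: eq_bigr => -[i /= il] _; rewrite scalerA /TQ -doubleB.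
congr (_ *: _).
have il2 : (i <= l)%N by [].
have e : l.*2 = (i.*2 + (l - i).*2)%N by rewrite -doubleD subnKC.
have := cQE M e; have ie : (i + (l - i).*2 = l.*2 - i)%N.
  by rewrite [in RHS]e -(addnn i) -addnA addKn.
rewrite ie => h.
have := @bin_fact l.*2 i.*2; rewrite leq_double il2 => /(_ isT) hb.
have {}hb : 'C(l.*2, i.*2)%:R * ((2 * i)`!%:R * (l - i).*2`!%:R) = (l.*2)`!%:R :> R.
  by rewrite -hb -doubleB mul2n !natrM.
have hs : ff M l.*2 = ff M (l.*2 - i) * \prod_(v < i) (m%:R / 2 + v.+1%:R).
  by apply: ff_split; rewrite -addnn (leq_trans il2)// leq_addr.
have hm := mu_prod i; rewrite hs.
have sg : (-1) ^+ (l.*2 - i) = (-1) ^+ i :> R.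
  by rewrite -signr_odd oddB ?odd_double ?signr_odd// -addnn (leq_trans il2)// leq_addr.
have i0 : i`!%:R != 0 :> R by rewrite pnatr_eq0 -lt0n fact_gt0.
have r0 : (l - i).*2`!%:R != 0 :> R by rewrite pnatr_eq0 -lt0n fact_gt0.
have p4 : 2 ^+ l.*2 = 4 ^+ i * 2 ^+ (l - i).*2 :> R.
  by rewrite [in LHS]e exprD -[i.*2]mul2n exprM (_ : 2 ^+ 2 = 4)//; ring.
move: h hb hm; rewrite sg p4.
set C := 'C(_, _)%:R; set a := i`!%:R; set b := (l - i).*2`!%:R; set d := (l.*2)`!%:R.
set P := \prod_(_ < _) _; set f := ff M _; set c := cQ _ _ _.
set g := (2 * i)`!%:R; set s := (-1) ^+ i; set u := mu m i => h hb hm.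
apply: (mulIf i0); apply: (mulIf r0).
rewrite -!/a -!/b.
transitivity (c * (a * b)); last by ring.
rewrite h -hb hm; ring.
Qed.

End leg_rodrigues.

(** * The Gamma function at integers and half-integers *)
Section gamma.
Context {R : realType}.
Implicit Types (p m k : nat) (t : R).
Local Notation leb := (@lebesgue_measure R).

(** t^{p/2} e^{-t}, for a natural number p: the integrand of Gamma(p/2 + 1). *)
Definition gker p t : R := Num.sqrt t ^+ p * expR (- t).

Lemma gker_ge0 p t : 0 <= gker p t.
Proof. by rewrite mulr_ge0 ?expR_ge0// exprn_ge0// sqrtr_ge0. Qed.

Lemma cont_gker p : continuous (gker p).
Proof.
move=> x; apply: (@cont_at_M _ (fun t => Num.sqrt t ^+ p) (fun t => expR (- t))).
  by apply: (@cont_at_X _ Num.sqrt); exact: sqrt_continuous.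
by apply: (@cont_at_comp _ expR (fun t => - t)); [exact: continuous_expR|exact: opp_continuous].
Qed.

Lemma gkerS2 p t : 0 <= t -> gker p.+2 t = t * gker p t.
Proof. by move=> t0; rewrite /gker -addn2 exprD sqr_sqrtr//; ring. Qed.

Lemma is_derive_gker p t : 0 < t ->
  is_derive t 1 (gker p.+2) ((p%:R / 2 + 1) * gker p t - gker p.+2 t).
Proof.
move=> t0; have s0 : 0 < Num.sqrt t by rewrite sqrtr_gt0.
have d1 : is_derive t 1 (@Num.sqrt R) (2 * Num.sqrt t)^-1 by exact: is_derive1_sqrt.
have d2 := der_X p.+2 d1.
have d3 := der_comp (is_derive_expR (- t)) (der_N (der_id t)).
have := der_M d2 d3; congr is_derive.
rewrite gkerS2 ?ltW// /gker /= exprS (_ : p.+2%:R = p%:R + 2 :> R); last first.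
  by rewrite -addn2 natrD.
have ht := sqr_sqrtr (ltW t0); set E := expR (- t); move: ht.
set s := Num.sqrt t in s0 *; have sn : s != 0 by rewrite gt_eqF.
by move=> <-; rewrite exprS; field.
Qed.

Lemma gker_cvg0 p : gker p t @[t --> +oo] --> (0 : R).
Proof.
apply/cvgrPdist_lt => e e0.
exists (Num.max 1 (p.+1`!%:R / e)); split; first exact: num_real.
move=> t; rewrite gt_max => /andP[t1 te].
have t0 : 0 < t by apply: lt_trans t1.
rewrite sub0r normrN ger0_norm ?gker_ge0//.
have s1 : Num.sqrt t <= t.
  rewrite -[X in _ <= X](sqr_sqrtr (ltW t0)) expr2 ler_peMl// ?sqrtr_ge0//.
  by rewrite -sqrtr1 ler_sqrt// ltW.
apply: (@le_lt_trans _ _ (t ^+ p * expR (- t))).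
  by rewrite ler_wpM2r ?expR_ge0// lerXn2r// ?nnegrE ?sqrtr_ge0// ltW.
have f0 : 0 < p.+1`!%:R :> R by rewrite ltr0n fact_gt0.
have := expR_ge1Dxn p (ltW t0) => h.
have : t ^+ p.+1 / p.+1`!%:R < expR t by apply: lt_le_trans h; rewrite ltrDr.
rewrite ltr_pdivrMr// => h2.
rewrite expRN ltr_pdivrMr ?expR_gt0//.
rewrite -(ltr_pM2l t0) -exprS; apply: lt_le_trans h2 _.
rewrite mulrC mulrA ler_wpM2r ?expR_ge0//.
by move: te; rewrite ltr_pdivrMr// => /ltW.
Qed.

Definition Gint p : \bar R := (\int[leb]_(t in `[0%R, +oo[) (gker p t)%:E)%E.

(** Gamma(x + 1) = x Gamma(x), from the primitive t^{m/2 + 1} e^{-t}.  The derivative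
    changes sign at t = m/2 + 1 only; cutting there keeps all the integrals
    nonnegative, so no integrability is used. *)
Lemma Gint_rec m : Gint m.+2 = ((m%:R / 2 + 1)%:E * Gint m)%E.
Proof.
set A : R := m%:R / 2 + 1.
have A0 : 0 < A by rewrite /A ltr_wpDl// divr_ge0.
pose h t := gker m.+2 t - A * gker m t.
have c1 := @cont_gker m; have c2 := @cont_gker m.+2.
have ch : continuous h by rewrite /h; cont.
have chN : continuous (fun t => A * gker m t - gker m.+2 t) by cont.
have hE t : 0 <= t -> h t = (t - A) * gker m t.
  by move=> t0; rewrite /h gkerS2//; ring.
have dg t : 0 < t -> is_derive t 1 (gker m.+2) (- h t).
  by move=> t0; have := is_derive_gker m t0; rewrite opprB.
have I1 : (\int[leb]_(t in `[A, +oo[) (h t)%:E = (gker m.+2 A)%:E)%E.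
  have dgN t : A < t -> is_derive t 1 (fun t => - gker m.+2 t) (h t).
    by move=> At; have := der_N (dg t (lt_trans A0 At)); rewrite opprK.
  rewrite (@ge0_continuous_FTC2y _ h (fun t => - gker m.+2 t) A 0).
  - by rewrite sub0e EFinN oppeK.
  - by move=> t At; rewrite hE ?mulr_ge0 ?subr_ge0 ?gker_ge0// (le_trans (ltW A0)).
  - exact: continuous_subspaceT.
  - by rewrite -oppr0; apply: cvgN; exact: gker_cvg0.
  - by move=> t At; have [] := dgN t At.
  - by apply: cvg_at_right_filter; apply: cvgN; exact: c2.
  - move=> t; rewrite in_itv/= andbT => At; rewrite derive1E.
    by have [_ ->] := dgN t At.
have I2 : (\int[leb]_(t in `[0%R, A]) (A * gker m t - gker m.+2 t)%:E = (gker m.+2 A)%:E)%E.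
  rewrite (@continuous_FTC2 _ (fun t => A * gker m t - gker m.+2 t) (gker m.+2))//.
  - by rewrite [X in (_ - X)%E](_ : _ = 0%:E) ?sube0// /gker sqrtr0 expr0n mul0r.
  - exact: continuous_subspaceT.
  - split; [|exact/cvg_at_right_filter/c2|exact/cvg_at_left_filter/c2].
    by move=> t /[!in_itv]/= /andP[t0 _]; have [] := dg t t0.
  - move=> t /[!in_itv]/= /andP[t0 _]; rewrite derive1E.
    by have [_ ->] := dg t t0; rewrite opprB.
have mf (f : R -> R) (D : set R) : measurable D -> continuous f ->
    measurable_fun D (fun t => (f t)%:E).
  move=> mD cf; apply/measurable_EFinP; apply: measurable_funTS.
  exact: continuous_measurable_fun.
have cA : continuous (fun t => A * gker m t) by cont.
have Ag t : 0 <= A * gker m t by rewrite mulr_ge0 ?gker_ge0// ltW.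
have AG : (A%:E * Gint m = \int[leb]_(t in `[0%R, +oo[) (A * gker m t)%:E)%E.
  rewrite /Gint -ge0_integralZl//; last 3 first.
  - exact: mf.
  - by move=> t _; rewrite lee_fin gker_ge0.
  - by rewrite lee_fin ltW.
rewrite AG /Gint.
have S : `[0%R, +oo[%classic = `[0%R, A] `|` `]A, +oo[%classic.
  by rewrite -itv_bndbnd_setU// bnd_simp ltW.
have D : [disjoint `[0%R, A]%classic & `]A, +oo[%classic].
  rewrite disj_set2E; apply/eqP/seteqP; split => // t /= [].
  by rewrite !in_itv/= andbT => /andP[_ tA] /(le_lt_trans tA); rewrite ltxx.
have spl (f : R -> R) : continuous f -> (forall t, 0 <= f t) ->
    (\int[leb]_(t in `[0%R, +oo[) (f t)%:E =
     \int[leb]_(t in `[0%R, A]) (f t)%:E + \int[leb]_(t in `[A, +oo[) (f t)%:E)%E.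
  move=> cf f0; rewrite S ge0_integral_setU//=.
  - by congr (_ + _)%E; rewrite integral_itv_obnd_cbnd//; exact: mf.
  - by apply: mf => //; exact: measurableU.
  - by move=> t _; rewrite lee_fin.
rewrite (spl _ cA Ag) (spl _ c2 (@gker_ge0 _)).
have e1 : (\int[leb]_(t in `[A, +oo[) (gker m.+2 t)%:E =
    (gker m.+2 A)%:E + \int[leb]_(t in `[A, +oo[) (A * gker m t)%:E)%E.
  rewrite -I1 -ge0_integralD//=.
  - by apply: eq_integral => t _; rewrite -EFinD /h subrK.
  - move=> t; rewrite /= in_itv/= andbT => At.
    by rewrite lee_fin hE ?mulr_ge0 ?subr_ge0 ?gker_ge0// (le_trans (ltW A0)).
  - exact: mf.
  - by move=> t _; rewrite lee_fin.
  - exact: mf.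
have e2 : (\int[leb]_(t in `[0%R, A]) (A * gker m t)%:E =
    (gker m.+2 A)%:E + \int[leb]_(t in `[0%R, A]) (gker m.+2 t)%:E)%E.
  rewrite -I2 -ge0_integralD//=.
  - by apply: eq_integral => t _; rewrite -EFinD subrK.
  - move=> t; rewrite /= in_itv/= => /andP[t0 tA].
    by rewrite lee_fin -opprB -/(h t) hE// -mulNr opprB mulr_ge0 ?subr_ge0 ?gker_ge0.
  - exact: mf.
  - by move=> t _; rewrite lee_fin gker_ge0.
  - exact: mf.
by rewrite e1 e2 addeCA addeA.
Qed.

Lemma measurable_gker p (D : set R) : measurable D ->
  measurable_fun D (fun t => (gker p t)%:E).
Proof.
move=> mD; apply/measurable_EFinP; apply: measurable_funTS.
by apply: continuous_measurable_fun; exact: cont_gker.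
Qed.

Lemma Gint0 : Gint 0 = 1%:E.
Proof.
have dg t : is_derive t 1 (fun t : R => - expR (- t)) (gker 0 t).
  have := der_N (der_comp (is_derive_expR (- t)) (der_N (der_id t))).
  by rewrite /gker expr0 mulN1r opprK mul1r.
have ck := @cont_gker 0.
have c t : {for t, continuous (fun t : R => - expR (- t))}.
  by have [h _] := dg t; apply/differentiable_continuous/derivable1_diffP.
rewrite /Gint (@ge0_continuous_FTC2y _ (gker 0) (fun t => - expR (- t)) 0 0).
- by rewrite oppr0 expR0 sub0e EFinN oppeK.
- by move=> t _; exact: gker_ge0.
- exact: continuous_subspaceT.
- by rewrite -oppr0; apply: cvgN; exact: cvgr_expR.
- by move=> t _; have [] := dg t.
- exact/cvg_at_right_filter/c.
- by move=> t _; rewrite derive1E; have [_ ->] := dg t.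
Qed.

Lemma Gint_gt0 p : (0 < Gint p)%E.
Proof.
have sub : [set` `[1 : R, 2]] `<=` [set` `[0 : R, +oo[].
  by move=> t /=; rewrite !in_itv/= andbT => /andP[+ _]; apply: le_trans.
apply: (@lt_le_trans _ _ (\int[leb]_(t in `[1%R, 2%R]) (gker p t)%:E)%E); last first.
  apply: ge0_subset_integral => //; first exact: measurable_gker.
  by move=> t _; rewrite lee_fin gker_ge0.
have ck := @cont_gker p.
have h : 0 < RI 1 2 (gker p).
  apply: (@RI_gt0 _ _ _ _ 1) => //; rewrite ?ltr1n ?lexx ?ler1n//.
    by move=> t _; exact: gker_ge0.
  by rewrite /gker sqrtr1 expr1n mul1r expR_gt0.
have -> : (\int[leb]_(t in `[1%R, 2%R]) (gker p t)%:E = (RI 1 2 (gker p))%:E)%E.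
  by rewrite /RI /Rintegral fineK//; apply: integrable_fin_num => //; exact: integrable_segment.
by rewrite lte_fin.
Qed.

Lemma Gint_fin p : (Gint p < +oo)%E.
Proof.
have step q : (Gint q < +oo)%E -> (Gint q.+2 < +oo)%E.
  move=> h; rewrite Gint_rec lte_mul_pinfty// lee_fin addr_ge0// divr_ge0//.
have h0 : (Gint 0 < +oo)%E by rewrite Gint0 ltry.
have h1 : (Gint 1 < +oo)%E.
  apply: (@le_lt_trans _ _ (Gint 0 + Gint 2)%E); last by rewrite lte_add_pinfty// step.
  rewrite /Gint -ge0_integralD//=; last 4 first.
  - by move=> t _; rewrite lee_fin gker_ge0.
  - exact: measurable_gker.
  - by move=> t _; rewrite lee_fin gker_ge0.
  - exact: measurable_gker.
  apply: ge0_le_integral => //=.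
  - by move=> t _; rewrite lee_fin gker_ge0.
  - exact: measurable_gker.
  - by apply: emeasurable_funD; exact: measurable_gker.
  - move=> t; rewrite in_itv/= andbT => t0; rewrite -EFinD lee_fin /gker -mulrDl.
    rewrite ler_wpM2r ?expR_ge0// expr0 expr1.
    have s0 := sqrtr_ge0 t; set s := Num.sqrt t in s0 *; nra.
suff : (Gint p < +oo)%E /\ (Gint p.+1 < +oo)%E by case.
by elim: p => [|p [ih1 ih2]]; split => //; exact: step.
Qed.

Lemma GammaE p : Gamma (p%:R / 2 + 1 : R) = fine (Gint p).
Proof.
rewrite /Gamma /Rintegral /Gint; congr fine.
rewrite -integral_itv_obnd_cbnd; last exact: measurable_gker.
apply: eq_integral => t; rewrite inE/= in_itv/= andbT => t0; congr (_%:E).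
rewrite /gker addrK; congr (_ * _).
by rewrite mulrC powRrM powR12_sqrt ?ltW// powR_mulrn// sqrtr_ge0.
Qed.

Lemma Gamma_gt0 p : 0 < Gamma (p%:R / 2 + 1 : R).
Proof. by rewrite GammaE fine_gt0// Gint_gt0 Gint_fin. Qed.

Lemma Gamma_rec p : Gamma (p.+2%:R / 2 + 1 : R) = (p%:R / 2 + 1) * Gamma (p%:R / 2 + 1 : R).
Proof.
rewrite !GammaE Gint_rec fineM// ge0_fin_numE ?Gint_fin//.
by rewrite ltW// Gint_gt0.
Qed.

End gamma.

(** * The Rodrigues formula *)
Section gamma_shift.
Context {R : realType}.
Implicit Types (p m k : nat).

Lemma Gamma_shift m k :
  Gamma (m%:R / 2 + 1 + k%:R : R) = Gamma (m%:R / 2 + 1 : R) * ff (m%:R / 2 + k%:R) k.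
Proof.
elim: k => [|k ih]; first by rewrite addr0 /ff big_ord0 mulr1.
have e2 : k.*2%:R = 2 * k%:R :> R by rewrite -natrM mul2n.
have -> : m%:R / 2 + 1 + k.+1%:R = (m + k.*2).+2%:R / 2 + 1 :> R.
  by rewrite -(addn2 (m + k.*2)) 2!natrD e2 -(addn1 k) natrD; field.
rewrite Gamma_rec.
have -> : (m + k.*2)%:R / 2 + 1 = m%:R / 2 + 1 + k%:R :> R.
  by rewrite natrD e2; field.
rewrite ih /ff big_ord_recl /= subr0.
have -> : \prod_(i < k) (m%:R / 2 + k.+1%:R - (fintype.bump 0 i)%:R) =
    \prod_(i < k) (m%:R / 2 + k%:R - i%:R) :> R.
  by apply: eq_bigr => i _; rewrite /fintype.bump /= add1n -(addn1 k) -(addn1 (nat_of_ord i)) !natrD; ring.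
rewrite -(addn1 k) natrD; ring.
Qed.

End gamma_shift.

Section legendre.
Context {R : realType}.
Implicit Types (m k j : nat) (s t M : R).

Lemma derive1n_rodrigues M j s : -1 < s < 1 ->
  derive1n j (fun s : R => (1 - s ^+ 2) `^ M) s = (Q M j).[s] * (1 - s ^+ 2) `^ (M - j%:R).
Proof.
elim: j s => [|j ih] s hs; first by rewrite derive1n0 /= hornerC mul1r subr0.
rewrite derive1nS derive1E.
have U0 (x : R) : -1 < x < 1 -> 0 < 1 - x ^+ 2 by move=> /andP[? ?]; nra.
pose F (x : R) := (Q M j).[x] * (1 - x ^+ 2) `^ (M - j%:R).
have -> : 'D_1 (derive1n j (fun s : R => (1 - s ^+ 2) `^ M)) s = 'D_1 F s.
  apply: near_eq_derive.
  have : \forall x \near s, x \in `]-1, 1[ by apply: near_in_itvoo; rewrite in_itv/=.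
  by apply: filterS => x; rewrite in_itv/=; exact: ih.
have d1 : is_derive s 1 (fun x => 1 - x ^+ 2) (- (1 * (2%:R * s ^+ 1))).
  by have := der_D (der_cst 1 s) (der_N (der_X 2 (der_id s))); rewrite add0r.
have d2 := @der_comp _ (fun y => y `^ (M - j%:R)) (fun x => 1 - x ^+ 2) s _ _ (is_derive1_powR (M - j%:R) (U0 _ hs)) d1.
have d3 := der_M (der_horner (Q M j) (der_id s)) d2.
have [_ ->] := d3.
have hQ : (Q M j.+1).[s] = (1 - s ^+ 2) * (Q M j)^`().[s] - 2 * (M - j%:R) * (s * (Q M j).[s]).
  by rewrite QS !hornerE.
rewrite hQ.
have -> : (1 - s ^+ 2) `^ (M - j%:R) = (1 - s ^+ 2) * (1 - s ^+ 2) `^ (M - j.+1%:R).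
  rewrite -[X in _ = X * _](powRr1 (ltW (U0 _ hs))) -powRD.
    by congr (_ `^ _); rewrite -(addn1 j) natrD; ring.
  by apply/implyP => _; rewrite gt_eqF// U0.
have -> : M - j%:R - 1 = M - j.+1%:R :> R by rewrite -(addn1 j) natrD; ring.
set E := _ `^ _; rewrite expr1; ring.
Qed.

(** On ]-1, 1[ the powers of 1 - t^2 in the Rodrigues formula cancel, and at the end
    points the limit of a polynomial is its value. *)
Lemma legendre_horner m k t : -1 <= t <= 1 ->
  legendre m.+3 k t =
    ((-1) ^+ k / (2 ^+ k * ff (m%:R / 2 + k%:R) k)) * (Q (m%:R / 2 + k%:R) k).[t].
Proof.
move=> ht; set M : R := m%:R / 2 + k%:R.
set c := (-1) ^+ k / _.
rewrite /legendre.
have U0 (x : R) : -1 < x < 1 -> 0 < 1 - x ^+ 2 by move=> /andP[? ?]; nra.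
have m3 : (m.+3%:R - 3) / 2 = m%:R / 2 :> R by rewrite -(addn3 m) natrD; field.
have m1 : (m.+3%:R - 1) / 2 = m%:R / 2 + 1 :> R by rewrite -(addn3 m) natrD; field.
have f0 : 0 < ff M k by exact: ff_gt0.
have rE s : -1 < s < 1 -> rodrigues m.+3 k s = c * (Q M k).[s].
  move=> hs; rewrite /rodrigues m3 m1 derive1n_rodrigues// Gamma_shift.
  have -> : m%:R / 2 + k%:R - k%:R = m%:R / 2 :> R by ring.
  rewrite -/M powRN.
  have p0 : 0 < (1 - s ^+ 2) `^ (m%:R / 2) by apply: powR_gt0; exact: U0.
  have g0 := @Gamma_gt0 R m.
  move: p0 g0; set P := _ `^ _; set G := Gamma _ => p0 g0.
  have pn := lt0r_neq0 p0; have gn := lt0r_neq0 g0; have fn := lt0r_neq0 f0.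
  rewrite /c; have tn : 2 ^+ k != 0 :> R by rewrite expf_neq0.
  move: tn fn; set T := 2 ^+ k; set D := ff M k => tn fn; field.
  by rewrite pn gn tn fn.
have tI : closure (`]-1, 1[%classic : set R) t.
  move=> B /nbhs_ballP[d /= d0 dB].
  pose w : R := Num.min (d / 2) (1 / 2).
  have w0 : 0 < w by rewrite /w lt_min !divr_gt0.
  have w1 : w <= 1 / 2 by rewrite /w ge_min lexx orbT.
  have wd : w <= d / 2 by rewrite /w ge_min lexx.
  exists ((1 - w) * t); split; first by rewrite /= in_itv/=; apply/andP; split; nra.
  apply: dB; rewrite /ball/= ltr_norml; apply/andP; split; nra.
have := within_nbhs_proper tI => PF.
apply: cvg_lim => //.
have hc : {for t, continuous (fun s => c * (Q M k).[s])}.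
  by apply: (@cont_at_M _ (fun=> c)); [exact: cvg_cst|exact: continuous_horner].
have hw : (fun s => c * (Q M k).[s]) s @[s --> within (`]-1, 1[%classic : set R) (nbhs t)] --> c * (Q M k).[t].
  by apply: cvg_trans hc; apply: cvg_app; exact: cvg_within.
apply: cvg_trans hw; apply: near_eq_cvg.
rewrite near_withinE; apply: filterE => s /=; rewrite in_itv/= => hs.
by rewrite rE.
Qed.

Lemma legendre_even m l t : -1 <= t <= 1 -> legendre m.+3 l.*2 t = (leg m l).[t].
Proof.
move=> ht; rewrite legendre_horner// leg_Q hornerZ.
by rewrite -signr_odd odd_double expr0 mul1r.
Qed.

End legendre.

(** * Lebesgue measure on tuples *)
Section lebesgue_line.
Context {R : realType}.
Local Open Scope ereal_scope.
Local Notation leb := (@lebesgue_measure R).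

(** Uniqueness of Lebesgue measure: both sides agree on half-open intervals. *)
Lemma lebesgue_affine (r a : R) (f : R -> \bar R) : (0 < r)%R ->
  measurable_fun [set: R] f -> (forall x, 0 <= f x) ->
  r%:E * \int[leb]_x f (r * x + a)%R = \int[leb]_x f x.
Proof.
move=> r0 mf f0; pose phi (x : measurableTypeR R) : measurableTypeR R := (r * x + a)%R.
have mphi : measurable_fun [set: measurableTypeR R] phi.
  by apply: measurable_funD => //; exact: measurable_funM.
pose nu : {measure set (measurableTypeR R) -> \bar R} :=
  measure_function_pushforward__canonical__measure_function_Measure leb mphi.
pose k : {nonneg R} := NngNum (ltW r0).
have E A : measurable A -> leb A = mscale k nu A.
  apply: lebesgue_measure_unique => /= _ [[u v] /= _ <-].
  rewrite /mscale /= /pushforward.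
  have -> : phi @^-1` `]u, v]%classic = `]((u - a) / r)%R, ((v - a) / r)%R]%classic.
    apply/seteqP; split => x /=; rewrite !in_itv/= /phi ltr_pdivrMr// ler_pdivlMr//.
      by rewrite ltrBlDr lerBrDr ![(x * r)%R]mulrC.
    by rewrite ltrBlDr lerBrDr ![(x * r)%R]mulrC.
  rewrite !lebesgue_measure_itv/= !lte_fin ltr_pM2r ?invr_gt0// ltrD2r.
  case: ifP => _; last by rewrite mule0.
  by rewrite -!EFinB -EFinM; congr (_%:E); field; rewrite gt_eqF.
rewrite [RHS](@eq_measure_integral _ _ _ _ (mscale k nu)) => [|A mA _]; last exact: E.
rewrite ge0_integral_mscale//; congr (_ * _).
by rewrite ge0_integral_pushforward// => x _; exact: f0.
Qed.

End lebesgue_line.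

Section lebesgue_tuple_theory.
Context {R : realType}.
Local Open Scope ereal_scope.
Local Notation leb := (@lebesgue_measure R).
Local Notation lt n := (@lebesgue_tuple R n).

(** Tonelli, with the first coordinate innermost. *)
Lemma integral_tcons n (f : n.+1.-tuple R -> \bar R) :
  measurable_fun setT f -> (forall t, 0 <= f t) ->
  \int[lt n.+1]_t f t = \int[lt n]_y \int[leb]_x f (tcons (x, y)).
Proof.
move=> mf f0.
have := @ge0_integral_pushforward _ _ _ _ R (@tcons R n) (@measurable_tcons R n) (leb \x lt n) setT f measurableT mf (fun t _ => f0 t).
rewrite preimage_setT => ->.
rewrite (@fubini_tonelli2 _ _ _ _ _ leb (lt n))//=.
  by apply: measurableT_comp => //; exact: measurable_tcons.
Qed.

Lemma rowt_tcons n (x : R) (y : n.-tuple R) i :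
  rowt (tcons (x, y)) 0%R i = if unlift ord0 i is Some j then rowt y 0%R j else x.
Proof.
rewrite !mxE; case: unliftP => [j ->|->] //=.
by rewrite !mxE (tnth_nth x) /= (tnth_nth x).
Qed.

Lemma trowK n : cancel (@rowt R n) trow.
Proof. by move=> t; apply: eq_from_tnth => i; rewrite tnth_mktuple mxE. Qed.

Lemma rowtK n : cancel (@trow R n) rowt.
Proof. by move=> t; apply/rowP => i; rewrite mxE tnth_mktuple. Qed.

Lemma measurable_trow d (T : measurableType d) n (F : T -> 'rV[R]_n) :
  (forall i, measurable_fun setT (fun t => F t 0%R i)) ->
  measurable_fun setT (fun t => trow (F t)).
Proof.
move=> mF; apply/measurable_fun_tnthP => i.
by rewrite (_ : _ \o _ = fun t => F t 0%R i)//; apply/funext => t /=; rewrite tnth_mktuple.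
Qed.

Lemma lebesgue_tuple_affine n (r : R) (v : 'rV[R]_n) (f : n.-tuple R -> \bar R) :
  (0 < r)%R -> measurable_fun setT f -> (forall t, 0 <= f t) ->
  (r ^+ n)%:E * \int[lt n]_t f (trow (r *: rowt t + v)%R) = \int[lt n]_t f t.
Proof.
move=> r0; elim: n v f => [|n ih] v f mf f0.
  rewrite mul1e; apply: eq_integral => t _; congr f.
  by apply: eq_from_tnth => -[].
have mg : measurable_fun setT (fun t : n.+1.-tuple R => trow (r *: rowt t + v)%R).
  apply: measurable_trow => i; under eq_fun do rewrite !mxE.
  apply: measurable_funD => //; apply: measurable_funM => //.
  exact: measurable_tnth.
rewrite !integral_tcons//; last exact: measurableT_comp.
pose w : 'rV[R]_n := \row_i v 0%R (lift ord0 i).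
have E x y : trow (r *: rowt (tcons (x, y)) + v)%R =
    tcons ((r * x + v 0 0)%R, trow (r *: rowt y + w)%R).
  apply: (can_inj (@trowK _)); apply/rowP => i.
  rewrite rowtK rowt_tcons rowtK !mxE.
  by case: unliftP => [j ->|->]; rewrite ?mxE //= (tnth_nth x) /= (tnth_nth x).
have msec y : measurable_fun setT (fun x : R => f (tcons (x, y))).
  apply: measurableT_comp => //.
  by apply: (measurableT_comp (@measurable_tcons _ n)); exact: pair2_measurable.
have mI : measurable_fun setT (fun y : n.-tuple R => \int[leb]_x f (tcons (x, y))).
  apply: (@measurable_fun_fubini_tonelli_G _ _ _ _ _ leb (fun p => f (tcons p))) => //.
  by apply: measurableT_comp => //; exact: measurable_tcons.
have I0 y : 0 <= \int[leb]_x f (tcons (x, y)) by apply: integral_ge0.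
rewrite -[RHS](ih w); [|exact: mI|exact: I0].
rewrite exprSr EFinM -muleA; congr (_ * _).
rewrite -ge0_integralZl//; last 3 first.
- apply: (@measurable_fun_fubini_tonelli_G _ _ _ _ _ leb (fun p => f (trow (r *: rowt (tcons p) + v)%R))) => //.
  apply: (measurableT_comp mf); apply: (measurableT_comp mg).
  exact: measurable_tcons.
- by move=> y _; exact: integral_ge0.
- by rewrite lee_fin ltW.
apply: eq_integral => y _.
under eq_integral do rewrite E.
by rewrite (@lebesgue_affine _ r (v 0%R 0%R) (fun x => f (tcons (x, _)))).
Qed.

Lemma lebesgue_tuple_shift n (v : 'rV[R]_n) (f : n.-tuple R -> \bar R) :
  measurable_fun setT f -> (forall t, 0 <= f t) ->
  \int[lt n]_t f (trow (rowt t + v)%R) = \int[lt n]_t f t.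
Proof.
move=> mf f0; rewrite -(@lebesgue_tuple_affine n 1%R v f)// expr1n mul1e.
by under [RHS]eq_integral do rewrite scale1r.
Qed.

Lemma lebesgue_tuple_box n (I : set R) : measurable I ->
  measurable [set t : n.-tuple R | forall i, I (tnth t i)] /\
  lt n [set t | forall i, I (tnth t i)] = (leb I) ^+ n.
Proof.
move=> mI; elim: n => [|n [mB ih]].
  have -> : [set t : 0.-tuple R | forall i, I (tnth t i)] = setT.
    by apply/seteqP; split => // t _ [].
  by split=> //=; rewrite diracT.
have mB' : measurable [set t : n.+1.-tuple R | forall i, I (tnth t i)].
  rewrite (_ : [set _ | _] = \bigcap_(i in setT) ((@tnth _ _ ^~ i) @^-1` I)); last first.
    by apply/seteqP; split => t /= h; [move=> i _; exact: h|move=> i; exact: (h i)].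
  apply: fin_bigcap_measurable => // i _.
  by rewrite -[X in measurable X]setTI; exact: measurable_tnth.
split=> //; rewrite expeS -ih /= /pushforward.
rewrite (_ : _ @^-1` _ = I `*` [set t : n.-tuple R | forall i, I (tnth t i)]).
  by rewrite product_measure1E.
apply/seteqP; split => -[x y] /=.
  move=> h; split; first exact: (h ord0).
  by move=> i /=; have := h (lift ord0 i); rewrite (tnth_nth x) /= -(tnth_nth x).
move=> [Ix hy] i; case: (unliftP ord0 i) => [j ->|->]//.
by rewrite (tnth_nth x) /= -(tnth_nth x).
Qed.

End lebesgue_tuple_theory.

(** * Reflections and rotation invariance *)
Section euclidean_theory.
Context {R : realType} {n : nat}.
Implicit Types (x y u w : 'rV[R]_n) (A : 'M[R]_n).

Lemma dotE x y : dot x y = (x *m y^T) 0 0.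
Proof. by rewrite mxE; apply: eq_bigr => i _; rewrite mxE. Qed.

Lemma dotC x y : dot x y = dot y x.
Proof. by apply: eq_bigr => i _; rewrite mulrC. Qed.

Lemma dotDl x y w : dot (x + y) w = dot x w + dot y w.
Proof. by rewrite !dotE mulmxDl mxE. Qed.

Lemma dotNl x w : dot (- x) w = - dot x w.
Proof. by rewrite !dotE mulNmx mxE. Qed.

Lemma dotZl (a : R) x w : dot (a *: x) w = a * dot x w.
Proof. by rewrite !dotE -scalemxAl mxE. Qed.

Lemma dotDr w x y : dot w (x + y) = dot w x + dot w y.
Proof. by rewrite ![dot w _]dotC dotDl. Qed.

Lemma dotNr w x : dot w (- x) = - dot w x.
Proof. by rewrite ![dot w _]dotC dotNl. Qed.

Lemma dotZr (a : R) w x : dot w (a *: x) = a * dot w x.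
Proof. by rewrite ![dot w _]dotC dotZl. Qed.

Lemma dot0l x : dot 0 x = 0.
Proof. by rewrite dotE mul0mx mxE. Qed.

Lemma dotxx_ge0 x : 0 <= dot x x.
Proof. by apply: sumr_ge0 => i _; rewrite -expr2 sqr_ge0. Qed.

Lemma dotxx_eq0 x : (dot x x == 0) = (x == 0).
Proof.
apply/idP/eqP => [|->]; last by rewrite dot0l.
rewrite psumr_eq0; last by move=> i _; rewrite -expr2 sqr_ge0.
move=> /allP h; apply/rowP => i; rewrite mxE; apply/eqP.
by have := h i (mem_index_enum _); rewrite mulf_eq0 orbb.
Qed.

Lemma enorm_ge0 x : 0 <= enorm x.
Proof. exact: sqrtr_ge0. Qed.

Lemma sqr_enorm x : enorm x ^+ 2 = dot x x.
Proof. by rewrite sqr_sqrtr// dotxx_ge0. Qed.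

Lemma enorm_eq0 x : (enorm x == 0) = (x == 0).
Proof. by rewrite -dotxx_eq0 -sqr_enorm sqrf_eq0. Qed.

Lemma enormZ (a : R) x : enorm (a *: x) = `|a| * enorm x.
Proof.
by rewrite /enorm dotZl dotZr mulrA sqrtrM -?expr2 ?sqr_ge0// sqrtr_sqr.
Qed.

Lemma enormN x : enorm (- x) = enorm x.
Proof. by rewrite /enorm dotNl dotNr opprK. Qed.

Lemma dot_orthogonal A x y : A *m A^T = 1%:M -> dot (x *m A) (y *m A) = dot x y.
Proof. by move=> h; rewrite !dotE trmx_mul mulmxA -(mulmxA x) h mulmx1. Qed.

Lemma enorm_orthogonal A x : A *m A^T = 1%:M -> enorm (x *m A) = enorm x.
Proof. by move=> h; rewrite /enorm dot_orthogonal. Qed.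

Definition reflection w : 'M[R]_n := 1%:M - (2 / dot w w) *: (w^T *m w).

(** With the convention 1 / 0 = 0, [reflection 0] is the identity; this spares the case
    u = w in [reflection_swap]. *)
Lemma mulmx_reflection x w : x *m reflection w = x - (2 * dot x w / dot w w) *: w.
Proof.
rewrite /reflection mulmxBr mulmx1 -scalemxAr mulmxA.
rewrite [x *m w^T]mx11_scalar -dotE mul_scalar_mx scalerA.
by congr (_ - _ *: _); ring.
Qed.

Lemma tr_reflection w : (reflection w)^T = reflection w.
Proof. by rewrite /reflection linearB /= trmx1 linearZ /= trmx_mul trmxK. Qed.

Lemma reflection_orthogonal w : reflection w *m (reflection w)^T = 1%:M.
Proof.
rewrite tr_reflection; apply/row_matrixP => i; rewrite row_mul.
rewrite !mulmx_reflection row1; set x := delta_mx 0 i.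
have E : row i (reflection w) = x - (2 * dot x w / dot w w) *: w.
  by rewrite -mulmx_reflection rowE.
rewrite E dotDl dotNl dotZl; have [w0|wn0] := eqVneq (dot w w) 0.
  by have /eqP -> : w == 0; [rewrite -dotxx_eq0 w0|rewrite !scaler0 !subr0].
have -> : 2 * (dot x w - 2 * dot x w / dot w w * dot w w) / dot w w = - (2 * dot x w / dot w w).
  by field.
by rewrite scaleNr opprK subrK.
Qed.

Lemma reflection_swap u w : dot u u = dot w w -> u *m reflection (u - w) = w.
Proof.
move=> h; rewrite mulmx_reflection.
have [/eqP uw|uw] := eqVneq (u - w) 0.
  by move: uw; rewrite subr_eq0 => /eqP ->; rewrite subrr scaler0 subr0.
have n0 : dot (u - w) (u - w) != 0 by rewrite dotxx_eq0.
have -> : 2 * dot u (u - w) / dot (u - w) (u - w) = 1.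
  apply: (mulIf n0); rewrite mulfVK// mul1r.
  by rewrite !(dotDl, dotDr, dotNl, dotNr) -h (dotC w u); ring.
by rewrite scale1r opprB addrC subrK.
Qed.

End euclidean_theory.

Section rotation.
Context {R : realType}.
Local Open Scope ereal_scope.
Local Notation leb := (@lebesgue_measure R).
Local Notation lt n := (@lebesgue_tuple R n).

(** The punctured ball over which the cones defining the spherical measure are
    taken. *)
Definition pball n : set (n.-tuple R) := [set t | (0 < enorm (rowt t) <= 1)%R].

Arguments pball n _ : clear implicits.

Lemma measurable_pball n : measurable (pball n).
Proof.
have -> : pball n = (enorm \o rowt) @^-1` `]0%R, 1%R].
  by apply/funext => t /=; rewrite in_itv.
by rewrite -[X in measurable X]setTI; exact: measurable_enorm.
Qed.

Lemma pball_gt0 n : 0 < lt n.+1 (pball n.+1).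
Proof.
pose a : R := (n.+1%:R^-1)%R.
have a0 : (0 < a)%R by rewrite invr_gt0 ltr0n.
have mI : measurable (`]0%R, a]%classic : set R) by [].
have [mB B] := @lebesgue_tuple_box R n.+1 _ mI.
apply: (@lt_le_trans _ _ (lt n.+1 [set t | forall i, `]0%R, a]%classic (tnth t i)])); last first.
  apply: le_measure; rewrite ?inE//; first exact: measurable_pball.
  move=> t /= h; have h' i : (0 < tnth t i <= a)%R by have := h i; rewrite in_itv.
  rewrite /pball /= sqrtr_gt0; apply/andP; split.
    apply: (@lt_le_trans _ _ (tnth t ord0 * tnth t ord0)%R).
      by apply: mulr_gt0; have /andP[] := h' ord0.
    rewrite /dot (bigD1 ord0)//= !mxE lerDl sumr_ge0// => i _.
    by rewrite -expr2 sqr_ge0.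
  rewrite -sqrtr1 ler_sqrt//.
  apply: (@le_trans _ _ (\sum_(i < n.+1) a)%R).
    apply: ler_sum => i _; rewrite !mxE; have /andP[t0 ta] := h' i.
    have a1 : (a <= 1)%R by rewrite invf_le1 ?ltr0n// ler1n.
    by apply: le_trans ta; rewrite ler_piMr ?(ltW t0)// (le_trans _ a1)//; have /andP[] := h' i.
  by rewrite sumr_const card_ord -mulr_natl mulfV// pnatr_eq0.
rewrite B expe_gt0// lebesgue_measure_itv/= lte_fin a0 oppr0 adde0 lte_fin//.
Qed.

Lemma pball_lty n : lt n (pball n) < +oo.
Proof.
have mI : measurable (`[(-1)%R, 1%R]%classic : set R) by [].
have [mB B] := @lebesgue_tuple_box R n _ mI.
apply: (@le_lt_trans _ _ (lt n [set t | forall i, `[(-1)%R, 1%R]%classic (tnth t i)])).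
  apply: le_measure; rewrite ?inE//; first exact: measurable_pball.
  move=> t /= /andP[_ h] i.
  rewrite in_itv/= -ler_norml -sqrtr_sqr -sqrtr1 ler_sqrt//.
  have h1 : (dot (rowt t) (rowt t) <= 1)%R.
    by rewrite -sqr_enorm expr_le1// enorm_ge0.
  apply: le_trans h1; rewrite /dot (bigD1 i)//= !mxE -expr2 lerDl sumr_ge0// => j _.
  by rewrite -expr2 sqr_ge0.
rewrite B lebesgue_measure_itv/= lte_fin; case: ifP => _; rewrite -?EFinB -EFin_expe ltry//.
Qed.

Lemma mule_fin_inj (a b c : \bar R) :
  c \is a fin_num -> 0 < c -> a * c = b * c -> a = b.
Proof.
move=> cf c0 E; apply/eqP; rewrite eq_le.
by rewrite -(lee_pmul2r cf c0 a b) -(lee_pmul2r cf c0 b a) E lexx.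
Qed.

(** Uniqueness of translation-invariant measures, in the form of a double integral.
    With g the indicator of the punctured ball, two applications of Tonelli and
    of translation invariance turn
      (int f(x A) dx) (int g(y) dy) into (int f(y) dy) (int g(x A) dx);
    g is invariant under A and has a finite positive integral. *)
Lemma lebesgue_tuple_rot n (A : 'M[R]_n.+1) (f : n.+1.-tuple R -> \bar R) :
  A *m A^T = 1%:M -> measurable_fun setT f -> (forall t, 0 <= f t) ->
  \int[lt n.+1]_t f (trow (rowt t *m A)) = \int[lt n.+1]_t f t.
Proof.
move=> oA mf f0; set mu := lt n.+1.
have oA' : A^T *m A = 1%:M by exact: mulmx1C.
pose g (t : n.+1.-tuple R) : \bar R := (\1_(pball n.+1) t)%:E.
have mg : measurable_fun setT g.
  by apply/measurable_EFinP; apply: measurable_indic; exact: measurable_pball.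
have g0 t : 0 <= g t by rewrite lee_fin.
have gE : \int[mu]_t g t = mu (pball n.+1).
  by rewrite /g integral_indic// ?setIT//; exact: measurable_pball.
have mlin (B : 'M[R]_n.+1) (c : R) : measurable_fun setT
    (fun p : n.+1.-tuple R * n.+1.-tuple R => trow (rowt p.1 *m B + c *: rowt p.2)%R).
  apply: measurable_trow => i.
  rewrite (_ : (fun _ => _) = (fun p : n.+1.-tuple R * n.+1.-tuple R =>
    \sum_j tnth p.1 j * B j i + c * tnth p.2 i)%R); last first.
    apply/funext => p; rewrite !mxE; congr (_ + _)%R.
    by apply: eq_bigr => j _; rewrite mxE.
  apply: measurable_funD.
    apply: measurable_sum => j; apply: measurable_funM => //.
    by apply: (measurableT_comp (@measurable_tnth _ (measurableTypeR R) n.+1 j) measurable_fst).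
  apply: measurable_funM => //.
  by apply: (measurableT_comp (@measurable_tnth _ (measurableTypeR R) n.+1 i) measurable_snd).
pose F t := f (trow (rowt t *m A)).
have mA : measurable_fun setT (fun t : n.+1.-tuple R => trow (rowt t *m A)).
  apply: measurable_trow => i.
  rewrite (_ : (fun _ => _) = (fun t : n.+1.-tuple R => \sum_j tnth t j * A j i)%R); last first.
    by apply/funext => p; rewrite !mxE; apply: eq_bigr => j _; rewrite mxE.
  apply: measurable_sum => j; apply: measurable_funM => //; exact: measurable_tnth.
have mF : measurable_fun setT F by exact: measurableT_comp.
have F0 t : 0 <= F t by exact: f0.
have mshift (h : n.+1.-tuple R -> \bar R) (v : 'rV[R]_n.+1) : measurable_fun setT h ->
    measurable_fun setT (fun t => h (trow (rowt t + v))).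
  move=> mh; apply: (measurableT_comp mh); apply: measurable_trow => i.
  rewrite (_ : (fun _ => _) = (fun t : n.+1.-tuple R => tnth t i + v 0 i)%R); last first.
    by apply/funext => p; rewrite !mxE.
  by apply: measurable_funD => //; exact: measurable_tnth.
pose G (p : n.+1.-tuple R * n.+1.-tuple R) :=
  f (trow (rowt p.1 *m A + 1 *: rowt p.2)%R) * g p.2.
have mG : measurable_fun setT G.
  apply: emeasurable_funM; first exact: (measurableT_comp mf (mlin A 1%R)).
  exact: (measurableT_comp mg measurable_snd).
have G0 p : 0 <= G p by exact: mule_ge0.
pose H (p : n.+1.-tuple R * n.+1.-tuple R) :=
  f p.2 * g (trow (rowt p.1 *m (- A) + 1 *: rowt p.2)%R).
have mH : measurable_fun setT H.
  apply: emeasurable_funM; first exact: (measurableT_comp mf measurable_snd).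
  exact: (measurableT_comp mg (mlin (- A)%R 1%R)).
have H0 p : 0 <= H p by exact: mule_ge0.
have E1 : (\int[mu]_t F t) * (\int[mu]_t g t) = \int[mu]_y \int[mu]_x G (x, y).
  rewrite -ge0_integralZl//; last by apply: integral_ge0 => t _; exact: F0.
  apply: eq_integral => y _.
  rewrite -(@lebesgue_tuple_shift _ _ (rowt y *m A^T)%R F mF F0).
  rewrite -ge0_integralZr//; last exact: (mshift F _ mF).
  apply: eq_integral => x _; rewrite /G /F /= rowtK scale1r.
  by rewrite mulmxDl -(mulmxA (rowt y)) oA' mulmx1.
have E2 : \int[mu]_y \int[mu]_x G (x, y) = \int[mu]_x \int[mu]_y G (x, y).
  by symmetry; exact: (@fubini_tonelli _ _ _ _ _ mu mu G mG G0).
have E3 : \int[mu]_x \int[mu]_y G (x, y) = \int[mu]_x \int[mu]_y H (x, y).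
  apply: eq_integral => x _.
  rewrite -[RHS](@lebesgue_tuple_shift _ _ (rowt x *m A)%R (fun y => H (x, y))); last 2 first.
  - exact: measurableT_comp.
  - by move=> y; exact: H0.
  apply: eq_integral => y _; rewrite /G /H /= !rowtK !scale1r mulmxN [(rowt y + _)%R]addrC.
  by rewrite addKr trowK.
have E4 : \int[mu]_x \int[mu]_y H (x, y) = \int[mu]_y \int[mu]_x H (x, y).
  exact: (@fubini_tonelli _ _ _ _ _ mu mu H mH H0).
have E5 : \int[mu]_y \int[mu]_x H (x, y) = (\int[mu]_t f t) * (\int[mu]_t g t).
  have gI0 : 0 <= \int[mu]_t g t by apply: integral_ge0 => t _; exact: g0.
  rewrite -(@ge0_integralZr _ _ _ mu _ measurableT _ mf _ (fun t _ => f0 t) gI0).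
  apply: eq_integral => y _.
  pose K x := g (trow (rowt x *m (- A) + 1 *: rowt y)%R).
  have mK : measurable_fun setT K.
    exact: (measurableT_comp (measurableT_comp mg (mlin (- A)%R 1%R)) (pair2_measurable y)).
  have K0 x : 0 <= K x by exact: g0.
  rewrite (@ge0_integralZl _ _ _ mu _ measurableT K mK _ (fun t _ => K0 t) (f0 y)).
  congr (_ * _); rewrite -(@lebesgue_tuple_shift _ _ (rowt y *m A^T)%R K mK K0).
  apply: eq_integral => x _; rewrite /K /g !rowtK scale1r mulmxDl !mulmxN.
  rewrite -(mulmxA (rowt y)) oA' mulmx1 subrK.
  congr (_%:E); rewrite !indicE; congr ((_ : bool)%:R)%R.
  by apply/idP/idP; rewrite !inE /pball /= rowtK enormN enorm_orthogonal.
have b0 : 0 < \int[mu]_t g t by rewrite gE; exact: pball_gt0.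
have bfin : \int[mu]_t g t \is a fin_num.
  rewrite gE; have h := @pball_lty n.+1; have h0 := ltW (@pball_gt0 n).
  by rewrite (ge0_fin_numE h0).
have E : (\int[mu]_t F t) * (\int[mu]_t g t) = (\int[mu]_t f t) * (\int[mu]_t g t).
  by rewrite E1 E2 E3 E4 E5.
exact: (mule_fin_inj bfin b0 E).
Qed.

End rotation.
Arguments pball {R} n _.

(** * Zonal functions on the sphere *)
Section sphere_integral.
Context {R : realType}.
Local Open Scope ereal_scope.
Local Notation leb := (@lebesgue_measure R).
Local Notation lt n := (@lebesgue_tuple R n).

Lemma measurable_sphere n : measurable (@sphere R n).
Proof.
have -> : @sphere R n = (enorm \o rowt) @^-1` [set 1%R] by [].
by rewrite -[X in measurable X]setTI; exact: measurable_enorm.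
Qed.

Lemma sphere_normalize n (t : n.-tuple R) : pball n t -> sphere (normalize t).
Proof.
move=> /andP[t0 _]; rewrite /sphere /= /normalize rowtK enormZ ger0_norm.
  by rewrite mulVf// gt_eqF.
by rewrite invr_ge0 ltW.
Qed.

(** The map that collapses the complement of the punctured ball to 0 pushes Lebesgue
    measure forward to the spherical measure, on subsets of the sphere, because 0 is
    not on the sphere. *)
Lemma integral_sphere n (f : n.-tuple R -> \bar R) :
  measurable_fun setT f -> (forall t, 0 <= f t) ->
  \int[@sphere_measure R n]_(u in @sphere R n) f u =
  n%:R%:E * \int[lt n]_(t in pball n) f (normalize t).
Proof.
move=> mf f0; pose phi (t : n.-tuple R) := trow (\1_(pball n) t *: rowt (normalize t))%R.
have phiE t : pball n t -> phi t = normalize t.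
  by move=> h; rewrite /phi indicE mem_set// scale1r trowK.
have phi0 t : ~ pball n t -> ~ sphere (phi t).
  move=> h; rewrite /sphere /= /phi indicE memNset// scale0r rowtK.
  by rewrite /enorm dot0l sqrtr0 => /esym/eqP; rewrite oner_eq0.
have mphi : measurable_fun setT phi.
  apply: measurable_trow => i.
  rewrite (_ : (fun _ => _) = (fun t => \1_(pball n) t * tnth (normalize t) i)%R); last first.
    by apply/funext => t; rewrite !mxE.
  apply: measurable_funM; first by apply: measurable_indic; exact: measurable_pball.
  exact: (measurableT_comp (@measurable_tnth _ (measurableTypeR R) n i) (@measurable_normalize R n)).
pose nu : {measure set (n.-tuple R) -> \bar R} :=
  measure_function_pushforward__canonical__measure_function_Measure (lt n) mphi.
pose k : {nonneg R} := NngNum (ler0n R n).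
rewrite (@eq_measure_integral _ _ _ _ (mscale k nu)) => [|A mA AS]; last first.
  rewrite /mscale /= /sphere_measure; congr (_ * lt n _).
  apply/seteqP; split => t /=; first by move=> [h1 h2]; rewrite phiE.
  move=> h; have pt : pball n t by apply: contrapT => /phi0; apply; exact: AS.
  by split; [exact: pt|change (A (normalize t)); rewrite -(phiE _ pt)].
rewrite (@ge0_integral_mscale _ _ _ _ _ (@measurable_sphere n))//; last exact: measurable_funTS.
congr (_ * _).
have := @ge0_integral_pushforward _ _ _ _ R phi mphi (lt n) (@sphere R n) f (@measurable_sphere n).
move=> -> //; last exact: measurable_funTS.
have -> : phi @^-1` (@sphere R n) = pball n.
  apply/seteqP; split => t /=; first by move=> h; apply: contrapT => /phi0.
  by move=> h; rewrite phiE//; exact: sphere_normalize.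
by apply: eq_integral => t; rewrite inE /= => h; rewrite phiE.
Qed.

Lemma integral_indicM d (T : measurableType d) (mu : {measure set T -> \bar R})
    (D : set T) (g : T -> R) :
  \int[mu]_(x in D) (g x)%:E = \int[mu]_x (\1_D x * g x)%:E.
Proof.
rewrite integral_mkcond; apply: eq_integral => x _.
by rewrite patchE indicE; case: ifP => _; rewrite ?mul1r// mul0r.
Qed.

Lemma exists_rotation n (e u : 'rV[R]_n) : enorm e = 1%R -> enorm u = 1%R ->
  exists2 A : 'M[R]_n, A *m A^T = 1%:M & e *m A = u.
Proof.
move=> he hu; exists (reflection (e - u)); first exact: reflection_orthogonal.
by apply: reflection_swap; rewrite -!sqr_enorm he hu.
Qed.

Lemma measurable_dot n (e : 'rV[R]_n) : measurable_fun setT (fun t => dot e (rowt t)).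
Proof.
rewrite (_ : (fun _ => _) = (fun t : n.-tuple R => \sum_i e 0 i * tnth t i)%R); last first.
  by apply/funext => t; apply: eq_bigr => i _; rewrite mxE.
by apply: measurable_sum => i; apply: measurable_funM => //; exact: measurable_tnth.
Qed.

(** Rotate e to the first basis vector. *)
Lemma integral_sphere_zonal n (e : 'rV[R]_n.+1) (Phi : R -> R) : enorm e = 1%R ->
  continuous Phi -> (forall t, 0 <= Phi t)%R ->
  \int[@sphere_measure R n.+1]_(u in @sphere R n.+1) (Phi (dot e (rowt u)))%:E =
  n.+1%:R%:E * \int[lt n.+1]_t (\1_(pball n.+1) t * Phi (rowt t 0 0 / enorm (rowt t)))%:E.
Proof.
move=> he cPhi Phi0.
have mPhi : measurable_fun setT Phi by exact: continuous_measurable_fun.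
pose e0 : 'rV[R]_n.+1 := delta_mx 0%R 0%R.
have de0 x : dot e0 x = x 0%R 0%R.
  rewrite /dot (bigD1 ord0)//= !mxE eqxx mul1r big1 ?addr0// => i i0.
  by rewrite mxE (negbTE i0) andbF mul0r.
have he0 : enorm e0 = 1%R by rewrite /enorm de0 mxE eqxx sqrtr1.
have [A oA eA] := exists_rotation he he0.
have md (v : 'rV[R]_n.+1) : measurable_fun setT (fun u => (Phi (dot v (rowt u)))%:E).
  by apply/measurable_EFinP; apply: (measurableT_comp mPhi); exact: measurable_dot.
rewrite (integral_sphere (md e)); last by move=> t; rewrite lee_fin.
rewrite (@integral_indicM _ _ (lt n.+1) (pball n.+1) (fun t => Phi (dot e (rowt (normalize t))))).
congr (_ * _).
pose f v t := (\1_(pball n.+1) t * Phi (dot v (rowt (normalize t))))%:E.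
have mf v : measurable_fun setT (f v).
  apply/measurable_EFinP; apply: measurable_funM.
    by apply: measurable_indic; exact: measurable_pball.
  apply: (measurableT_comp mPhi).
  exact: (measurableT_comp (measurable_dot v) (@measurable_normalize R n.+1)).
rewrite -[LHS](@lebesgue_tuple_rot R n A^T (f e))//; last 2 first.
- by rewrite trmxK; exact: mulmx1C.
- by move=> t; rewrite lee_fin mulr_ge0// indicE ler0n.
apply: eq_integral => t _; congr (_ * Phi _)%:E.
  rewrite !indicE; congr ((_ : bool)%:R)%R.
  apply/idP/idP; rewrite !inE /pball /= rowtK enorm_orthogonal// trmxK; exact: mulmx1C.
have oA' : A^T *m A^T^T = 1%:M by rewrite trmxK; exact: mulmx1C.
rewrite /normalize !rowtK enorm_orthogonal// dotZr.
by rewrite -de0 -eA -[dot (e *m A) _](dot_orthogonal _ _ oA') -mulmxA oA mulmx1 mulrC.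
Qed.

End sphere_integral.

Section slice.
Context {R : realType}.
Implicit Types (r s x : R) (Phi : R -> R).
Local Notation leb := (@lebesgue_measure R).
Local Notation hpi := (pi / 2 : R).

Lemma integral_RI (a b : R) (f : R -> R) : continuous f ->
  (\int[leb]_(x in `[a, b]) (f x)%:E = (RI a b f)%:E)%E.
Proof.
move=> cf; rewrite /RI /Rintegral fineK//; apply: integrable_fin_num => //.
exact: integrable_segment.
Qed.

Lemma cont_inv (f : R -> R) : continuous f -> (forall x, f x != 0) ->
  continuous (fun x => (f x)^-1).
Proof. by move=> cf f0 x; apply: (@continuousV _ _ f x (f0 x)); exact: cf. Qed.

Lemma le_cosE r s : 0 < r <= 1 -> - hpi <= s <= hpi ->
  (r <= cos s) = (- acos r <= s <= acos r).
Proof.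
move=> /andP[r0 r1] hs; have hp := @hpi_lt_pi R; have hp0 := @hpi_gt0 R.
have rB : -1 <= r <= 1 by rewrite r1 (le_trans _ (ltW r0))// oppr_le0.
have a0 := acos_ge0 rB; have ap := acos_lepi rB.
have ca : cos (acos r) = r by apply: acosK; rewrite in_itv/=.
have cs : cos s = cos `|s| by case: (ler0P s); rewrite ?cosN.
rewrite -ler_norml in hs; rewrite -ler_norml cs -{1}ca !leNgt ltr_cos//.
all: by rewrite in_itv/= ?a0 ?normr_ge0 ?(le_trans hs (ltW hp)).
Qed.

(** On the line at distance r from the axis, x = r tan s: then x / sqrt(x^2 + r^2) = sin s,
    dx = r / cos^2 s ds, and sqrt(x^2 + r^2) <= 1 becomes r <= cos s. *)
Lemma slice_change_var r Phi : 0 < r -> continuous Phi ->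
  (\int[leb]_x (\1_[set x | 0 < Num.sqrt (x ^+ 2 + r ^+ 2) <= 1]%R x
      * Phi (x / Num.sqrt (x ^+ 2 + r ^+ 2)))%:E =
   \int[leb]_s (\1_`[(- hpi)%R, hpi]%classic s
      * (\1_[set s | r <= cos s]%R s * (Phi (sin s) * (r / cos s ^+ 2))))%:E)%E.
Proof.
move=> r0 cPhi; pose D x := Num.sqrt (x ^+ 2 + r ^+ 2).
have D0 x : 0 < D x by rewrite sqrtr_gt0 ltr_wpDl ?sqr_ge0// exprn_gt0.
have D1 x : (D x <= 1) = (x ^+ 2 + r ^+ 2 <= 1).
  by rewrite /D -[X in _ <= X]sqrtr1 ler_sqrt.
have [r1|r1] := ltP 1 r.
  transitivity (0%:E : \bar R); [|symmetry]; apply: integral0_eq => x _.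
    rewrite indicE memNset ?mul0r//= => /andP[_]; rewrite D1 => h.
    have := sqr_ge0 x; nra.
  rewrite [X in (_ * (X * _))%R]indicE memNset ?mul0r ?mulr0//= => h.
  by have := le_lt_trans (le_trans h (cos_le1 x)) r1; rewrite ltxx.
pose th := acos r; have hp := @hpi_lt_pi R; have hp0 := @hpi_gt0 R.
have rB : -1 <= r <= 1 by rewrite r1 (le_trans _ (ltW r0))// oppr_le0.
have th0 : 0 <= th by exact: acos_ge0.
have cth : cos th = r by apply: acosK; rewrite in_itv/=.
have thh : th <= hpi.
  rewrite leNgt; apply/negP => h.
  have : cos th < cos hpi.
    by rewrite ltr_cos// in_itv/= ?th0 ?acos_lepi// (ltW hp0) ltW.
  by rewrite cos_pihalf cth ltNge (ltW r0).
pose b := Num.sqrt (1 - r ^+ 2); have b0 : 0 <= b by exact: sqrtr_ge0.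
have r21 : r ^+ 2 <= 1 by rewrite expr_le1// ltW.
have b2 : b ^+ 2 = 1 - r ^+ 2 by rewrite sqr_sqrtr// subr_ge0.
have sth : sin th = b by exact: sin_acos.
pose I x := (D x)^-1.
have cD : continuous D.
  move=> x; apply: (@cont_at_comp _ Num.sqrt (fun x => x ^+ 2 + r ^+ 2)).
    exact: sqrt_continuous.
  by cont1.
have cI : continuous I by apply: cont_inv => // x; rewrite gt_eqF.
pose psi x := Phi (x * I x).
have cpsi : continuous psi by rewrite /psi; cont.
(* E = max (cos^2, r^2) agrees with cos^2 on the range of integration and is positive everywhere, so that chi is continuous on the line. *)
pose E s := (cos s ^+ 2 + r ^+ 2 + `|cos s ^+ 2 - r ^+ 2|) / 2.
have E0 s : E s != 0.
  rewrite gt_eqF// divr_gt0// ltr_pwDl ?normr_ge0//.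
  by rewrite ltr_wpDl ?sqr_ge0// exprn_gt0.
have cE : continuous E by rewrite /E; cont.
pose J s := (E s)^-1.
have cJ : continuous J by exact: cont_inv.
pose chi s := Phi (sin s) * (r * J s).
have cchi : continuous chi by rewrite /chi; cont.
have chiE s : r <= cos s -> chi s = Phi (sin s) * (r / cos s ^+ 2).
  move=> h; rewrite /chi /J /E ger0_norm; last first.
    by rewrite subr_ge0 lerXn2r// nnegrE ?ltW// (lt_le_trans r0).
  by congr (_ * (_ / _)); field.
have [F dF] := primitive_ex (- b - 1) cpsi.
have psiRI : RI (- b) b psi = F b - F (- b).
  have bb : - b <= b by lra.
  by apply: RI_FTC => // x /andP[bx _]; apply: dF; lra.
have chiRI : RI (- th) th chi = F b - F (- b).
  have tt : - th <= th by lra.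
  have tb : r * tan th = b by rewrite /tan sth cth mulrC divfK// gt_eqF.
  rewrite -tb -mulrN -tanN.
  apply: (@RI_FTC _ _ _ _ (fun s => F (r * tan s))) => // s hs.
  have hs' : - hpi <= s <= hpi by move: hs => /andP[? ?]; apply/andP; split; lra.
  have rc : r <= cos s by rewrite le_cosE// r0.
  have c0 : 0 < cos s by exact: lt_le_trans rc.
  have rr : r ^+ 2 + b ^+ 2 = 1 by rewrite b2 addrC subrK.
  have := sin2cos2 s; set S := sin s; set C := cos s in rc c0 * => SC.
  have tE : tan s = S / C by [].
  have DE : D (r * tan s) = r / C.
    rewrite /D tE; have -> : (r * (S / C)) ^+ 2 + r ^+ 2 = (r / C) ^+ 2.
      by rewrite !exprMn exprVn SC; field; rewrite gt_eqF.
    by rewrite sqrtr_sqr ger0_norm// (divr_ge0 (ltW r0) (ltW c0)).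
  have bD : D (r * tan s) <= 1 by rewrite DE ler_pdivrMr// mul1r.
  have lb : - b - 1 < r * tan s.
    have : `|r * tan s| <= b.
      rewrite -sqrtr_sqr ler_sqrt; last by rewrite subr_ge0.
      by move: bD; rewrite D1 => h; rewrite lerBrDr.
    by rewrite ler_norml => /andP[h _]; apply: lt_le_trans h; lra.
  have cn : cos s != 0 by rewrite gt_eqF.
  have d1 := der_M (der_cst r s) (is_derive_tan cn).
  have := @der_comp _ F (fun y => r * tan y) s _ _ (dF _ lb) d1.
  congr is_derive; rewrite (chiE _ rc) /psi /I DE tE -/S -/C mulr0 addr0 mulrC.
  congr (Phi _ * _).
  by field; rewrite !gt_eqF.
transitivity ((RI (- b) b psi)%:E).
  rewrite -integral_RI// [RHS]integral_indicM; apply: eq_integral => x _.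
  congr (_ * _)%:E; rewrite !indicE; congr ((_ : bool)%:R).
  apply/idP/idP; rewrite !inE/= in_itv/= -ler_norml -sqrtr_sqr D0 D1.
    by move=> h; rewrite /b ler_sqrt ?subr_ge0// lerBrDr.
  by rewrite /b ler_sqrt ?subr_ge0// lerBrDr.
rewrite psiRI -chiRI -integral_RI// [LHS]integral_indicM; apply: eq_integral => s _.
congr (_%:E); rewrite !indicE.
have [hs|hs] := boolP (s \in `[(- hpi)%R, hpi]%classic); last first.
  rewrite mul0r memNset ?mul0r//= in_itv/= => /andP[h1 h2].
  move: hs; rewrite notin_setE/= in_itv/=; apply; apply/andP; split; lra.
rewrite mul1r; move: hs; rewrite inE/= in_itv/= => hs.
have [rc|rc] := boolP (r <= cos s).
  rewrite mem_set; last by rewrite /= in_itv/= -le_cosE// r0.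
  by rewrite mem_set// !mul1r chiE.
rewrite memNset; last by rewrite /= in_itv/= -le_cosE ?r0//; exact/negP.
by rewrite memNset ?mul0r//=; exact/negP.
Qed.

End slice.

Section slicing.
Context {R : realType}.
Local Open Scope ereal_scope.
Local Notation leb := (@lebesgue_measure R).
Local Notation lt n := (@lebesgue_tuple R n).
Local Notation hpi := (pi / 2 : R)%R.

Lemma integralZ_EFin d (T : measurableType d) (mu : {measure set T -> \bar R}) (c : R)
    (g : T -> R) : measurable_fun setT g -> (forall x, 0 <= g x)%R -> (0 <= c)%R ->
  \int[mu]_x (c * g x)%:E = c%:E * \int[mu]_x (g x)%:E.
Proof.
move=> mg g0 c0; rewrite -ge0_integralZl//; first exact/measurable_EFinP.
by move=> x _; rewrite lee_fin.
Qed.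

Lemma eq_indic (T T' : Type) (D : set T) (D' : set T') x y :
  (D x <-> D' y) -> \1_D x = \1_D' y :> R.
Proof.
by move=> [h h']; rewrite !indicE; congr (nat_of_bool _)%:R%R; apply/idP/idP; rewrite !inE.
Qed.

Definition radial n (c : R) (y : n.-tuple R) : R :=
  (\1_[set y | enorm (rowt y) <= c]%R y * enorm (rowt y))%R.

Definition radial_moment n (c : R) : \bar R := \int[lt n]_y (radial c y)%:E.

Lemma radial_ge0 n c (y : n.-tuple R) : (0 <= radial c y)%R.
Proof. by rewrite mulr_ge0 ?enorm_ge0// indicE ler0n. Qed.

Lemma measurable_enorm_le n (c : R) :
  measurable [set y : n.-tuple R | enorm (rowt y) <= c]%R.
Proof.
rewrite (_ : [set _ | _] = (enorm \o rowt) @^-1` `]-oo, c]).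
  by rewrite -[X in measurable X]setTI; exact: measurable_enorm.
by apply/seteqP; split => y /=; rewrite in_itv.
Qed.

Lemma measurable_radial n c : measurable_fun setT (@radial n c).
Proof.
apply: measurable_funM; first by apply: measurable_indic; exact: measurable_enorm_le.
exact: measurable_enorm.
Qed.

Lemma radial_moment_ge0 n c : 0 <= radial_moment n c.
Proof. by apply: integral_ge0 => y _; rewrite lee_fin radial_ge0. Qed.

(** Homogeneity of degree n + 1. *)
Lemma radial_moment_scale n c : (0 <= c)%R ->
  radial_moment n c = (c ^+ n.+1)%:E * radial_moment n 1.
Proof.
rewrite le_eqVlt => /predU1P[<-|c0].
  rewrite expr0n mul0e /radial_moment; apply: integral0_eq => y _.
  rewrite /radial indicE; case: (boolP (y \in _)); last by rewrite mul0r.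
  rewrite inE/= => h; have /le_anti -> : (enorm (rowt y) <= 0 <= enorm (rowt y))%R.
    by rewrite h enorm_ge0.
  by rewrite mulr0.
have mr a : measurable_fun setT (fun y : n.-tuple R => (radial a y)%:E).
  by apply/measurable_EFinP; exact: measurable_radial.
rewrite /radial_moment -(@lebesgue_tuple_affine _ n c 0%R (fun y => (radial c y)%:E) c0); last 2 first.
- exact: mr.
- by move=> y; rewrite lee_fin radial_ge0.
rewrite exprSr EFinM -muleA; congr (_ * _).
rewrite -(@integralZ_EFin _ _ (lt n) c (radial 1) (@measurable_radial n 1%R) (@radial_ge0 n 1%R) (ltW c0)).
apply: eq_integral => y _; congr (_%:E).
rewrite /radial addr0 rowtK enormZ gtr0_norm// mulrCA; congr (_ * _)%R.
by congr (_ * _)%R; apply: eq_indic; rewrite /= rowtK enormZ gtr0_norm// ger_pMr.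
Qed.

(** The integrand after the change of variable on each slice, as a function of the
    angle s = p.1 and of the transverse coordinate p.2. *)
Definition slice_kernel (Phi : R -> R) n (p : R * n.-tuple R) : R :=
  (\1_`[(- hpi)%R, hpi]%classic p.1 *
   (\1_[set s | enorm (rowt p.2) <= cos s]%R p.1 *
    (Phi (sin p.1) * (enorm (rowt p.2) / cos p.1 ^+ 2))))%R.

Lemma measurable_slice_kernel (Phi : R -> R) n : continuous Phi ->
  measurable_fun setT (slice_kernel Phi (n := n)).
Proof.
move=> cPhi; have mc (f : R -> R) : continuous f ->
    measurable_fun setT (fun p : measurableTypeR R * n.-tuple R => f p.1).
  by move=> cf; apply: (measurableT_comp (continuous_measurable_fun cf) measurable_fst).
have me : measurable_fun setT (fun p : measurableTypeR R * n.-tuple R => enorm (rowt p.2)).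
  exact: (measurableT_comp (@measurable_enorm R n) measurable_snd).
have mi : measurable_fun setT
    (fun p : measurableTypeR R * n.-tuple R => (\1_`[(- hpi)%R, hpi]%classic p.1 : R)).
  by apply: (measurableT_comp _ measurable_fst); exact: measurable_indic.
apply: measurable_funM; first exact: mi.
apply: measurable_funM.
  pose S := [set p : measurableTypeR R * n.-tuple R | enorm (rowt p.2) <= cos p.1]%R.
  rewrite (_ : (fun _ => _) = \1_S); last first.
    by apply/funext => p; exact: eq_indic.
  apply: measurable_indic.
  rewrite (_ : S = (fun p => (cos p.1 - enorm (rowt p.2))%R) @^-1` `[0%R, +oo[).
    rewrite -[X in measurable X]setTI.
    have : measurable_fun setT (fun p : measurableTypeR R * n.-tuple R => (cos p.1 - enorm (rowt p.2))%R).
      by apply: measurable_funB => //; apply: mc; exact: continuous_cos.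
    by apply.
  by apply/seteqP; split => p /=; rewrite /S /= in_itv/= andbT subr_ge0.
apply: measurable_funM.
  by apply: (mc (fun s => Phi (sin s))); cont.
apply: measurable_funM => //.
rewrite (_ : (fun _ => _) = (fun p : measurableTypeR R * n.-tuple R => (cos p.1 ^+ 2) `^ (-1))%R); last first.
  by apply/funext => p; rewrite powR_inv1// sqr_ge0.
apply: (measurableT_comp (measurable_powR (-1)%R)).
by apply: (mc (fun s => cos s ^+ 2)%R); cont.
Qed.

Lemma slice_kernel_ge0 (Phi : R -> R) n p : (forall t, 0 <= Phi t)%R -> (0 <= slice_kernel Phi (n := n) p)%R.
Proof.
move=> h; apply: mulr_ge0; first by rewrite indicE ler0n.
apply: mulr_ge0; first by rewrite indicE ler0n.
by apply: mulr_ge0 => //; apply: divr_ge0; [exact: enorm_ge0|exact: sqr_ge0].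
Qed.

Lemma enorm_tcons n (x : R) (y : n.-tuple R) :
  enorm (rowt (tcons (x, y))) = Num.sqrt (x ^+ 2 + enorm (rowt y) ^+ 2).
Proof.
rewrite sqr_enorm /enorm /dot big_ord_recl !rowt_tcons unlift_none -expr2.
congr (Num.sqrt (_ + _))%R; apply: eq_bigr => i _.
by rewrite rowt_tcons liftK.
Qed.

(** Slice parallel to the axis, change variable on each slice, exchange the order of
    integration: the transverse integral over |y| <= cos s scales like cos^{k+3} s.
    The slice through the origin is exceptional, but negligible. *)
Lemma integral_pball_zonal k (Phi : R -> R) : continuous Phi -> (forall t, 0 <= Phi t)%R ->
  \int[lt k.+3]_t (\1_(pball k.+3) t * Phi (rowt t 0 0 / enorm (rowt t)))%:E =
  radial_moment k.+2 1 * (RI (- hpi) hpi (fun s => Phi (sin s) * cos s ^+ k.+1)%R)%:E.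
Proof.
move=> cPhi Phi0.
have mPhi : measurable_fun setT Phi by exact: continuous_measurable_fun.
pose f (t : k.+3.-tuple R) : \bar R := (\1_(pball k.+3) t * Phi (rowt t 0 0 / enorm (rowt t)))%:E.
have f0 t : 0 <= f t by rewrite lee_fin mulr_ge0// indicE ler0n.
have mf : measurable_fun setT f.
  apply/measurable_EFinP; apply: measurable_funM.
    by apply: measurable_indic; exact: measurable_pball.
  apply: (measurableT_comp mPhi).
  rewrite (_ : (fun _ => _) = (fun t : k.+3.-tuple R => tnth (normalize t) ord0)).
    exact: (measurableT_comp (@measurable_tnth _ (measurableTypeR R) k.+3 ord0) (@measurable_normalize R k.+3)).
  by apply/funext => t; rewrite /normalize tnth_mktuple !mxE mulrC.
have mK : measurable_fun setT (fun p => (slice_kernel Phi (n := k.+2) p)%:E).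
  by apply/measurable_EFinP; exact: measurable_slice_kernel.
have K0 p : 0 <= (slice_kernel Phi (n := k.+2) p)%:E by rewrite lee_fin slice_kernel_ge0.
transitivity (\int[lt k.+2]_y \int[leb]_s (slice_kernel Phi (s, y))%:E).
  rewrite (integral_tcons mf f0); apply: ge0_ae_eq_integral => //.
  - apply: (@measurable_fun_fubini_tonelli_G _ _ _ _ _ leb (fun p => f (tcons p))) => //.
    by apply: (measurableT_comp mf); exact: measurable_tcons.
  - exact: (@measurable_fun_fubini_tonelli_G _ _ _ _ _ leb _ mK).
  - by move=> y _; apply: integral_ge0.
  - by move=> y _; apply: integral_ge0.
  have mI : measurable ([set 0%R] : set R) by [].
  have [mB B] := @lebesgue_tuple_box R k.+2 _ mI.
  exists [set t : k.+2.-tuple R | forall i, [set 0%R] (tnth t i)]; split => //.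
    by apply: (etrans B); rewrite lebesgue_measure_set1 expeS mul0e.
  move=> y /= h i; apply: contrapT => yi; apply: h => _.
  have r0 : (0 < enorm (rowt y))%R.
    rewrite lt_neqAle enorm_ge0 andbT eq_sym enorm_eq0; apply/eqP => y0; apply: yi.
    by have := congr1 (fun v : 'rV[R]_k.+2 => v ord0 i) y0; rewrite !mxE.
  rewrite -(slice_change_var r0 cPhi); apply: eq_integral => x _.
  rewrite /f enorm_tcons rowt_tcons unlift_none; congr (_ * _)%:E.
  by apply: eq_indic; rewrite /pball /= enorm_tcons.
transitivity (\int[leb]_s \int[lt k.+2]_y (slice_kernel Phi (s, y))%:E).
  symmetry; exact: (@fubini_tonelli _ _ _ _ _ leb (lt k.+2) _ mK K0).
have cg : continuous (fun s => Phi (sin s) * cos s ^+ k.+1)%R by cont.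
rewrite -integral_RI// [X in _ * X]integral_indicM.
have mg : measurable_fun setT (fun s : R =>
    (\1_`[(- hpi)%R, hpi]%classic s * (Phi (sin s) * cos s ^+ k.+1))%:E).
  apply/measurable_EFinP; apply: measurable_funM; first exact: measurable_indic.
  exact: continuous_measurable_fun.
have g0 s : 0 <= (\1_`[(- hpi)%R, hpi]%classic s * (Phi (sin s) * cos s ^+ k.+1))%:E.
  rewrite lee_fin indicE; have [|_] := boolP (s \in _); last by rewrite mul0r.
  by rewrite inE/= in_itv/= => hs; rewrite mul1r mulr_ge0// exprn_ge0// cos_ge0_pihalf.
rewrite -(@ge0_integralZl _ _ _ leb _ measurableT _ mg _ (fun s _ => g0 s) (radial_moment_ge0 k.+2 1%R)).
apply: eq_integral => s _.
have [hs|hs] := boolP (s \in `[(- hpi)%R, hpi]%classic); last first.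
  rewrite [X in (X * _)%R]indicE (negbTE hs) mul0r mule0; apply: integral0_eq => y _.
  by rewrite /slice_kernel [X in (X * _)%R]indicE (negbTE hs) mul0r.
rewrite [X in (X * _)%R]indicE hs mul1r.
have c0 : (0 <= cos s)%R by apply: cos_ge0_pihalf; move: hs; rewrite inE/= in_itv.
transitivity ((Phi (sin s) / cos s ^+ 2)%:E * radial_moment k.+2 (cos s)).
  have p0 : (0 <= Phi (sin s) / cos s ^+ 2)%R by rewrite divr_ge0// sqr_ge0.
  rewrite /radial_moment -(@integralZ_EFin _ _ (lt k.+2) _ (radial (cos s))
    (@measurable_radial k.+2 (cos s)) (@radial_ge0 k.+2 (cos s)) p0).
  apply: eq_integral => y _.
  apply: (f_equal EFin).
  rewrite /slice_kernel /radial /= [X in (X * _)%R]indicE hs mul1r.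
  have -> : \1_[set s0 | enorm (rowt y) <= cos s0]%R s =
      \1_[set y0 | enorm (rowt y0) <= cos s]%R y :> R.
    exact: eq_indic.
  by ring.
rewrite radial_moment_scale// muleA -EFinM muleC; congr (_ * _%:E).
rewrite -mulrA; congr (_ * _)%R.
have [->|cn] := eqVneq (cos s) 0%R; first by rewrite !expr0n mulr0.
by rewrite !exprS; field.
Qed.

End slicing.

Section sphere_zonal.
Context {R : realType}.
Local Notation lt n := (@lebesgue_tuple R n).
Local Notation hpi := (pi / 2 : R)%R.

Lemma RI_cosX_gt0 k : 0 < RI (- hpi) hpi (fun s => cos s ^+ k).
Proof.
have hp := @hpi_gt0 R.
have cc : continuous (fun s : R => cos s ^+ k) by cont.
have h : - hpi < hpi by lra.
apply: (@RI_gt0 _ _ _ _ 0 h cc).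
- by move=> s hs; rewrite exprn_ge0// cos_ge0_pihalf.
- by apply/andP; split; lra.
- by rewrite cos0 expr1n.
Qed.

(** Evaluate the slicing formula at the constant 1: the left side is the volume of
    the ball, which is finite and positive. *)
Lemma radial_moment_fin k : exists2 c, 0 < c & radial_moment k.+2 1 = (c%:E : \bar R).
Proof.
have c1 : continuous (fun _ : R => 1 : R) by exact: cst_continuous.
have W0 := RI_cosX_gt0 k.+1.
set W := RI _ _ _ in W0.
have E : lt k.+3 (pball k.+3) = (radial_moment k.+2 1 * W%:E)%E.
  have -> : W = RI (- hpi) hpi (fun s => 1 * cos s ^+ k.+1).
    by apply: eq_RI => s _; rewrite mul1r.
  rewrite -(@integral_pball_zonal R k (fun=> 1) c1 (fun=> ler01)).
  rewrite -(@integral_indicM _ _ _ (lt k.+3) (pball k.+3) (fun=> 1)).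
  by rewrite integral_cst ?mul1e//; exact: measurable_pball.
have V0 := @pball_gt0 R k.+2; have V1 := @pball_lty R k.+3.
rewrite E in V0 V1.
have := radial_moment_ge0 k.+2 (1 : R); case: (radial_moment k.+2 1) V0 V1 => [c| |]// V0 V1.
  rewrite lee_fin le_eqVlt => /predU1P[c0|c0]; last by exists c.
  by move: V0; rewrite -c0 mul0e ltxx.
by move: V1; rewrite gt0_mulye ?lte_fin// ltxx.
Qed.

Lemma sphere_zonal k : exists2 C : R, 0 < C &
  forall (e : 'rV[R]_k.+3) (Phi : R -> R), enorm e = 1 -> continuous Phi ->
  \int[@sphere_measure R k.+3]_(u in @sphere R k.+3) Phi (dot e (rowt u)) =
  C * RI (- hpi) hpi (fun s => Phi (sin s) * cos s ^+ k.+1).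
Proof.
have [c c0 cE] := radial_moment_fin k.
exists (k.+3%:R * c) => [|e Phi he cPhi]; first by rewrite mulr_gt0.
have pos (Psi : R -> R) : continuous Psi -> (forall t, 0 <= Psi t) ->
  (\int[@sphere_measure R k.+3]_(u in @sphere R k.+3) (Psi (dot e (rowt u)))%:E =
    (k.+3%:R * c * RI (- hpi) hpi (fun s => Psi (sin s) * cos s ^+ k.+1))%:E)%E.
  move=> cPsi Psi0; rewrite integral_sphere_zonal// integral_pball_zonal// cE.
  by rewrite -!EFinM mulrA.
pose P t := (`|Phi t| + Phi t) / 2; pose N t := (`|Phi t| - Phi t) / 2.
have cP : continuous P by rewrite /P; cont.
have cN : continuous N by rewrite /N; cont.
have P0 t : 0 <= P t.
  by have := ler_norm (- Phi t); rewrite normrN /P => h; rewrite divr_ge0//; lra.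
have N0 t : 0 <= N t by have := ler_norm (Phi t); rewrite /N => h; rewrite divr_ge0//; lra.
rewrite /Rintegral integralE.
rewrite (eq_integral (fun u => (P (dot e (rowt u)))%:E)); last first.
  move=> u _; rewrite funeposE /P -EFin_max; congr (_%:E).
  by set a := Phi _; case: (lerP 0 a) => h; [rewrite ger0_norm//|rewrite ltr0_norm//]; lra.
rewrite [X in (_ - X)%E](eq_integral (fun u => (N (dot e (rowt u)))%:E)); last first.
  move=> u _; rewrite funenegE /N -EFin_max; congr (_%:E).
  by set a := Phi _; case: (lerP 0 (- a)) => h; [rewrite ler0_norm ?oppr_ge0//|rewrite gtr0_norm ?oppr_lt0//]; lra.
rewrite !pos//= -mulrBr; congr (_ * _).
rewrite -RI_B; [|by cont|by cont].
by apply: eq_RI => s _; rewrite /P /N; field.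
Qed.

End sphere_zonal.

(** * Support functions *)
Section reflection_det.
Context {R : realType} {n : nat}.
Implicit Types (x y z e u w : 'rV[R]_n) (A B : 'M[R]_n).

Lemma det_orthogonal A : A *m A^T = 1%:M -> \det A ^+ 2 = 1.
Proof. by move=> h; have := congr1 determinant h; rewrite det_mulmx det_tr det1. Qed.

Lemma conj_reflection B w : B *m B^T = 1%:M ->
  B^T *m reflection w *m B = reflection (w *m B).
Proof.
move=> oB; rewrite /reflection dot_orthogonal// mulmxBr mulmx1 mulmxBl (mulmx1C oB).
by rewrite -scalemxAr -scalemxAl trmx_mul !mulmxA.
Qed.

(** All reflections are conjugate to each other. *)
Lemma det_reflection w z : w != 0 -> z != 0 -> \det (reflection w) = \det (reflection z).
Proof.
move=> w0 z0; have nz : enorm z != 0 by rewrite enorm_eq0.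
have nw : enorm w != 0 by rewrite enorm_eq0.
set a := enorm w / enorm z; have a0 : a != 0 by rewrite mulf_neq0// invr_neq0.
have E1 : reflection (a *: z) = reflection z.
  apply/row_matrixP => i; rewrite !rowE !mulmx_reflection.
  rewrite !(dotZl, dotZr) scalerA; congr (_ - _ *: _).
  have : dot z z != 0 by rewrite dotxx_eq0.
  by move=> dz; field; rewrite dz a0.
have dE : dot w w = dot (a *: z) (a *: z).
  by rewrite dotZl dotZr -!sqr_enorm /a; field.
have oB := reflection_orthogonal (w - a *: z); have wB := reflection_swap dE.
move: oB wB; set B := reflection (_ - _) => oB wB.
rewrite -E1 -wB -(conj_reflection _ oB) !det_mulmx det_tr mulrAC -expr2.
by rewrite det_orthogonal// mul1r.
Qed.

Lemma exists_orthogonal x y : (2 < n)%N -> exists z, [/\ z != 0, dot z x = 0 & dot z y = 0].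
Proof.
move=> n2; pose M : 'M[R]_(n, 1 + 1) := row_mx x^T y^T.
have kM : kermx M != 0.
  by rewrite -mxrank_eq0 mxrank_ker subn_eq0 -ltnNge (leq_ltn_trans (rank_leq_col M)).
exists (nz_row (kermx M)); have : nz_row (kermx M) *m M = 0.
  by apply/sub_kermxP; exact: nz_row_sub.
move/eqP; rewrite mul_mx_row row_mx_eq0 => /andP[/eqP hx /eqP hy].
by split; rewrite ?nz_row_eq0// dotE ?hx ?hy mxE.
Qed.

(** The reflection in u - w fixes e and takes u to w, but its determinant has the wrong
    sign; following it by a reflection in a vector orthogonal to e and w repairs this.
    Such a vector exists from dimension 3 on. *)
Lemma pole_transitive e u w : (2 < n)%N -> dot u u = dot w w -> dot e u = dot e w ->
  exists2 A, pole_stabilizer e A & u *m A = w.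
Proof.
move=> n2 uw eu; have [->|uwn] := eqVneq u w.
  exists 1%:M; last by rewrite mulmx1.
  by split; [split; [rewrite trmx1 mulmx1|rewrite det1]|rewrite mulmx1].
have [z [z0 ze zw]] := exists_orthogonal e w n2.
have fixr x y : dot x y = 0 -> x *m reflection y = x.
  by move=> xy; rewrite mulmx_reflection xy mulr0 mul0r scale0r subr0.
exists (reflection (u - w) *m reflection z); last first.
  by rewrite mulmxA reflection_swap// fixr// dotC.
split; first split.
- rewrite trmx_mul mulmxA -(mulmxA (reflection (u - w))).
  by rewrite reflection_orthogonal mulmx1 reflection_orthogonal.
- rewrite det_mulmx (@det_reflection (u - w) z)// ?subr_eq0//.
  by rewrite -expr2 det_orthogonal// reflection_orthogonal.
- by rewrite mulmxA !fixr// 1?dotC// dotDl dotNl ![dot _ e]dotC eu subrr.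
Qed.

End reflection_det.

Section support.
Context {R : realType} {n : nat} (L : set 'rV[R]_n).
Hypotheses (hL : convex_body L) (hsym : origin_symmetric L).
Implicit Types (x u w : 'rV[R]_n).
Local Notation h := (support_function L).

Lemma support_has_sup u : has_sup [set dot u x | x in L].
Proof.
have [[x0 Lx0] cL _] := hL; split; first by exists (dot u x0), x0.
have [M [Mr hM]] := compact_bounded cL.
have hM1 := hM (`|M| + 1) (le_lt_trans (ler_norm M) (ltr_pwDr ltr01 (lexx _))).
exists (\sum_i `|u 0 i| * (`|M| + 1)) => _ [x Lx <-].
apply: ler_sum => i _; apply: (le_trans (ler_norm _)); rewrite normrM ler_wpM2l//.
apply: le_trans (hM1 x Lx).
have /mapP[j Hj ->] : `|x 0 i| \in [seq `|x p.1 p.2| | p : 'I_1 * 'I_n].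
  by apply/mapP; exists (ord0, i) => //=; rewrite mem_enum.
by rewrite [leRHS]/Num.norm /= mx_normrE; apply/bigmax_geP; right => /=; exists j.
Qed.

Lemma le_support u x : L x -> dot u x <= h u.
Proof. by move=> Lx; apply: ub_le_sup; [exact: (support_has_sup u).2|exists x]. Qed.

Lemma support_le u c : (forall x, L x -> dot u x <= c) -> h u <= c.
Proof.
move=> hc; apply: ge_sup; first exact: (support_has_sup u).1.
by move=> _ [x Lx <-]; exact: hc.
Qed.

Lemma supportD u w : h (u + w) <= h u + h w.
Proof. by apply: support_le => x Lx; rewrite dotDl lerD ?le_support. Qed.

Lemma supportZ_le c u : 0 <= c -> h (c *: u) <= c * h u.
Proof. by move=> c0; apply: support_le => x Lx; rewrite dotZl ler_wpM2l ?le_support. Qed.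

Lemma support0 : h 0 = 0.
Proof.
apply/le_anti/andP; split; first by apply: support_le => x _; rewrite dot0l.
by have [[x Lx] _ _] := hL; rewrite -(dot0l x) le_support.
Qed.

Lemma supportZ c u : 0 <= c -> h (c *: u) = c * h u.
Proof.
rewrite le_eqVlt => /predU1P[<-|c0]; first by rewrite scale0r support0 mul0r.
apply/le_anti; rewrite (supportZ_le _ (ltW c0)) /=.
have ci : 0 <= c^-1 by rewrite invr_ge0 ltW.
have := supportZ_le (c *: u) ci.
have cn : c != 0 by rewrite gt_eqF.
rewrite scalerA mulVf// scale1r ler_pdivlMl//.
Qed.

Lemma supportN u : h (- u) = h u.
Proof.
have le w : h (- w) <= h w.
  apply: support_le => x Lx; rewrite dotNl -dotNr; apply: le_support; exact: hsym.
by apply/le_anti; rewrite le -{1}(opprK u) le.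
Qed.

Lemma support_ge0 u : 0 <= h u.
Proof. by have := supportD u (- u); rewrite subrr support0 supportN; lra. Qed.

Lemma supportZ_abs c u : h (c *: u) = `|c| * h u.
Proof.
have [c0|c0] := leP 0 c; first by rewrite supportZ// ger0_norm.
by rewrite -supportN -scaleNr supportZ ?oppr_ge0 ?ltW// ltr0_norm.
Qed.

Lemma support_dist u w : `|h u - h w| <= h (u - w).
Proof.
have le x y : h x - h y <= h (x - y).
  by rewrite lerBlDr -{1}(subrK y x) supportD.
rewrite ler_norml; apply/andP; split; last exact: le.
by rewrite lerNl opprB -[h (u - w)]supportN opprB le.
Qed.

Lemma support_invariant e A u : SO_invariant e L -> pole_stabilizer e A -> h (u *m A) = h u.
Proof.
move=> inv sA; have [[oA _] _] := sA; have LA := inv A sA.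
apply/le_anti/andP; split; apply: support_le => x Lx.
  have [y Ly <-] : [set x *m A | x in L] x by rewrite LA.
  by rewrite dot_orthogonal// le_support.
by rewrite -(dot_orthogonal u x oA) le_support// -LA; exists x.
Qed.

End support.

(** * The profile of a body of revolution *)
Section profile.
Context {R : realType} {n : nat} (L : set 'rV[R]_n) (e v : 'rV[R]_n).
Hypotheses (hL : convex_body L) (hsym : origin_symmetric L) (hSO : SO_invariant e L).
Hypotheses (hn : (2 < n)%N) (he : enorm e = 1) (hv : enorm v = 1) (hev : dot e v = 0).
Local Notation h := (support_function L).
Local Notation hpi := (pi / 2 : R)%R.
Implicit Types (s t a d x y : R) (u w : 'rV[R]_n).

Lemma dot_ee : dot e e = 1. Proof. by rewrite -sqr_enorm he expr1n. Qed.
Lemma dot_vv : dot v v = 1. Proof. by rewrite -sqr_enorm hv expr1n. Qed.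
Lemma dot_ve : dot v e = 0. Proof. by rewrite dotC. Qed.
Local Notation dotS := (dotDl, dotDr, dotZl, dotZr, dotNl, dotNr, dot_ee, dot_vv, hev, dot_ve).

(** The support function on the plane spanned by e and v. *)
Definition mer x y := h (x *: e + y *: v).

Lemma support_zonal u w : dot u u = dot w w -> dot e u = dot e w -> h u = h w.
Proof.
move=> uw eu; have [A sA <-] := pole_transitive hn uw eu.
by rewrite (support_invariant hL _ hSO sA).
Qed.

Lemma support_mer u : h u = mer (dot e u) (Num.sqrt (dot u u - dot e u ^+ 2)).
Proof.
have h0 : 0 <= dot u u - dot e u ^+ 2.
  have := dotxx_ge0 (u - dot e u *: e); rewrite !dotS (dotC u e); congr (0 <= _); ring.
by apply: support_zonal; rewrite !dotS; [have := sqr_sqrtr h0; set r := Num.sqrt _ => hr|]; lra.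
Qed.

Lemma merD x y x' y' : mer (x + x') (y + y') <= mer x y + mer x' y'.
Proof. by rewrite /mer !scalerDl addrACA supportD. Qed.

Lemma merZ a x y : 0 <= a -> mer (a * x) (a * y) = a * mer x y.
Proof. by move=> a0; rewrite /mer -!scalerA -scalerDr supportZ. Qed.

Lemma merN x y : mer (- x) (- y) = mer x y.
Proof. by rewrite /mer !scaleNr -opprD supportN. Qed.

Lemma mer_even x y : mer x (- y) = mer x y.
Proof. by apply: support_zonal; rewrite !dotS; ring. Qed.

Lemma mer_ge0 x y : 0 <= mer x y. Proof. exact: support_ge0. Qed.

(** (x, y') lies on the segment joining the points (x, y) and (x, - y), at which [mer]
    takes the same value. *)
Lemma mer_mono x y y' : `|y'| <= y -> mer x y' <= mer x y.
Proof.
move=> yy; have [y0|y0] := eqVneq y 0.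
  by move: yy; rewrite y0 normr_le0 => /eqP ->.
have yp : 0 < y by rewrite lt_neqAle eq_sym y0 (le_trans (normr_ge0 y')).
move: yy; rewrite ler_norml => /andP[h1 h2].
have := merD ((y + y') / (2 * y) * x) ((y + y') / (2 * y) * y)
             ((y - y') / (2 * y) * x) ((y - y') / (2 * y) * - y).
have p1 : 0 <= (y + y') / (2 * y) by apply: divr_ge0; lra.
have p2 : 0 <= (y - y') / (2 * y) by apply: divr_ge0; lra.
rewrite !merZ// mer_even.
have -> : (y + y') / (2 * y) * x + (y - y') / (2 * y) * x = x by field.
have -> : (y + y') / (2 * y) * y + (y - y') / (2 * y) * - y = y' by field.
rewrite -mulrDl.
by have -> : (y + y') / (2 * y) + (y - y') / (2 * y) = 1; [field|rewrite mul1r].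
Qed.

Lemma mer_dist x y x' y' : `|mer x y - mer x' y'| <= `|x - x'| * h e + `|y - y'| * h v.
Proof.
apply: le_trans (support_dist hL hsym _ _) _.
rewrite opprD addrACA -!scalerBl; apply: le_trans (supportD hL _ _) _.
by rewrite !supportZ_abs.
Qed.

Definition prof s := mer (sin s) (cos s).

Lemma prof_pi s : prof (s + pi) = prof s.
Proof. by rewrite /prof sinDpi cosDpi merN. Qed.

Lemma prof_even s : prof (- s) = prof s.
Proof. by rewrite /prof sinN cosN -merN opprK mer_even. Qed.

Lemma prof_lipschitz s t : `|prof s - prof t| <= (h e + h v) * `|s - t|.
Proof.
have cosE (z : R) : cos z = sin (z + pi / 2).
  by rewrite sinD cos_pihalf sin_pihalf mulr0 add0r mulr1.
apply: le_trans (mer_dist _ _ _ _) _; rewrite mulrDl; apply: lerD; rewrite mulrC.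
  by apply: ler_wpM2l; [exact: support_ge0|exact: sin_lipschitz].
apply: ler_wpM2l; first exact: support_ge0.
rewrite !cosE; apply: le_trans (sin_lipschitz _ _) _.
by rewrite opprD addrACA subrr addr0.
Qed.

Lemma prof_circ a d : 0 < d < hpi -> 2 * cos d * prof a <= prof (a + d) + prof (a - d).
Proof.
move=> /andP[d0 d1]; have c0 : 0 <= cos d.
  by apply: cos_ge0_pihalf; apply/andP; split; lra.
have c20 : 0 <= 2 * cos d by exact: mulr_ge0.
rewrite /prof -(merZ _ _ c20).
have -> : 2 * cos d * sin a = sin (a + d) + sin (a - d) by rewrite sinD sinB; ring.
have -> : 2 * cos d * cos a = cos (a + d) + cos (a - d) by rewrite cosD cosB; ring.
exact: merD.
Qed.

(** The two sides are [mer] at points with the same first coordinate, the second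
    coordinates being ordered: f / |sin| decreases on ]0, pi / 2]. *)
Lemma prof_compare s s0 : 0 <= s <= hpi -> 0 <= s0 <= hpi ->
  s <= s0 -> sin s * prof s0 <= sin s0 * prof s.
Proof.
move=> /andP[a1 a2] /andP[b1 b2] ss.
have hp := @hpi_lt_pi R; have hp0 := @hpi_gt0 R.
have s1 : 0 <= sin s by apply: sin_ge0_pi; apply/andP; split; lra.
have s2 : 0 <= sin s0 by apply: sin_ge0_pi; apply/andP; split; lra.
have c2 : 0 <= cos s0 by apply: cos_ge0_pihalf; apply/andP; split; lra.
rewrite /prof -!merZ// (mulrC (sin s0) (sin s)); apply: mer_mono.
rewrite ger0_norm ?mulr_ge0//.
have : 0 <= sin (s0 - s) by apply: sin_ge0_pi; apply/andP; split; lra.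
by rewrite sinB; lra.
Qed.

Lemma dot_unit_bound u : dot u u = 1 -> -1 <= dot e u <= 1.
Proof.
move=> uu; have h1 := dotxx_ge0 (u - dot e u *: e).
rewrite -ler_norml -(@expr_le1 _ 2)// real_normK ?num_real//.
by move: h1; rewrite !dotS (dotC u e) uu; lra.
Qed.

Lemma prof_pos : L <> [set 0] -> exists2 s, - hpi <= s <= hpi & 0 < prof s.
Proof.
move=> L0; have [x Lx x0] : exists2 x, L x & x != 0.
  apply: contrapT => H; apply: L0; apply/seteqP; split => x /=.
    by move=> Lx; apply: contrapT => /eqP x0; apply: H; exists x.
  have [[y Ly] _ _] := hL; move=> ->; have [<-//|y0] := eqVneq y 0.
  by exfalso; apply: H; exists y.
pose u := (enorm x)^-1 *: x.
have nx : 0 < enorm x by rewrite lt_neqAle enorm_ge0 eq_sym enorm_eq0 x0.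
have uu : dot u u = 1 by rewrite /u dotZl dotZr -sqr_enorm; field; rewrite gt_eqF.
have hu : 0 < h u.
  apply: lt_le_trans (le_support hL u Lx); rewrite /u dotZl -sqr_enorm.
  by rewrite mulr_gt0 ?invr_gt0// exprn_gt0.
have eu := dot_unit_bound uu.
exists (asin (dot e u)); first by rewrite asin_geNpi2// asin_lepi2.
rewrite /prof asinK ?in_itv//= cos_asin//; move: hu; rewrite support_mer uu.
by [].
Qed.

End profile.

(** * Legendre coefficients through the profile *)
Section coef.
Context {R : realType} (m : nat).
Local Notation hpi := (pi / 2 : R)%R.
Implicit Types (e v : 'rV[R]_m.+3) (L : set 'rV[R]_m.+3).

Lemma legendre_coef_prof : exists2 C : R, 0 < C & forall L e v,
  convex_body L -> origin_symmetric L -> SO_invariant e L ->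
  enorm e = 1 -> enorm v = 1 -> dot e v = 0 ->
  forall k (P : {poly R}), (forall t, -1 <= t <= 1 -> legendre m.+3 k t = P.[t]) ->
  legendre_coef e k L =
    C * RI (- hpi) hpi (fun s => prof L e v s * (P.[sin s] * cos s ^+ m.+1)).
Proof.
have [C C0 hC] := @sphere_zonal R m; exists C => // L e v hL hsym hSO he hv hev k P hP.
pose Phi t := mer L e v t (Num.sqrt (1 - t ^+ 2)) * P.[t].
have cM : continuous (fun t => mer L e v t (Num.sqrt (1 - t ^+ 2))).
  have cs : continuous (fun t : R => Num.sqrt (1 - t ^+ 2)).
    move=> x; apply: (@cont_at_comp _ Num.sqrt (fun x => 1 - x ^+ 2)); last by cont1.
    exact: sqrt_continuous.
  move=> x; pose G t := `|x - t| * support_function L e +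
    `|Num.sqrt (1 - x ^+ 2) - Num.sqrt (1 - t ^+ 2)| * support_function L v.
  have cG : continuous G by rewrite /G; cont.
  have Gx : G x = 0 by rewrite /G !subrr normr0 !mul0r addr0.
  apply/cvgrPdist_lt => eps eps0.
  have /cvgrPdist_lt/(_ _ eps0) := cG x; apply: filterS => t.
  rewrite Gx sub0r normrN => ht; apply: le_lt_trans ht; apply: le_trans (ler_norm _).
  exact: mer_dist.
have cPhi : continuous Phi by rewrite /Phi; cont.
rewrite /legendre_coef (@eq_Rintegral _ _ _ _ _ (fun u => Phi (dot e (rowt u)))); last first.
  move=> u; rewrite inE /sphere /= => hu.
  have uu : dot (rowt u) (rowt u) = 1 by rewrite -sqr_enorm hu expr1n.
  rewrite hP; last exact: (dot_unit_bound he uu).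
  by rewrite (support_mer hL hSO _ he hv hev) ?uu.
rewrite hC//; congr (_ * _); apply: eq_RI => s hs.
rewrite /Phi /prof -mulrA; congr (mer _ _ _ _ _ * _).
by rewrite -cos2sin2 sqrtr_sqr ger0_norm// cos_ge0_pihalf.
Qed.

End coef.

Section flat_equator.
Context {R : realType} {n : nat}.
Implicit Types (e v w x : 'rV[R]_n) (L : set 'rV[R]_n).

Lemma continuous_dot e : continuous (dot e : 'rV[R]_n -> R).
Proof.
suff H r : continuous (fun y : 'rV[R]_n => \sum_(i <- r) e 0 i * y 0 i) by exact: H.
elim: r => [|i r ih] x.
  rewrite (_ : (fun _ => _) = (fun=> 0)); last by apply/funext => y; rewrite big_nil.
  exact: cst_continuous.
rewrite (_ : (fun _ => _) = (fun y : 'rV[R]_n => e 0 i * y 0 i + \sum_(j <- r) e 0 j * y 0 j)).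
  apply: (@continuousD _ _ _ (fun y : 'rV[R]_n => e 0 i * y 0 i)); last exact: ih.
  apply: (@continuousM _ _ (fun=> e 0 i) (fun y : 'rV[R]_n => y 0 i)).
    exact: cst_continuous.
  exact: coord_continuous.
by apply/funext => y; rewrite big_cons.
Qed.

(** The difference quotient is constant. *)
Lemma derive_dot (c : R) e w x : 'D_w (fun y => c * dot e y) x = c * dot e w.
Proof.
rewrite /derive; apply: cvg_lim => //; apply: cvg_near_cst.
near=> t; have t0 : t != 0 by near: t; exact: nbhs_dnbhs_neq.
by rewrite /= dotDr dotZr mulrDr addrK /GRing.scale/= mulrCA mulKf.
Unshelve. all: by end_near. Qed.

(** If h vanishes at v, it vanishes on the whole equator, so h(x) = h(e) |e . x|.  This is
    linear near e, hence has a zero Hessian there. *)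
Lemma C2_plus_equator L e v : (2 < n)%N -> convex_body L -> origin_symmetric L ->
  SO_invariant e L -> enorm e = 1 -> enorm v = 1 -> dot e v = 0 ->
  C2_plus L -> 0 < support_function L v.
Proof.
move=> n2 hL hsym hSO he hv hev [_ hC].
set h := support_function L.
rewrite lt_neqAle (support_ge0 hL hsym) andbT eq_sym; apply/eqP => hv0.
have ee : dot e e = 1 by rewrite -sqr_enorm he expr1n.
have hE x : h x = h e * `|dot e x|.
  rewrite /h (support_mer hL hSO n2 he hv hev).
  set r := Num.sqrt _; have := mer_dist e v hL hsym (dot e x) r (dot e x) 0.
  rewrite [support_function L v]hv0 subrr normr0 mulr0 mul0r addr0 normr_le0 subr_eq0 => /eqP ->.
  by rewrite /mer scale0r addr0 (supportZ_abs hL hsym) mulrC.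
have pE i x : 0 < dot e x -> partial i h x = h e * dot e (delta_mx 0 i).
  move=> ex; rewrite /partial -(derive_dot (h e) e (delta_mx 0 i) x).
  apply: near_eq_derive.
  have near_pos := cvgr_gt _ (@continuous_dot e x) _ ex.
  near=> y; have ey : 0 < dot e y by near: y; exact: near_pos.
  by rewrite hE ger0_norm// ltW.
have H0 : hessian h e = 0.
  apply/matrixP => i j; rewrite !mxE /partial.
  rewrite -[RHS](derive_cst (h e * dot e (delta_mx 0 i)) e (delta_mx 0 j)).
  apply: near_eq_derive.
  have e0 : 0 < dot e e by rewrite ee.
  have near_pos := cvgr_gt _ (@continuous_dot e e) _ e0.
  near=> y; have ey : 0 < dot e y by near: y; exact: near_pos.
  exact: pE.
have v0 : v != 0 by rewrite -enorm_eq0 hv oner_eq0.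
by have := hC e he v v0 hev; rewrite H0 mulmx0 dot0l ltxx.
Unshelve. all: by end_near. Qed.

End flat_equator.

(** * Multiplier bounds *)
Section multiplier.
Context {R : realType} (m : nat) (f : R -> R) (K : R).
Local Notation hpi := (pi / 2 : R)%R.
Hypotheses (fK : forall x y, `|f x - f y| <= K * `|x - y|) (fpi : forall x, f (x + pi) = f x).
Hypothesis fcirc : forall a d, 0 < d < hpi -> 2 * cos d * f a <= f (a + d) + f (a - d).
Implicit Types (l : nat) (c sg t a : R) (p q : {poly R}).

Definition pairing p := RI (- hpi) hpi (fun s => f s * (p.[sin s] * cos s ^+ m.+1)).

Lemma prof_continuous : continuous f. Proof. exact: lipschitz_continuous fK. Qed.

Lemma pairing_comb c p q : pairing (c *: p + q) = c * pairing p + pairing q.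
Proof.
have cf := prof_continuous.
rewrite /pairing -RI_Z; last by cont.
rewrite -RI_D; [|by cont|by cont].
by apply: eq_RI => s _; rewrite hornerD hornerZ; ring.
Qed.

Lemma lap_comb c p q : lap m (c *: p + q) = c *: lap m p + lap m q.
Proof. by rewrite /lap !(derivD, derivZ) -!mul_polyC; ring. Qed.

Lemma lapZ c p : lap m (c *: p) = c *: lap m p.
Proof. by rewrite /lap !derivZ -!mul_polyC; ring. Qed.

Lemma lap_leg l : lap m (leg m l : {poly R}) =
  - ((l.*2%:R - 1) * (m%:R + 2 + l.*2%:R)) *: leg m l.
Proof.
by rewrite leg_Q lapZ lap_Q !scalerA mulrC.
Qed.

Lemma leg_even l t : (leg m l : {poly R}).[- t] = (leg m l).[t].
Proof.
by rewrite leg_Q !hornerZ Q_parity -signr_odd odd_double expr0 mul1r.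
Qed.

Lemma pairing_lap_ge0 p : (forall t, p.[- t] = p.[t]) ->
  (forall a, 0 <= a <= hpi -> 0 <= Lam m p a) -> 0 <= pairing (lap m p).
Proof.
move=> pe p0; apply: (sine_transform_pairing_ge0 fK fpi fcirc); first by cont.
move=> a ha; rewrite sine_transform_lap// mulr_ge0//.
have [a0|a0] := leP 0 a; first by apply: p0; rewrite a0; case/andP: ha.
rewrite -(LamN m pe ha); apply: p0; move: ha => /andP[h1 h2]; apply/andP; split; lra.
Qed.

(** Positivity at p = c + sg (m + 2) P, divided by m + 2. *)
Lemma pairing_leg_ge0 l c sg :
  (forall a, 0 <= a <= hpi -> 0 <= c * Lx m 0 a + sg * (m.+2%:R * Lam m (leg m l) a)) ->
  0 <= c * pairing 1 - sg * ((l.*2%:R - 1) * (m%:R + 2 + l.*2%:R) * pairing (leg m l)).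
Proof.
(* The constant polynomial is written 'X^0 to match the definition of Lx m 0. *)
move=> H; pose p : {poly R} := c *: 'X^0 + (sg * m.+2%:R) *: leg m l.
have pe t : p.[- t] = p.[t] by rewrite /p !hornerD !hornerZ leg_even !hornerXn !expr0.
have := @pairing_lap_ge0 p pe.
have -> : lap m p = (c * m.+2%:R) *: 1 +
    (- (sg * m.+2%:R * ((l.*2%:R - 1) * (m%:R + 2 + l.*2%:R)))) *: leg m l.
  rewrite /p lap_comb lapZ lap_leg expr0; congr (_ + _); last by rewrite scalerA mulrN.
  by rewrite /lap -polyC1 derivC deriv0 !(mulr0, scaler0, addr0) subr0 scalerA.
rewrite -[X in _ *: 1 + X]addr0 !pairing_comb.
have -> : pairing 0 = 0.
  by have := pairing_comb 1 0 0; rewrite scale1r addr0 mul1r; lra.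
set N := (l.*2%:R - 1) * _; have m0 : 0 < m.+2%:R :> R by rewrite ltr0n.
move=> h; rewrite -(pmulr_rge0 _ m0).
have -> : m.+2%:R * (c * pairing 1 - sg * (N * pairing (leg m l))) =
  c * m.+2%:R * pairing 1 + (- (sg * m.+2%:R * N) * pairing (leg m l) + 0) by ring.
apply: h => a ha; have /andP[a0 _] := ha; rewrite /p Lam_comb// LamZ//.
by have := H a ha; rewrite mulrA.
Qed.

Lemma pairing_leg_lt l : (2 <= l)%N -> 0 < pairing 1 ->
  (l.*2%:R - 1) * (m%:R + 2 + l.*2%:R) * `|pairing (leg m l)| < pairing 1.
Proof.
move=> l2 A0; set N := (l.*2%:R - 1) * (m%:R + 2 + l.*2%:R).
have l1 : 2 <= l.*2%:R :> R by rewrite (ler_nat R 2) (leq_trans l2)// -addnn leq_addr.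
have N0 : 0 <= N.
  have m0 : 0 <= m%:R :> R by [].
  by apply: mulr_ge0; move: l1; set x := l.*2%:R => l1; lra.
have bnd a : 0 <= a <= hpi -> `|m.+2%:R * Lam m (leg m l) a| <= 99 / 100 * Lx m 0 a.
  by move=> ha; rewrite normrM ger0_norm// Lam_leg_bound.
have h1 : 0 <= 99 / 100 * pairing 1 - 1 * (N * pairing (leg m l)).
  apply: pairing_leg_ge0 => a ha; rewrite mul1r.
  by have := bnd a ha; rewrite ler_norml => /andP[? ?]; lra.
have h2 : 0 <= 99 / 100 * pairing 1 - (-1) * (N * pairing (leg m l)).
  apply: pairing_leg_ge0 => a ha; rewrite mulN1r.
  by have := bnd a ha; rewrite ler_norml => /andP[? ?]; lra.
rewrite -[N]ger0_norm// -normrM ltr_norml; apply/andP; split; lra.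
Qed.

Lemma pairing_leg1_bounds :
  - (1 / 2 * pairing 1) <= (m%:R + 4) * pairing (leg m 1) <= pairing 1.
Proof.
have E : (1.*2%:R - 1) * (m%:R + 2 + 1.*2%:R) * pairing (leg m 1) =
    (m%:R + 4) * pairing (leg m 1).
  by rewrite (_ : 1.*2 = 2%N)//; ring.
have h1 : 0 <= 1 * pairing 1 - 1 * ((m%:R + 4) * pairing (leg m 1)).
  rewrite -E; apply: pairing_leg_ge0 => a ha; rewrite !mul1r.
  by have := Lam_leg1_ge m ha; lra.
have h2 : 0 <= 1 / 2 * pairing 1 - (-1) * ((m%:R + 4) * pairing (leg m 1)).
  rewrite -E; apply: pairing_leg_ge0 => a ha; rewrite mulN1r.
  by have := Lam_leg1_le m ha; lra.
by apply/andP; split; lra.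
Qed.

Lemma pairing_odd p : (forall s, f (- s) = f s) -> (forall t, -1 <= t <= 1 -> p.[- t] = - p.[t]) ->
  pairing p = 0.
Proof.
move=> fe po; have cf := prof_continuous.
have hp0 := ltW (@hpi_gt0 R).
have cg : continuous (fun s => f s * (p.[sin s] * cos s ^+ m.+1)) by cont.
have := RI_reflect hp0 cg; rewrite -/(pairing p).
have -> : RI (- hpi) hpi (fun s => f (- s) * (p.[sin (- s)] * cos (- s) ^+ m.+1)) = - pairing p.
  rewrite /pairing -[RHS]mulN1r -RI_Z//; apply: eq_RI => s _.
  by rewrite fe sinN cosN po ?sin_geN1 ?sin_le1//; ring.
lra.
Qed.

Lemma pairing1_gt0 s : (forall x, 0 <= f x) -> - hpi <= s <= hpi -> 0 < f s -> 0 < pairing 1.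
Proof.
move=> f0 hs fs; have cf := prof_continuous; have hp := @hpi_gt0 R.
have hh : - hpi < hpi by lra.
have cg : continuous (fun s => f s * ((1 : {poly R}).[sin s] * cos s ^+ m.+1)) by cont.
have g0 x : - hpi <= x <= hpi -> 0 <= f x * ((1 : {poly R}).[sin x] * cos x ^+ m.+1).
  by move=> hx; rewrite hornerC mul1r mulr_ge0// exprn_ge0// cos_ge0_pihalf.
have pos x : - hpi < x < hpi -> 0 < f x -> 0 < pairing 1.
  move=> hx fx; apply: (@RI_gt0 _ _ _ _ x hh cg g0); first by case/andP: hx => *; rewrite !ltW.
  by rewrite hornerC mul1r mulr_gt0// exprn_gt0// cos_gt0_pihalf.
have nbh : \forall x \near s, 0 < f x by exact: (cvgr_gt _ (cf s) _ fs).
have /nbhs_ballP[eps /= eps0 B] := nbh.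
(* The weight cos^{m+1} vanishes at both end points: move s slightly inwards. *)
pose w := Num.min (1 / 2) (eps / (2 * (hpi + 1))).
have q0 : 0 < 2 * (hpi + 1) by lra.
have w0 : 0 < w by rewrite /w lt_min !divr_gt0.
have w1 : w <= 1 / 2 by rewrite /w ge_min lexx.
have w2 : w * (2 * (hpi + 1)) <= eps by rewrite -ler_pdivlMr// /w ge_min lexx orbT.
apply: (pos ((1 - w) * s)).
  by move: hs => /andP[h1 h2]; apply/andP; split; nra.
apply: B; rewrite /ball/= ltr_norml; move: hs => /andP[h1 h2]; apply/andP; split; nra.
Qed.

End multiplier.

(** * The quadratic coefficient *)
Section strict.
Context {R : realType} (m : nat) (L : set 'rV[R]_m.+3) (e v : 'rV[R]_m.+3).
Hypotheses (hL : convex_body L) (hsym : origin_symmetric L) (hSO : SO_invariant e L).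
Hypotheses (he : enorm e = 1) (hv : enorm v = 1) (hev : dot e v = 0).
Local Notation hpi := (pi / 2 : R)%R.
Local Notation f := (prof L e v).

(** 1 - (n+1) P_2(t) is proportional to 2 - (n+1) t^2, whose |sin|-weighted integral is
    zero.  With s0 its zero, f(s) sin s0 - f(s0) |sin s| has the same sign as
    2 - (n+1) sin^2 s for every s, and it does not vanish at s = 0. *)
Lemma pairing_leg1_lt : 0 < f 0 ->
  (m%:R + 4) * pairing m f (leg m 1) < pairing m f 1.
Proof.
move=> f00; have hp := @hpi_gt0 R; have hp1 := @hpi_lt_pi R.
have fK := prof_lipschitz e v hL hsym.
have cf : continuous f := prof_continuous fK.
have m0 : 0 <= m%:R :> R by [].
have m4 : 0 < m%:R + 4 :> R by lra.
pose sg : R := Num.sqrt (2 / (m%:R + 4)).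
have sg2 : sg ^+ 2 * (m%:R + 4) = 2.
  by rewrite sqr_sqrtr ?divr_ge0 ?ltW// mulfVK// gt_eqF.
have sg0 : 0 < sg by rewrite sqrtr_gt0 divr_gt0.
have sg1 : sg <= 1 by nra.
have sgB : -1 <= sg <= 1 by apply/andP; split; lra.
pose s0 := asin sg; have ss0 : sin s0 = sg by rewrite asinK// in_itv/=.
have s0h : s0 <= hpi by exact: asin_lepi2.
have s00 : 0 <= s0.
  rewrite leNgt; apply/negP => h; have h2 : - hpi <= s0 by exact: asin_geNpi2.
  have : 0 <= sin (- s0) by apply: sin_ge0_pi; apply/andP; split; lra.
  by rewrite sinN ss0; lra.
pose w s := (lap m ('X^2 : {poly R})).[sin s] * cos s ^+ m.+1.
have cw : continuous w by rewrite /w; cont.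
have lapE t : (lap m ('X^2 : {poly R})).[t] = 2 - (m%:R + 4) * t ^+ 2.
  have d1 : ('X^2 : {poly R})^`() = 'X *+ 2 by rewrite derivXn.
  have d2 : ('X *+ 2 : {poly R})^`() = 1 *+ 2 by rewrite derivMn derivX.
  rewrite horner_lap d1 d2 !hornerMn hornerX hornerXn hornerC -(addn2 m) natrD; ring.
pose g s := sg * (f s * w s) - f s0 * (`|sin (s - 0)| * w s).
have cg : continuous g by rewrite /g; cont.
have g0 s : - hpi <= s <= hpi -> 0 <= g s.
  move=> hs.
  have fs : f s = f `|s|.
    by case: (ler0P s) => // _; rewrite (prof_even hL hsym hSO (isT : (2 < m.+3)%N) he hv hev).
  have rh : `|s| <= hpi by rewrite ler_norml.
  have r0 := normr_ge0 s.
  have sr0 : 0 <= sin `|s| by apply: sin_ge0_pi; apply/andP; split; lra.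
  have ss : `|sin s| = sin `|s|.
    by rewrite -[RHS]ger0_norm//; case: (ler0P s) => _; rewrite ?sinN ?normrN.
  have ss2 : sin s ^+ 2 = sin `|s| ^+ 2 by rewrite -ss real_normK// num_real.
  have c0 : 0 <= cos s ^+ m.+1 by rewrite exprn_ge0// cos_ge0_pihalf.
  rewrite /g subr0 /w lapE ss ss2 fs.
  have -> : sg * (f `|s| * ((2 - (m%:R + 4) * sin `|s| ^+ 2) * cos s ^+ m.+1)) -
     f s0 * (sin `|s| * ((2 - (m%:R + 4) * sin `|s| ^+ 2) * cos s ^+ m.+1)) =
     (sg * f `|s| - sin `|s| * f s0) * (2 - (m%:R + 4) * sin `|s| ^+ 2) * cos s ^+ m.+1 by ring.
  apply: mulr_ge0 => //.
  have I1 : 0 <= `|s| <= hpi by rewrite r0.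
  have I2 : 0 <= s0 <= hpi by rewrite s00.
  have J1 : `|s| \in `[(- hpi), hpi] by rewrite in_itv/=; apply/andP; split; lra.
  have J2 : s0 \in `[(- hpi), hpi] by rewrite in_itv/=; apply/andP; split; lra.
  have [h|h] := leP `|s| s0.
    have := prof_compare hL hSO (isT : (2 < m.+3)%N) he hv hev I1 I2 h; rewrite ss0 => h1.
    have h2 : sin `|s| <= sg by rewrite -ss0 leNgt (ltr_sin J2 J1) -leNgt.
    have h3 : sin `|s| ^+ 2 <= sg ^+ 2 by rewrite lerXn2r// nnegrE ltW.
    apply: mulr_ge0; first by rewrite subr_ge0.
    by rewrite -sg2 mulrC -mulrBr mulr_ge0 ?subr_ge0// ltW.
  have := prof_compare hL hSO (isT : (2 < m.+3)%N) he hv hev I2 I1 (ltW h); rewrite ss0 => h1.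
  have h2 : sg <= sin `|s| by rewrite -ss0 leNgt (ltr_sin J1 J2) -leNgt ltW.
  have h3 : sg ^+ 2 <= sin `|s| ^+ 2 by rewrite lerXn2r// nnegrE ltW.
  rewrite -mulrNN !opprB; apply: mulr_ge0; first by rewrite subr_ge0.
  by rewrite -sg2 [X in _ - X]mulrC -mulrBr mulr_ge0 ?subr_ge0// ltW.
have gp : 0 < RI (- hpi) hpi g.
  apply: (@RI_gt0 _ _ _ _ 0 _ cg g0); [lra|by apply/andP; split; lra|].
  rewrite /g /w subr0 sin0 normr0 mul0r mulr0 subr0 cos0 expr1n lapE expr0n /=.
  by rewrite mulr0 subr0 mulr1 !mulr_gt0.
have ev t : ('X^2 : {poly R}).[- t] = ('X^2).[t] by rewrite !hornerXn sqrrN.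
have h00 : - hpi <= 0 <= hpi by apply/andP; split; lra.
have V0 : RI (- hpi) hpi (fun s => `|sin (s - 0)| * w s) = 0.
  rewrite /w (sine_transform_lap m ev h00) /Lam sin0 hornerXn expr0n /=.
  by rewrite mul0r mulr0 mul0r addr0 mulr0.
move: gp; rewrite /g RI_B; [|by cont|by cont].
rewrite !RI_Z; [|by cont|by cont].
rewrite V0 mulr0 subr0 pmulr_rgt0// => gp.
have E : pairing m f 1 - (m%:R + 4) * pairing m f (leg m 1) =
    (m%:R + 3) / (m%:R + 2) * RI (- hpi) hpi (fun s => f s * w s).
  have cp (p : {poly R}) : continuous (fun s => f s * (p.[sin s] * cos s ^+ m.+1)) by cont.
  rewrite /pairing -!RI_Z; [|by cont|exact: cp].
  rewrite -RI_B; [|exact: cp|by cont].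
  apply: eq_RI => s _; rewrite /w lapE hornerC horner_leg big_ord_recl big_ord1 /=.
  have m2 : m%:R + 2 != 0 :> R by rewrite gt_eqF//; lra.
  have mu1 : mu m 1 = (m%:R + 2)^-1 :> R.
    apply: (mulfI m2); rewrite mulfV//; have := @muS R m 0.
    by rewrite (_ : mu m 0 = 1)// !mulr1 double0 natrD => ->.
  rewrite (_ : fintype.bump 0 0 = 1%N)// (_ : 'C(1.*2, 0.*2) = 1%N)//.
  rewrite (_ : 'C(1.*2, 1.*2) = 1%N)// (_ : (1 - 0).*2 = 2%N)// (_ : (1 - 1).*2 = 0%N)//.
  by rewrite mu1 (_ : mu m 0 = 1)// !expr0 expr1; field.
by rewrite -subr_gt0 E mulr_gt0// divr_gt0//; lra.
Qed.

End strict.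

Theorem theorem5p5 (R : realType) (n : nat) (hn : (3 <= n)%N)
    (e : 'rV[R]_n) (he : enorm e = 1)
    (L : set 'rV[R]_n) (hL : convex_body L)
    (hsym : origin_symmetric L) (hSO : SO_invariant e L) :
  [/\ L <> [set 0] ->
        forall k : nat, (2 < k)%N ->
          `|legendre_coef e k L| <
            legendre_coef e 0 L / ((k%:R - 1) * (n%:R + k%:R - 1)),
      `|legendre_coef e 2 L| <= legendre_coef e 0 L / (n%:R + 1)
    & C2_plus L ->
        `|legendre_coef e 2 L| < legendre_coef e 0 L / (n%:R + 1)].
Proof.
case: n hn e he L hL hsym hSO => [|[|[|m]]]// hn e he L hL hsym hSO.
have [z [z0 ze _]] := exists_orthogonal e e hn.
pose v := (enorm z)^-1 *: z.
have hv : enorm v = 1.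
  by rewrite enormZ ger0_norm ?invr_ge0 ?enorm_ge0// mulVf// enorm_eq0.
have hev : dot e v = 0 by rewrite /v dotZr dotC ze mulr0.
have [C C0 /(_ L e v hL hsym hSO he hv hev) coefE] := @legendre_coef_prof R m.
have fK := prof_lipschitz e v hL hsym; have fpi := prof_pi e v hL hsym.
have fcirc := prof_circ e v hL.
have fe := prof_even hL hsym hSO hn he hv hev.
have f0 x : 0 <= prof L e v x by exact: mer_ge0.
have m0 : 0 <= m%:R :> R by [].
have a0 : legendre_coef e 0 L = C * pairing m (prof L e v) 1.
  rewrite (coefE 0%N 1)// => t ht; have -> : 0%N = 0.*2 by [].
  rewrite legendre_even// horner_leg big_ord1 !expr0 hornerC. by rewrite !mulr1.
have a_even l : legendre_coef e l.*2 L = C * pairing m (prof L e v) (leg m l).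
  by apply: coefE => t ht; rewrite legendre_even.
have n3 : m.+3%:R = m%:R + 3 :> R by rewrite -(addn3 m) natrD.
have A0 : L <> [set 0] -> 0 < pairing m (prof L e v) 1.
  by move=> /(prof_pos hL hSO hn he hv hev)[s hs fs]; exact: pairing1_gt0 fK _ f0 hs fs.
have m4 : 0 < m%:R + 3 + 1 :> R by lra.
have /andP[b1 b2] := pairing_leg1_bounds m fK fpi fcirc.
have A_ge0 : 0 <= pairing m (prof L e v) 1 by lra.
split.
- move=> /A0 Apos k k2.
  have k2' : 2 < k%:R :> R by rewrite ltr_nat.
  have N0 : 0 < (k%:R - 1) * (m.+3%:R + k%:R - 1) :> R by rewrite mulr_gt0//; lra.
  rewrite ltr_pdivlMr// a0.
  have [ok|ek] := boolP (odd k).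
    rewrite (coefE k (((-1) ^+ k / (2 ^+ k * ff (m%:R / 2 + k%:R) k)) *: Q (m%:R / 2 + k%:R) k)); last first.
      by move=> t ht; rewrite legendre_horner// hornerZ.
    rewrite -/(pairing _ _ _) (pairing_odd m fK)//; first by rewrite mulr0 normr0 mul0r mulr_gt0.
    move=> t ht; rewrite !hornerZ Q_parity.
    have -> : (-1) ^+ k = -1 :> R by rewrite -signr_odd ok expr1.
    by ring.
  have kE : k = k./2.*2 by rewrite -[LHS]odd_double_half (negbTE ek).
  have l2 : (2 <= k./2)%N by move: k2; rewrite {1}kE; case: (k./2) => [|[|]].
  have := pairing_leg_lt fK fpi fcirc l2 Apos; rewrite -kE => h.
  rewrite {1}kE a_even normrM (gtr0_norm C0) -mulrA ltr_pM2l// n3.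
  by apply: le_lt_trans h; rewrite le_eqVlt; apply/orP; left; apply/eqP; ring.
- have -> : 2%N = 1.*2 by []; rewrite a_even a0 n3 ler_pdivlMr// normrM (gtr0_norm C0) -mulrA ler_pM2l//.
  by rewrite -[X in _ * X](gtr0_norm m4) -normrM ler_norml; apply/andP; split; lra.
- move=> hC; have f00 : 0 < prof L e v 0.
    rewrite /prof sin0 cos0 /mer scale0r add0r scale1r.
    exact: (C2_plus_equator hn hL hsym hSO he hv hev hC).
  have h1 := pairing_leg1_lt hL hsym hSO he hv hev f00.
  have Apos : 0 < pairing m (prof L e v) 1.
    have h00 : - (pi / 2) <= (0 : R) <= pi / 2.
      by have := @hpi_gt0 R => hp; apply/andP; split; lra.
    exact: pairing1_gt0 fK _ f0 h00 f00.
  have -> : 2%N = 1.*2 by []; rewrite a_even a0 n3 ltr_pdivlMr// normrM (gtr0_norm C0) -mulrA ltr_pM2l//.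
  by rewrite -[X in _ * X](gtr0_norm m4) -normrM ltr_norml; apply/andP; split; lra.
Qed.
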